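(* Let $C$ be a tilted algebra, let $E=\mathrm{Ext}^2_C(DC,C)$, and let $B=C\ltimes E$ be the corresponding cluster-tilted algebra. Then: (a) The right $C$-module $DE=D({}_CE)$ is a (classical) partial tilting and $\tau_C$-rigid $C$-module, and its induced module $DE\otimes_C B$ is a (classical) partial tilting and $\tau_B$-rigid $B$-module. (b) The right $C$-module $E=E_C$ is a partial cotilting and $\tau_C$-corigid $C$-module, and its coinduced module $D(B\otimes_C DE)$, where here $DE=D(E_C)$ is regarded as a left $C$-module, is a partial cotilting and $\tau_B$-corigid $B$-module.
   Context: All algebras are basic and finite dimensional over an algebraically closed field $k$; modules are finitely generated right modules unless stated otherwise; $D=\mathrm{Hom}_k(-,k)$ is the standard duality; $\tau_\Lambda$ is the Auslander-Reiten translation in $\mathrm{mod}\,\Lambda$. A tilted algebra is $C=\mathrm{End}_A T$, where $A=kQ$ is the path algebra of a finite connected quiver $Q$ without oriented cycles and $T$ is a basic tilting $A$-module. $E=\mathrm{Ext}^2_C(DC,C)$ is a $C$-$C$-bimodule; the relation extension (trivial extension) $B=C\ltimes E$ has underlying space $C\oplus E$ and multiplication $(c,e)(c',e')=(cc',ce'+ec')$, and it is the cluster-tilted algebra corresponding to $C$. $C$ is a subalgebra of $B$ with the same identity. For $M\in\mathrm{mod}\,C$ the induced module is $M\otimes_C B$ and the coinduced module is $D(B\otimes_C DM)$; both are right $B$-modules. A $\Lambda$-module $M$ is (classical) partial tilting if $\mathrm{pd}_\Lambda M\le 1$ and $\mathrm{Ext}^1_\Lambda(M,M)=0$; partial cotilting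 if $\mathrm{id}_\Lambda M\le 1$ and $\mathrm{Ext}^1_\Lambda(M,M)=0$; $\tau_\Lambda$-rigid if $\mathrm{Hom}_\Lambda(M,\tau_\Lambda M)=0$; $\tau_\Lambda$-corigid if $\mathrm{Hom}_\Lambda(\tau_\Lambda^{-1}M,M)=0$. *)

(* Defs.v *)
From HB Require Import structures.
From mathcomp Require Import all_boot all_algebra all_field ring.
Set Implicit Arguments.
Unset Strict Implicit.
Unset Printing Implicit Defensive.
Import GRing.Theory.
Local Open Scope ring_scope.

Section LinearMaps.
Variable k : fieldType.

Definition mklin (V W : vectType k) (f : V -> W) (hf : linear f) : 'Hom(V, W) :=
  linfun (HB.pack_for {linear V -> W} f (GRing.isLinear.Build k V W *:%R f hf)).

Lemma mklinE (V W : vectType k) (f : V -> W) (hf : linear f) : mklin hf =1 f.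
Proof. by move=> x; rewrite /mklin lfunE. Qed.

Lemma lin_ext (V W : vectType k) (f g : V -> W) : linear f -> linear g ->
  (forall i : 'I_(\dim {:V}), f (vbasis {:V})`_i = g (vbasis {:V})`_i) -> f =1 g.
Proof.
move=> hf hg e x; rewrite -(mklinE hf) -(mklinE hg).
rewrite (coord_vbasis (memvf x)) !linear_sum; apply: eq_bigr => i _.
by rewrite !linearZ /= !mklinE e.
Qed.

Definition dualv (V : vectType k) : vectType k := 'Hom(V, k^o).

(* The quotient of V by U is realised on the chosen complement of U; only
   vpi_eq0 and vpiK below are relevant. *)
Definition vquot (V : vectType k) (U : {vspace V}) : vectType k := subvs_of (U^C)%VS.

Definition vpi (V : vectType k) (U : {vspace V}) : V -> vquot U :=
  fun v => vsproj (U^C)%VS (daddv_pi (U^C)%VS U v).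

Definition vrepr (V : vectType k) (U : {vspace V}) (q : vquot U) : V := vsval q.

Section Quot.
Variables (V : vectType k) (U : {vspace V}).

Lemma vpi_linear : linear (@vpi V U).
Proof. by move=> c x y; rewrite /vpi !linearP. Qed.

Lemma vreprP : linear (@vrepr V U).
Proof. by move=> c x y; rewrite /vrepr linearP. Qed.

Lemma capCv : ((U^C) :&: U = 0)%VS.
Proof. by rewrite capvC capv_compl. Qed.

Lemma vpiK : cancel (@vrepr V U) (@vpi V U).
Proof.
by move=> q; rewrite /vpi /vrepr daddv_pi_id ?capCv ?subvsP // vsvalK.
Qed.

Lemma vpi_decomp v : v - vrepr (vpi U v) \in U.
Proof.
rewrite /vpi /vrepr vsprojK ?memv_pi //.
have h : v \in (U^C + U)%VS by rewrite addvC addv_complf memvf.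
by rewrite -{1}(daddv_pi_add capCv h) addrC addKr memv_pi.
Qed.

Lemma vpi_eq0 v : (vpi U v == 0) = (v \in U).
Proof.
apply/eqP/idP => [e|Uv].
  by have := vpi_decomp v; rewrite e [vrepr 0](linear0 vsval) subr0.
apply: subvs_inj; rewrite [RHS](linear0 vsval).
have h : vrepr (vpi U v) \in U.
  by rewrite -[X in X \in _](subKr v) memvB ?vpi_decomp.
have : vrepr (vpi U v) \in ((U^C) :&: U)%VS by rewrite memv_cap h subvsP.
by rewrite capCv memv0 => /eqP.
Qed.

Lemma vpi_eq v w : (vpi U v = vpi U w) <-> (v - w \in U).
Proof.
rewrite -vpi_eq0; have -> : vpi U (v - w) = vpi U v - vpi U w.
  by rewrite /vpi !linearB.
by split=> [->|/eqP/subr0_eq //]; rewrite subrr.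
Qed.

End Quot.
End LinearMaps.

Section Bimodules.
Variable k : fieldType.

(* Finite-dimensional A-B-bimodules with k acting centrally.  A right A-module
   is a k-A-bimodule, a left A-module is an A-k-bimodule: bilinearity and
   unitality force the action of k^o to be the scalar multiplication. *)
Record bimod (A B : falgType k) := Bimod {
  bcar :> vectType k;
  lact : A -> bcar -> bcar;
  ract : bcar -> B -> bcar;
  lact_linl : forall x, linear (lact^~ x);
  lact_linr : forall a, linear (lact a);
  ract_linl : forall b, linear (ract^~ b);
  ract_linr : forall x, linear (ract x);
  lact1 : forall x, lact 1 x = x;
  lactM : forall a a' x, lact (a * a') x = lact a (lact a' x);
  ract1 : forall x, ract x 1 = x;
  ractM : forall x b b', ract x (b * b') = ract (ract x b) b';
  lractA : forall a x b, lact a (ract x b) = ract (lact a x) b }.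

Definition is_bhom (A B : falgType k) (X Y : bimod A B) (f : 'Hom(X, Y)) : Prop :=
  (forall a x, f (lact a x) = lact a (f x)) /\
  (forall x b, f (ract x b) = ract (f x) b).

Record bhom (A B : falgType k) (X Y : bimod A B) := Bhom {
  bfun :> 'Hom(X, Y);
  bhomP : is_bhom bfun }.

Definition stable (A B : falgType k) (X : bimod A B) (U : {vspace X}) : Prop :=
  (forall a x, x \in U -> lact a x \in U) /\
  (forall x b, x \in U -> ract x b \in U).

End Bimodules.

Notation rmod A := (bimod (_^o) A).
Notation lmod A := (bimod A (_^o)).

Section Actions.
Variables (k : fieldType) (A B : falgType k) (X : bimod A B).
Definition lacth a : 'End(X) := mklin (@lact_linr _ _ _ X a).
Definition racth b : 'End(X) := mklin (@ract_linl _ _ _ X b).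
Lemma lacthE a x : lacth a x = lact a x. Proof. exact: mklinE. Qed.
Lemma racthE b x : racth b x = ract x b. Proof. exact: mklinE. Qed.
Lemma lactB a (x y : X) : lact a (x - y) = lact a x - lact a y.
Proof. by rewrite -!lacthE linearB. Qed.
Lemma ractB b (x y : X) : ract (x - y) b = ract x b - ract y b.
Proof. by rewrite -!racthE linearB. Qed.
Lemma ractZr c b (x : X) : ract x (c *: b) = c *: ract x b.
Proof. by rewrite -!(mklinE (@ract_linr _ _ _ X x)) linearZ. Qed.
Lemma lacth_lin : linear lacth.
Proof.
by move=> c a a'; apply/lfunP => x; rewrite add_lfunE scale_lfunE !lacthE lact_linl.
Qed.
Lemma racth_lin : linear racth.
Proof.
by move=> c a a'; apply/lfunP => x; rewrite add_lfunE scale_lfunE !racthE ract_linr.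
Qed.
Lemma lacth1 : lacth 1 = \1%VF.
Proof. by apply/lfunP => x; rewrite lacthE lact1 id_lfunE. Qed.
Lemma racth1 : racth 1 = \1%VF.
Proof. by apply/lfunP => x; rewrite racthE ract1 id_lfunE. Qed.
Lemma lacthM a a' : lacth (a * a') = (lacth a \o lacth a')%VF.
Proof. by apply/lfunP => x; rewrite comp_lfunE !lacthE lactM. Qed.
Lemma racthM b b' : racth (b * b') = (racth b' \o racth b)%VF.
Proof. by apply/lfunP => x; rewrite comp_lfunE !racthE ractM. Qed.
Lemma lracthC a b : (lacth a \o racth b = racth b \o lacth a)%VF.
Proof. by apply/lfunP => x; rewrite !comp_lfunE !lacthE !racthE lractA. Qed.
End Actions.
Arguments lacth {k A B} X a.
Arguments racth {k A B} X b.

Section CompLin.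
Variables (k : fieldType) (U V W : vectType k).
Lemma compl_lin (f : 'Hom(V, W)) : linear (fun g : 'Hom(U, V) => (f \o g)%VF).
Proof. by move=> c g h; rewrite comp_lfunDr comp_lfunZr. Qed.
Lemma compr_lin (g : 'Hom(U, V)) : linear (fun f : 'Hom(V, W) => (f \o g)%VF).
Proof. by move=> c f h; rewrite comp_lfunDl comp_lfunZl. Qed.
End CompLin.

Section Constructions.
Variable k : fieldType.

Definition breg (A : falgType k) : bimod A A.
Proof.
refine (@Bimod k A A A (fun a x => a * x) (fun x b => x * b) _ _ _ _ _ _ _ _ _).
- by move=> x c a a'; rewrite mulrDl scalerAl.
- by move=> a c x y; rewrite mulrDr scalerAr.
- by move=> b c x y; rewrite mulrDl scalerAl.
- by move=> x c b b'; rewrite mulrDr scalerAr.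
- exact: mul1r.
- by move=> a a' x; rewrite mulrA.
- exact: mulr1.
- by move=> x b b'; rewrite mulrA.
- by move=> a x b; rewrite mulrA.
Defined.

(* rforget keeps the right action only, lforget the left action only. *)
Definition rforget (A B : falgType k) (X : bimod A B) : bimod k^o B.
Proof.
refine (@Bimod k k^o B X (fun c x => (c : k) *: x) (fun x b => ract x b) _ _
  (@ract_linl _ _ _ X) (@ract_linr _ _ _ X) _ _ (@ract1 _ _ _ X) (@ractM _ _ _ X) _).
- by move=> x c a a' /=; rewrite scalerDl scalerA.
- by move=> a c x y /=; rewrite scalerDr !scalerA mulrC.
- exact: scale1r.
- by move=> a a' x; rewrite scalerA.
- by move=> a x b; rewrite -!racthE linearZ.
Defined.

Definition lforget (A B : falgType k) (X : bimod A B) : bimod A k^o.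
Proof.
refine (@Bimod k A k^o X (fun a x => lact a x) (fun x c => (c : k) *: x)
  (@lact_linl _ _ _ X) (@lact_linr _ _ _ X) _ _ (@lact1 _ _ _ X) (@lactM _ _ _ X) _ _ _).
- by move=> a c x y /=; rewrite scalerDr !scalerA mulrC.
- by move=> x c a a' /=; rewrite scalerDl scalerA.
- exact: scale1r.
- by move=> x a a'; rewrite scalerA mulrC.
- by move=> a x b; rewrite -!lacthE linearZ.
Defined.

Definition lrestrict (A A' B : falgType k) (f : {lrmorphism A' -> A}) (X : bimod A B) :
  bimod A' B.
Proof.
refine (@Bimod k A' B X (fun a x => lact (f a) x) (fun x b => ract x b) _ _
  (@ract_linl _ _ _ X) (@ract_linr _ _ _ X) _ _ (@ract1 _ _ _ X) (@ractM _ _ _ X) _).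
- by move=> x c a a'; rewrite linearP lact_linl.
- by move=> a c x y; rewrite lact_linr.
- by move=> x; rewrite rmorph1 lact1.
- by move=> a a' x; rewrite rmorphM lactM.
- by move=> a x b; rewrite lractA.
Defined.

Definition rrestrict (A B B' : falgType k) (f : {lrmorphism B' -> B}) (X : bimod A B) :
  bimod A B'.
Proof.
refine (@Bimod k A B' X (fun a x => lact a x) (fun x b => ract x (f b))
  (@lact_linl _ _ _ X) (@lact_linr _ _ _ X) _ _ (@lact1 _ _ _ X) (@lactM _ _ _ X) _ _ _).
- by move=> a c x y; rewrite ract_linl.
- by move=> x c a a'; rewrite linearP ract_linr.
- by move=> x; rewrite rmorph1 ract1.
- by move=> x a a'; rewrite rmorphM ractM.
- by move=> a x b; rewrite lractA.
Defined.

(* (b phi a)(x) = phi(a x b) *)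
Definition bdual (A B : falgType k) (X : bimod A B) : bimod B A.
Proof.
refine (@Bimod k B A (dualv X) (fun b phi => (phi \o racth X b)%VF)
  (fun phi a => (phi \o lacth X a)%VF) _ _ _ _ _ _ _ _ _).
- by move=> x c a a' /=; rewrite racth_lin comp_lfunDr comp_lfunZr.
- by move=> b; apply: compr_lin.
- by move=> a; apply: compr_lin.
- by move=> x c a a' /=; rewrite lacth_lin comp_lfunDr comp_lfunZr.
- by move=> x; rewrite racth1 comp_lfun1r.
- by move=> a a' x; rewrite racthM comp_lfunA.
- by move=> x; rewrite lacth1 comp_lfun1r.
- by move=> x b b'; rewrite lacthM comp_lfunA.
- by move=> a x b; rewrite -!comp_lfunA lracthC.
Defined.

Section SubQuot.
Variables (A B : falgType k) (X : bimod A B) (U : {vspace X}) (sU : stable U).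

Lemma bsub_lmem a (x : subvs_of U) : lact a (vsval x) \in U.
Proof. exact/sU.1/subvsP. Qed.
Lemma bsub_rmem b (x : subvs_of U) : ract (vsval x) b \in U.
Proof. exact/sU.2/subvsP. Qed.
Let memE := (bsub_lmem, bsub_rmem).

Definition bsub : bimod A B.
Proof.
refine (@Bimod k A B (subvs_of U) (fun a x => vsproj U (lact a (vsval x)))
  (fun x b => vsproj U (ract (vsval x) b)) _ _ _ _ _ _ _ _ _).
- by move=> x c a a'; rewrite lact_linl linearP.
- by move=> a c x y; rewrite linearP lact_linr linearP.
- by move=> a c x y; rewrite linearP ract_linl linearP.
- by move=> x c a a'; rewrite ract_linr linearP.
- by move=> x; rewrite lact1 vsvalK.
- by move=> a a' x; rewrite lactM vsprojK ?memE.
- by move=> x; rewrite ract1 vsvalK.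
- by move=> x a a'; rewrite ractM vsprojK ?memE.
- by move=> a x b; rewrite !vsprojK ?memE // lractA.
Defined.

Lemma bquot_l a v : vpi U (lact a (vrepr (vpi U v))) = vpi U (lact a v).
Proof.
by apply/vpi_eq; rewrite -memvN opprB -lactB; apply: sU.1; apply: vpi_decomp.
Qed.
Lemma bquot_r b v : vpi U (ract (vrepr (vpi U v)) b) = vpi U (ract v b).
Proof.
by apply/vpi_eq; rewrite -memvN opprB -ractB; apply: sU.2; apply: vpi_decomp.
Qed.

Definition bquot : bimod A B.
Proof.
refine (@Bimod k A B (vquot U) (fun a x => vpi U (lact a (vrepr x)))
  (fun x b => vpi U (ract (vrepr x) b)) _ _ _ _ _ _ _ _ _).
- by move=> x c a a'; rewrite lact_linl vpi_linear.
- by move=> a c x y; rewrite vreprP lact_linr vpi_linear.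
- by move=> a c x y; rewrite vreprP ract_linl vpi_linear.
- by move=> x c a a'; rewrite ract_linr vpi_linear.
- by move=> x; rewrite lact1 vpiK.
- by move=> a a' x; rewrite lactM bquot_l.
- by move=> x; rewrite ract1 vpiK.
- by move=> x a a'; rewrite ractM bquot_r.
- by move=> a x b; rewrite bquot_l bquot_r lractA.
Defined.

End SubQuot.

Lemma ker_stable (A B : falgType k) (X Y : bimod A B) (f : bhom X Y) : stable (lker f).
Proof.
split=> [a x|x b]; rewrite !memv_ker.
  by rewrite (bhomP f).1 => /eqP->; rewrite -lacthE linear0.
by rewrite (bhomP f).2 => /eqP->; rewrite -racthE linear0.
Qed.

Lemma im_stable (A B : falgType k) (X Y : bimod A B) (f : bhom X Y) : stable (limg f).
Proof.
split=> [a x /memv_imgP[u _ ->]|x b /memv_imgP[u _ ->]].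
  by rewrite -(bhomP f).1 memv_img ?memvf.
by rewrite -(bhomP f).2 memv_img ?memvf.
Qed.

Definition bker (A B : falgType k) (X Y : bimod A B) (f : bhom X Y) : bimod A B :=
  bsub (ker_stable f).

Definition bcoker (A B : falgType k) (X Y : bimod A B) (f : bhom X Y) : bimod A B :=
  bquot (im_stable f).

Definition bker_incl (A B : falgType k) (X Y : bimod A B) (f : bhom X Y) :
  bhom (bker f) X.
Proof.
exists (linfun (@vsval _ _ (lker f))); split=> [a x|x b].
  by rewrite !lfunE /= vsprojK // (ker_stable f).1 // subvsP.
by rewrite !lfunE /= vsprojK // (ker_stable f).2 // subvsP.
Defined.

End Constructions.

Section HomBimodules.
Variable k : fieldType.

Section Right.
Variables (A B C : falgType k) (X : bimod A B) (Y : bimod C B).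

(* The space of right B-linear maps X -> Y, see rhomvP. *)
Definition rhomv : {vspace 'Hom(X, Y)} :=
  (\bigcap_(i < \dim {:B}) let b := (vbasis {:B})`_i in
     lker (mklin (@compr_lin _ _ _ Y (racth X b)) - mklin (@compl_lin _ X _ _ (racth Y b))))%VS.

Lemma rhomvP (f : 'Hom(X, Y)) : reflect (forall x b, f (ract x b) = ract (f x) b) (f \in rhomv).
Proof.
apply: (iffP idP) => [hf x b|hf].
  move: b; apply: lin_ext => [c b b'|c b b'|i].
  - by rewrite ract_linr linearP.
  - by rewrite ract_linr.
  - move/subv_bigcapP: hf => /(_ i isT); rewrite -memvE => /eqlfunP.
    by rewrite !mklinE => /lfunP/(_ x); rewrite !comp_lfunE !racthE.
rewrite memvE; apply/subv_bigcapP => i _; rewrite -memvE; apply/eqlfunP.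
by rewrite !mklinE; apply/lfunP => x; rewrite !comp_lfunE !racthE hf.
Qed.

Lemma rhom_lmem a (f : 'Hom(X, Y)) : f \in rhomv -> (f \o lacth X a)%VF \in rhomv.
Proof.
move=> /rhomvP hf; apply/rhomvP => x b.
by rewrite !comp_lfunE !lacthE lractA hf.
Qed.

Lemma rhom_rmem c (f : 'Hom(X, Y)) : f \in rhomv -> (lacth Y c \o f)%VF \in rhomv.
Proof.
move=> /rhomvP hf; apply/rhomvP => x b.
by rewrite !comp_lfunE !lacthE hf lractA.
Qed.

(* Hom_B(X, Y) with (c f a)(x) = c f(a x). *)
Definition rhom : bimod C A.
Proof.
refine (@Bimod k C A (subvs_of rhomv)
  (fun c f => vsproj rhomv (lacth Y c \o vsval f)%VF)
  (fun f a => vsproj rhomv (vsval f \o lacth X a)%VF) _ _ _ _ _ _ _ _ _).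
- by move=> f c a a'; rewrite lacth_lin comp_lfunDl -comp_lfunZl linearP.
- by move=> a c f g; rewrite linearP compl_lin linearP.
- by move=> a c f g; rewrite linearP compr_lin linearP.
- by move=> f c a a'; rewrite lacth_lin comp_lfunDr -comp_lfunZr linearP.
- by move=> f; rewrite lacth1 comp_lfun1l vsvalK.
- by move=> a a' f; rewrite lacthM vsprojK ?rhom_lmem ?rhom_rmem ?subvsP // comp_lfunA.
- by move=> f; rewrite lacth1 comp_lfun1r vsvalK.
- by move=> f a a'; rewrite lacthM vsprojK ?rhom_lmem ?rhom_rmem ?subvsP // comp_lfunA.
- by move=> a f b; rewrite !vsprojK ?rhom_lmem ?rhom_rmem ?subvsP // comp_lfunA.
Defined.

End Right.

Section RightPre.
Variables (A B C : falgType k) (X X' : bimod A B) (f : bhom X X') (Y : bimod C B).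

Definition rhom_pre_fun (g : rhom X' Y) : rhom X Y :=
  vsproj (rhomv X Y) (vsval g \o f)%VF.

Lemma rhom_pre_mem (g : rhom X' Y) : (vsval g \o f)%VF \in rhomv X Y.
Proof.
apply/rhomvP => x b; rewrite !comp_lfunE (bhomP f).2.
by have /rhomvP-> := subvsP g.
Qed.

Lemma rhom_pre_linear : linear rhom_pre_fun.
Proof. by move=> c g h; rewrite /rhom_pre_fun linearP compr_lin linearP. Qed.

Definition rhom_pre : bhom (rhom X' Y) (rhom X Y).
Proof.
exists (mklin rhom_pre_linear); split=> [c g|g a]; rewrite !mklinE; apply: subvs_inj; rewrite /rhom_pre_fun /=.
  rewrite [in LHS]vsprojK; last exact: (rhom_pre_mem (vsproj _ _)).
  by rewrite !vsprojK ?rhom_rmem ?rhom_pre_mem ?subvsP // comp_lfunA.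
rewrite [in LHS]vsprojK; last exact: (rhom_pre_mem (vsproj _ _)).
rewrite !vsprojK ?rhom_lmem ?rhom_pre_mem ?subvsP -?comp_lfunA //; congr comp_lfun.
by apply/lfunP => x; rewrite !comp_lfunE !lacthE (bhomP f).1.
Defined.

End RightPre.

Section Left.
Variables (A B C : falgType k) (X : bimod A B) (Y : bimod A C).

(* The space of left A-linear maps X -> Y, see lhomvP. *)
Definition lhomv : {vspace 'Hom(X, Y)} :=
  (\bigcap_(i < \dim {:A}) let a := (vbasis {:A})`_i in
     lker (mklin (@compr_lin _ _ _ Y (lacth X a)) - mklin (@compl_lin _ X _ _ (lacth Y a))))%VS.

Lemma lhomvP (f : 'Hom(X, Y)) : reflect (forall a x, f (lact a x) = lact a (f x)) (f \in lhomv).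
Proof.
apply: (iffP idP) => [hf a x|hf].
  move: a; apply: lin_ext => [c b b'|c b b'|i].
  - by rewrite lact_linl linearP.
  - by rewrite lact_linl.
  - move/subv_bigcapP: hf => /(_ i isT); rewrite -memvE => /eqlfunP.
    by rewrite !mklinE => /lfunP/(_ x); rewrite !comp_lfunE !lacthE.
rewrite memvE; apply/subv_bigcapP => i _; rewrite -memvE; apply/eqlfunP.
by rewrite !mklinE; apply/lfunP => x; rewrite !comp_lfunE !lacthE hf.
Qed.

Lemma lhom_lmem b (f : 'Hom(X, Y)) : f \in lhomv -> (f \o racth X b)%VF \in lhomv.
Proof.
move=> /lhomvP hf; apply/lhomvP => a x.
by rewrite !comp_lfunE !racthE -lractA hf.
Qed.

Lemma lhom_rmem c (f : 'Hom(X, Y)) : f \in lhomv -> (racth Y c \o f)%VF \in lhomv.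
Proof.
move=> /lhomvP hf; apply/lhomvP => a x.
by rewrite !comp_lfunE !racthE hf lractA.
Qed.

(* Hom_A(X, Y) for left modules, with (b f c)(x) = f(x b) c. *)
Definition lhom : bimod B C.
Proof.
refine (@Bimod k B C (subvs_of lhomv)
  (fun b f => vsproj lhomv (vsval f \o racth X b)%VF)
  (fun f c => vsproj lhomv (racth Y c \o vsval f)%VF) _ _ _ _ _ _ _ _ _).
- by move=> f c a a'; rewrite racth_lin comp_lfunDr -comp_lfunZr linearP.
- by move=> a c f g; rewrite linearP compr_lin linearP.
- by move=> a c f g; rewrite linearP compl_lin linearP.
- by move=> f c a a'; rewrite racth_lin comp_lfunDl -comp_lfunZl linearP.
- by move=> f; rewrite racth1 comp_lfun1r vsvalK.
- by move=> a a' f; rewrite racthM vsprojK ?lhom_lmem ?lhom_rmem ?subvsP // comp_lfunA.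
- by move=> f; rewrite racth1 comp_lfun1l vsvalK.
- by move=> f a a'; rewrite racthM vsprojK ?lhom_lmem ?lhom_rmem ?subvsP // comp_lfunA.
- by move=> a f b; rewrite !vsprojK ?lhom_lmem ?lhom_rmem ?subvsP // comp_lfunA.
Defined.

End Left.

Section LeftPre.
Variables (A B C : falgType k) (X X' : bimod A B) (f : bhom X X') (Y : bimod A C).

Definition lhom_pre_fun (g : lhom X' Y) : lhom X Y :=
  vsproj (lhomv X Y) (vsval g \o f)%VF.

Lemma lhom_pre_mem (g : lhom X' Y) : (vsval g \o f)%VF \in lhomv X Y.
Proof.
apply/lhomvP => a x; rewrite !comp_lfunE (bhomP f).1.
by have /lhomvP-> := subvsP g.
Qed.

Lemma lhom_pre_linear : linear lhom_pre_fun.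
Proof. by move=> c g h; rewrite /lhom_pre_fun linearP compr_lin linearP. Qed.

Definition lhom_pre : bhom (lhom X' Y) (lhom X Y).
Proof.
exists (mklin lhom_pre_linear); split=> [b g|g c]; rewrite !mklinE; apply: subvs_inj; rewrite /lhom_pre_fun /=.
  rewrite [in LHS]vsprojK; last exact: (lhom_pre_mem (vsproj _ _)).
  rewrite !vsprojK ?lhom_lmem ?lhom_pre_mem ?subvsP -?comp_lfunA //; congr comp_lfun.
  by apply/lfunP => x; rewrite !comp_lfunE !racthE (bhomP f).2.
rewrite [in LHS]vsprojK; last exact: (lhom_pre_mem (vsproj _ _)).
by rewrite !vsprojK ?lhom_rmem ?lhom_pre_mem ?subvsP // comp_lfunA.
Defined.

End LeftPre.

End HomBimodules.

Section Tensor.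
Variable k : fieldType.

Lemma tens_linear (V W : vectType k) (x : V) (y : W) :
  linear (fun phi : dualv V => (phi x : k) *: y).
Proof. by move=> c f g; rewrite add_lfunE scale_lfunE scalerDl scalerA. Qed.

(* V (x)_k W is represented by Hom_k(V^*, W), v (x) w being phi |-> phi(v) w. *)
Definition tens (V W : vectType k) (x : V) (y : W) : 'Hom(dualv V, W) :=
  mklin (tens_linear x y).

Lemma tensE (V W : vectType k) (x : V) (y : W) phi :
  tens x y phi = (phi x : k) *: y.
Proof. exact: mklinE. Qed.

Lemma tens_linl (V W : vectType k) (y : W) : linear (fun x : V => tens x y).
Proof.
move=> c x x'; apply/lfunP => phi; rewrite add_lfunE scale_lfunE !tensE.
by rewrite linearP scalerDl scalerA.
Qed.

Lemma tens_linr (V W : vectType k) (x : V) : linear (fun y : W => tens x y).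
Proof.
move=> c y y'; apply/lfunP => phi; rewrite add_lfunE scale_lfunE !tensE.
by rewrite scalerDr !scalerA mulrC.
Qed.

Lemma vcoord_linear (V : vectType k) i :
  linear (fun x : V => coord (vbasis {:V}) i x : k^o).
Proof. by move=> c x y; rewrite linearP. Qed.

Definition vcoord (V : vectType k) (i : 'I_(\dim {:V})) : dualv V :=
  mklin (@vcoord_linear V i).

Lemma tens_sum (V W : vectType k) (t : 'Hom(dualv V, W)) :
  t = \sum_(i < \dim {:V}) tens (vbasis {:V})`_i (t (vcoord i)).
Proof.
apply/lfunP => phi; rewrite sum_lfunE.
have {1}-> : phi = \sum_(i < \dim {:V}) (phi (vbasis {:V})`_i : k) *: vcoord i.
  apply/lfunP => x; rewrite sum_lfunE {1}(coord_vbasis (memvf x)) linear_sum.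
  apply: eq_bigr => i _; rewrite linearZ scale_lfunE mklinE.
  exact: mulrC.
by rewrite linear_sum; apply: eq_bigr => i _; rewrite linearZ tensE.
Qed.

Lemma tens_ext (V W Z : vectType k) (f g : 'Hom('Hom(dualv V, W), Z)) :
  (forall x y, f (tens x y) = g (tens x y)) -> f = g.
Proof.
move=> e; apply/lfunP => t; rewrite (tens_sum t) !linear_sum.
by apply: eq_bigr => i _; apply: e.
Qed.

Section TensorK.
Variables (A C C' B : falgType k) (X : bimod A C) (Y : bimod C' B).

Definition btensk : bimod A B.
Proof.
refine (@Bimod k A B 'Hom(dualv X, Y) (fun a t => (t \o racth (bdual X) a)%VF)
  (fun t b => (racth Y b \o t)%VF) _ _ _ _ _ _ _ _ _).
- by move=> t c a a'; rewrite racth_lin comp_lfunDr comp_lfunZr.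
- by move=> a; apply: compr_lin.
- by move=> b; apply: compl_lin.
- by move=> t c b b'; rewrite racth_lin comp_lfunDl comp_lfunZl.
- by move=> t; rewrite racth1 comp_lfun1r.
- by move=> a a' t; rewrite racthM comp_lfunA.
- by move=> t; rewrite racth1 comp_lfun1l.
- by move=> t b b'; rewrite racthM comp_lfunA.
- by move=> a t b; rewrite comp_lfunA.
Defined.

Lemma lact_tens a (x : X) (y : Y) :
  lact (a : A) (tens x y : btensk) = tens (lact a x) y.
Proof.
apply/lfunP => phi; rewrite [LHS]comp_lfunE !tensE.
have -> : racth (bdual X) a phi = (phi \o lacth X a)%VF := racthE _ _.
by rewrite comp_lfunE lacthE.
Qed.

Lemma ract_tens b (x : X) (y : Y) :
  ract (tens x y : btensk) (b : B) = tens x (ract y b).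
Proof.
apply/lfunP => phi; rewrite [LHS]comp_lfunE !tensE linearZ /=.
by congr (_ *: _); apply: racthE.
Qed.

End TensorK.

Section TensorC.
Variables (A C B : falgType k) (X : bimod A C) (Y : bimod C B).

(* The span of all xc (x) y - x (x) cy, see tensrelP. *)
Definition tensrel : {vspace btensk X Y} :=
  (\sum_(i < \dim {:X}) \sum_(j < \dim {:C}) \sum_(l < \dim {:Y})
     let x := (vbasis {:X})`_i in let c := (vbasis {:C})`_j in
     let y := (vbasis {:Y})`_l in
     <[ (tens (ract x c) y - tens x (lact c y) : btensk X Y) ]>)%VS.

Lemma tensrelP (x : X) (c : C) (y : Y) :
  (tens (ract x c) y - tens x (lact c y) : btensk X Y) \in tensrel.
Proof.
rewrite -vpi_eq0.
pose F x c y := vpi tensrel (tens (ract x c) y - tens x (lact c y) : btensk X Y).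
have Fx c' y' : linear (fun x' => F x' c' y').
  move=> e u v; rewrite /F ract_linl !tens_linl -vpi_linear; congr vpi.
  by rewrite scalerBr opprD addrACA.
have Fc x' y' : linear (fun c' => F x' c' y').
  move=> e u v; rewrite /F ract_linr lact_linl tens_linl tens_linr -vpi_linear.
  by congr vpi; rewrite scalerBr opprD addrACA.
have Fy x' c' : linear (fun y' => F x' c' y').
  move=> e u v; rewrite /F lact_linr !tens_linr -vpi_linear; congr vpi.
  by rewrite scalerBr opprD addrACA.
have L0 (U V : vectType k) : linear (fun _ : U => 0 : V).
  by move=> e u v; rewrite scaler0 addr0.
apply/eqP; move: x; apply: (lin_ext (Fx _ _) (L0 _ _)) => i.
move: c; apply: (lin_ext (Fc _ _) (L0 _ _)) => j.
move: y; apply: (lin_ext (Fy _ _) (L0 _ _)) => l.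
apply/eqP; rewrite vpi_eq0 memvE.
apply: (sumv_sup i) => //; apply: (sumv_sup j) => //.
by apply: (sumv_sup l) => //; rewrite subvv.
Qed.

Lemma tensrel_stable : stable tensrel.
Proof.
have H (f : 'End(btensk X Y)) :
    (forall x c y, f (tens (ract x c) y - tens x (lact c y)) \in tensrel) ->
    forall t, t \in tensrel -> f t \in tensrel.
  move=> hf; suff hs : (tensrel <= f @^-1: tensrel)%VS.
    by move=> t ht; rewrite memv_preim (subvP hs).
  apply/subv_sumP => i _; apply/subv_sumP => j _; apply/subv_sumP => l _.
  by rewrite -memvE -memv_preim hf.
split=> [a t ht|t b ht].
  rewrite -lacthE; apply: H ht => x c y; rewrite lacthE lactB !lact_tens lractA.
  exact: tensrelP.
rewrite -racthE; apply: H ht => x c y; rewrite racthE ractB !ract_tens -lractA.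
exact: tensrelP.
Qed.

Definition btens : bimod A B := bquot tensrel_stable.

End TensorC.

Section Mult.
Variables (A B : falgType k) (X : bimod A B).

Definition multmap_fun (t : btensk X (breg B)) : X :=
  \sum_(i < \dim {:X}) ract (vbasis {:X})`_i (t (vcoord i)).

Lemma multmap_linear : linear multmap_fun.
Proof.
move=> c t t'; rewrite /multmap_fun scaler_sumr -big_split; apply: eq_bigr => i _ /=.
by rewrite add_lfunE scale_lfunE ract_linr.
Qed.

Lemma multmap_tens (x : X) (b : breg B) : multmap_fun (tens x b) = ract x b.
Proof.
rewrite /multmap_fun {2}(coord_vbasis (memvf x)) -racthE linear_sum.
apply: eq_bigr => i _; rewrite tensE mklinE linearZ /= (ractZr (X := X)).
by congr (_ *: _); rewrite -racthE.
Qed.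

(* The multiplication X (x)_k B -> X, x (x) b |-> xb. *)
Definition multmap : bhom (btensk X (breg B)) X.
Proof.
exists (mklin multmap_linear); split=> [a t|t b].
  have /lfunP/(_ t) : (mklin multmap_linear \o lacth (btensk X (breg B)) a =
      lacth X a \o mklin multmap_linear)%VF.
    apply: (tens_ext (V := X) (W := breg B)) => x y.
    rewrite !comp_lfunE !mklinE (lact_tens a x (y : breg B)).
    by rewrite !multmap_tens lractA.
  by rewrite !comp_lfunE !lacthE.
have /lfunP/(_ t) : (mklin multmap_linear \o racth (btensk X (breg B)) b =
    racth X b \o mklin multmap_linear)%VF.
  apply: (tens_ext (V := X) (W := breg B)) => x y.
  rewrite !comp_lfunE !mklinE (ract_tens (X := X) b x (y : breg B)).
  by rewrite !multmap_tens -ractM.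
by rewrite !comp_lfunE !racthE.
Defined.

End Mult.

(* 0 -> syz X -> X (x)_k B -> X -> 0 is exact, the middle term is a free right
   B-module, and everything is functorial in X and hence compatible with the
   left A-action.  Splicing gives the standard free resolution
     ... -> syz^2 X (x)_k B -> syz X (x)_k B -> X (x)_k B -> X -> 0
   of the right module X, and rExt n X Y below is the n-th cohomology of
   Hom_B(-, Y) applied to it, a C-A-bimodule. *)
Definition syz (A B : falgType k) (X : bimod A B) : bimod A B := bker (multmap X).

Definition rExt (A B C : falgType k) (n : nat) (X : bimod A B) (Y : bimod C B) :
  bimod C A :=
  if n is m.+1 then bcoker (rhom_pre (bker_incl (multmap (iter m (@syz A B) X))) Y)
  else rhom X Y.

End Tensor.

Section TrivialExtension.
Variables (k : fieldType) (C : falgType k) (E : bimod C C).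

(* C x E with product (c,e)(c',e') = (cc', ce' + ec'). *)
Definition trivext : Type := (C * E)%type.

HB.instance Definition _ := Vector.copy trivext (C * E)%type.

Definition te_one : trivext := (1, 0).
Definition te_mul (x y : trivext) : trivext :=
  (x.1 * y.1, lact x.1 y.2 + ract x.2 y.1).

Lemma te_mulA : associative te_mul.
Proof.
move=> [c e] [c' e'] [c'' e'']; rewrite /te_mul /=; congr (_, _); first exact: mulrA.
have hl : lact c (lact c' e'' + ract e' c'') = lact c (lact c' e'') + lact c (ract e' c'').
  by rewrite -!lacthE linearD.
have hr : ract (lact c e' + ract e c') c'' = ract (lact c e') c'' + ract (ract e c') c''.
  by rewrite -!racthE linearD.
by rewrite hl hr lactM ractM lractA addrA.
Qed.

Lemma te_mul1x : left_id te_one te_mul.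
Proof.
by move=> [c e]; rewrite /te_mul /= mul1r lact1 -racthE linear0 addr0.
Qed.

Lemma te_mulx1 : right_id te_one te_mul.
Proof. by move=> [c e]; rewrite /te_mul /= mulr1 ract1 -lacthE linear0 add0r. Qed.

Lemma te_mulDl : left_distributive te_mul +%R.
Proof.
move=> [c e] [c' e'] [d f]; rewrite /te_mul /=; congr (_, _); first exact: mulrDl.
have h1 : lact (c + c') f = lact c f + lact c' f.
  by have := lact_linl f 1 c c'; rewrite !scale1r.
have h2 : ract (e + e') d = ract e d + ract e' d.
  by rewrite -!racthE linearD.
by rewrite h1 h2 addrACA.
Qed.

Lemma te_mulDr : right_distributive te_mul +%R.
Proof.
move=> [d f] [c e] [c' e']; rewrite /te_mul /=; congr (_, _); first exact: mulrDr.
have h1 : ract f (c + c') = ract f c + ract f c'.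
  by have := ract_linr f 1 c c'; rewrite !scale1r.
have h2 : lact d (e + e') = lact d e + lact d e'.
  by rewrite -!lacthE linearD.
by rewrite h1 h2 addrACA.
Qed.

Lemma te_one_neq0 : te_one != 0.
Proof. by apply/eqP => -[/eqP]; rewrite oner_eq0. Qed.

HB.instance Definition _ := GRing.Zmodule_isNzRing.Build trivext
  te_mulA te_mul1x te_mulx1 te_mulDl te_mulDr te_one_neq0.

Lemma te_scaleAl (a : k) (x y : trivext) : a *: (x * y) = (a *: x) * y.
Proof.
case: x y => [c e] [d f]; congr (_, _) => /=; first exact: scalerAl.
have h1 : lact (a *: c) f = a *: lact c f.
  by rewrite -!(mklinE (@lact_linl _ _ _ E f)) linearZ.
have h2 : ract (a *: e) d = a *: ract e d by rewrite -!racthE linearZ.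
by rewrite h1 h2 scalerDr.
Qed.

HB.instance Definition _ := GRing.Lmodule_isLalgebra.Build k trivext te_scaleAl.

Lemma te_scaleAr (a : k) (x y : trivext) : a *: (x * y) = x * (a *: y).
Proof.
case: x y => [c e] [d f]; congr (_, _) => /=; first exact: scalerAr.
have h1 : ract e (a *: d) = a *: ract e d by rewrite ractZr.
have h2 : lact c (a *: f) = a *: lact c f by rewrite -!lacthE linearZ.
by rewrite h1 h2 scalerDr.
Qed.

HB.instance Definition _ := GRing.Lalgebra_isAlgebra.Build k trivext te_scaleAr.
HB.instance Definition _ := Algebra_isFalgebra.Build k trivext.

Definition te_incl (c : C) : trivext := (c, 0).

Lemma te_incl_linear : linear te_incl.
Proof. by move=> a c c'; congr (_, _); rewrite /= scaler0 addr0. Qed.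

Lemma te_incl_monoid : monoid_morphism te_incl.
Proof.
split=> // c c'; congr (_, _) => /=.
by rewrite -lacthE -racthE !linear0 addr0.
Qed.

HB.instance Definition _ :=
  GRing.isLinear.Build k C trivext *:%R te_incl te_incl_linear.
HB.instance Definition _ :=
  GRing.isMonoidMorphism.Build C trivext te_incl te_incl_monoid.

(* M (x)_C B *)
Definition induced (M : rmod C) : rmod trivext :=
  btens M (lrestrict te_incl (breg trivext)).

(* D(B (x)_C DM) *)
Definition coinduced (M : rmod C) : rmod trivext :=
  bdual (btens (rrestrict te_incl (breg trivext)) (bdual M)).

End TrivialExtension.

Section Homological.
Variable k : fieldType.

Definition biso (A B : falgType k) (X Y : bimod A B) : Prop :=
  exists f : bhom X Y, lker f = 0%VS /\ limg f = fullv.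

Definition short_exact (A B : falgType k) (X Y Z : bimod A B)
  (f : bhom X Y) (g : bhom Y Z) : Prop :=
  [/\ lker f = 0%VS, limg f = lker g & limg g = fullv].

Definition projective (A B : falgType k) (P : bimod A B) : Prop :=
  forall (X Y : bimod A B) (g : bhom X Y) (f : bhom P Y),
    limg g = fullv -> exists h : bhom P X, (g \o h)%VF = f.

Definition injective_mod (A B : falgType k) (I : bimod A B) : Prop :=
  forall (X Y : bimod A B) (g : bhom X Y) (f : bhom X I),
    lker g = 0%VS -> exists h : bhom Y I, (h \o g)%VF = f.

Definition pd_le1 (A B : falgType k) (M : bimod A B) : Prop :=
  exists (P1 P0 : bimod A B) (f : bhom P1 P0) (g : bhom P0 M),
    [/\ projective P1, projective P0 & short_exact f g].

Definition id_le1 (A B : falgType k) (M : bimod A B) : Prop :=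
  exists (I0 I1 : bimod A B) (f : bhom M I0) (g : bhom I0 I1),
    [/\ injective_mod I0, injective_mod I1 & short_exact f g].

Definition bzero (A B : falgType k) (X : bimod A B) : Prop := {:X}%VS = 0%VS.

Definition partial_tilting (A : falgType k) (M : rmod A) : Prop :=
  pd_le1 M /\ bzero (rExt 1 M M).

Definition partial_cotilting (A : falgType k) (M : rmod A) : Prop :=
  id_le1 M /\ bzero (rExt 1 M M).

Definition superfluous (A B : falgType k) (X : bimod A B) (U : {vspace X}) : Prop :=
  forall V : {vspace X}, stable V -> (U + V)%VS = fullv -> V = fullv.

(* A minimal projective presentation P1 -> P0 -> M -> 0: both P0 -> M and
   P1 -> im(P1 -> P0) are projective covers. *)
Record minpres (A B : falgType k) (M : bimod A B) := Minpres {
  mp1 : bimod A B;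
  mp0 : bimod A B;
  mpd : bhom mp1 mp0;
  mpe : bhom mp0 M;
  mp1_proj : projective mp1;
  mp0_proj : projective mp0;
  mp_exact : limg mpd = lker mpe;
  mpe_surj : limg mpe = fullv;
  mpe_min : superfluous (lker mpe);
  mpd_min : superfluous (lker mpd) }.

(* The transpose, the cokernel of Hom(P0, A) -> Hom(P1, A). *)
Definition rTr (A : falgType k) (M : rmod A) (p : minpres M) : lmod A :=
  bcoker (rhom_pre (mpd p) (breg A)).

Definition lTr (A : falgType k) (M : lmod A) (p : minpres M) : rmod A :=
  bcoker (lhom_pre (mpd p) (breg A)).

(* tau M = D Tr M and tau^-1 M = Tr D M.  A minimal projective presentation
   exists and is unique up to isomorphism, so these depend only on M up to
   isomorphism, and the choice of p in tau_rigid and tau_corigid is immaterial. *)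
Definition tau (A : falgType k) (M : rmod A) (p : minpres M) : rmod A :=
  bdual (rTr p).

Definition tauinv (A : falgType k) (M : rmod A) (p : minpres (bdual M)) : rmod A :=
  lTr p.

Definition tau_rigid (A : falgType k) (M : rmod A) : Prop :=
  exists p : minpres M, bzero (rhom M (tau p)).

Definition tau_corigid (A : falgType k) (M : rmod A) : Prop :=
  exists p : minpres (bdual M), bzero (rhom (tauinv p) M).

Definition is_dsum (A B : falgType k) (M : bimod A B) (I : finType)
  (X : I -> bimod A B) : Prop :=
  exists (u : forall i, bhom (X i) M) (p : forall i, bhom M (X i)),
    [/\ forall i, (p i \o u i)%VF = \1%VF,
        forall i j, i != j -> (p i \o u j)%VF = 0
      & \sum_i (u i \o p i)%VF = \1%VF].

Definition indecomposable (A B : falgType k) (X : bimod A B) : Prop :=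
  ~ bzero X /\
  forall U V : {vspace X}, stable U -> stable V ->
    (U + V)%VS = fullv -> (U :&: V)%VS = 0%VS -> U = 0%VS \/ V = 0%VS.

Definition basic (A B : falgType k) (M : bimod A B) : Prop :=
  exists (n : nat) (X : 'I_n -> bimod A B),
    [/\ is_dsum M X, forall i, indecomposable (X i)
      & forall i j, i != j -> ~ biso (X i) (X j)].

(* X is a direct summand of T^n, via X -> T^n -> X with components i and p. *)
Definition in_add (A B : falgType k) (T X : bimod A B) : Prop :=
  exists (n : nat) (i : 'I_n -> bhom X T) (p : 'I_n -> bhom T X),
    \sum_j (p j \o i j)%VF = \1%VF.

(* The last condition is an exact sequence 0 -> A -> T0 -> T1 -> 0 in add T. *)
Definition tilting (A : falgType k) (T : rmod A) : Prop :=
  partial_tilting T /\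
  exists (T0 T1 : rmod A) (f : bhom (rforget (breg A)) T0) (g : bhom T0 T1),
    [/\ in_add T T0, in_add T T1 & short_exact f g].

(* C is isomorphic to End_A T, the product being composition of functions. *)
Definition is_endalg (A : falgType k) (T : rmod A) (C : falgType k) : Prop :=
  exists phi : 'Hom(C, 'End(T)),
    [/\ lker phi = 0%VS, limg phi = rhomv T T, phi 1 = \1%VF
      & forall x y, phi (x * y) = (phi x \o phi y)%VF].

End Homological.

Record quiver := Quiver {
  qvert : finType;
  qarr : finType;
  qsrc : qarr -> qvert;
  qtgt : qarr -> qvert;
  qvert_gt0 : (0 < #|qvert|)%N }.

Section Quivers.
Variable Q : quiver.

Fixpoint qwalk (v : qvert Q) (s : seq (qarr Q)) : bool :=
  if s is a :: s' then (qsrc a == v) && qwalk (qtgt a) s' else true.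

Definition qend (v : qvert Q) (s : seq (qarr Q)) : qvert Q := last v (map (@qtgt Q) s).

Definition qacyclic : Prop :=
  forall v s, qwalk v s -> s <> [::] -> qend v s <> v.

Definition qconnected : Prop :=
  forall u v : qvert Q, connect (fun x y => [exists a : qarr Q,
    ((qsrc a == x) && (qtgt a == y)) || ((qsrc a == y) && (qtgt a == x))]) u v.

Lemma qwalk_cat v s t : qwalk v (s ++ t) = qwalk v s && qwalk (qend v s) t.
Proof. by elim: s v => //= a s IH v; rewrite IH andbA. Qed.

Lemma qend_cat v s t : qend v (s ++ t) = qend (qend v s) t.
Proof. by rewrite /qend map_cat last_cat. Qed.

Lemma qacyclic_size v s : qacyclic -> qwalk v s -> (size s < #|qvert Q|)%N.
Proof.
move=> ac ws; suff u : uniq (v :: map (@qtgt Q) s).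
  by rewrite -(size_map (@qtgt Q) s) -/(size (v :: _)) -(card_uniqP u) max_card.
elim: s v ws => //= a s IH v /andP[/eqP sa ws]; rewrite -/(uniq (_ :: _)).
apply/andP; split; last exact: IH.
apply/negP => hv; have [s1 [s2 [e1 e2]]] : exists s1 s2,
    a :: s = s1 ++ s2 /\ (s1 != [::]) && (qend v s1 == v).
  have : v \in map (@qtgt Q) (a :: s) by [].
  move=> /mapP[b /splitPr[p1 p2] e]; exists (rcons p1 b), p2.
  by rewrite cat_rcons /qend map_rcons last_rcons -e eqxx andbT; case: p1.
have w : qwalk v (s1 ++ s2) by rewrite -e1 /= sa eqxx.
case/andP: e2 => n1 /eqP e2; move: w; rewrite qwalk_cat => /andP[w _].
exact: (ac v s1 w (elimN eqP n1) e2).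
Qed.

(* The paths of Q, given by a starting point and a list of consecutive arrows.
   The bound on the length loses nothing when Q is acyclic, by qacyclic_size. *)
Definition qpath : finType :=
  {p : qvert Q * {bseq #|qvert Q| of qarr Q} | qwalk p.1 p.2}.

Definition qps (p : qpath) : qvert Q := (val p).1.
Definition qpl (p : qpath) : seq (qarr Q) := (val p).2.
Definition qpe (p : qpath) : qvert Q := qend (qps p) (qpl p).

Definition qconcat (p q r : qpath) : bool :=
  [&& qps r == qps p, qpe p == qps q & qpl r == qpl p ++ qpl q].

Lemma qpath_inj (p q : qpath) : qps p = qps q -> qpl p = qpl q -> p = q.
Proof.
move=> e1 e2; apply: val_inj; rewrite [LHS]surjective_pairing [RHS]surjective_pairing.
by congr (_, _) => //; apply: val_inj.
Qed.

Lemma qpath_ex v s : qwalk v s -> (size s <= #|qvert Q|)%N ->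
  exists p : qpath, qps p = v /\ qpl p = s.
Proof.
by move=> w h; exists (exist _ (v, Bseq h) w : qpath).
Qed.

Lemma qpath_wf (p : qpath) : qwalk (qps p) (qpl p).
Proof. exact: (valP p). Qed.

Lemma qpath_size (p : qpath) : (size (qpl p) <= #|qvert Q|)%N.
Proof. exact: size_bseq. Qed.

Definition qconcat3 (p q s r : qpath) : bool :=
  [&& qps r == qps p, qpe p == qps q, qpe q == qps s
    & qpl r == qpl p ++ qpl q ++ qpl s].

Lemma qconcat3l (p q s r : qpath) (R : nzRingType) :
  \sum_t ((qconcat p q t && qconcat t s r)%:R : R) = (qconcat3 p q s r)%:R.
Proof.
case H : (qconcat3 p q s r).
  case/and4P: H => /eqP h1 /eqP h2 /eqP h3 /eqP h4.
  have [||t [t1 t2]] := @qpath_ex (qps p) (qpl p ++ qpl q).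
  - by rewrite qwalk_cat qpath_wf /= -/(qpe p) h2 qpath_wf.
  - apply: leq_trans (qpath_size r).
    by rewrite h4 catA [X in (_ <= X)%N]size_cat leq_addr.
  have et : qpe t = qpe q by rewrite /qpe t1 t2 qend_cat -/(qpe p) h2.
  rewrite (bigD1 t) //= big1 ?addr0 => [|u ut].
    by rewrite /qconcat t1 t2 h1 h2 et h3 h4 !eqxx catA eqxx.
  case: andP => // -[/and3P[/eqP u1 _ /eqP u2] _].
  by case/eqP: ut; apply: qpath_inj; rewrite ?u1 ?u2 ?t1 ?t2.
apply: big1 => t _; case: andP => // -[/and3P[/eqP t1 /eqP pq /eqP t2]].
case/and3P => /eqP r1 /eqP ts /eqP r2; move/negP: H; case.
have et : qpe t = qpe q by rewrite /qpe t1 t2 qend_cat -/(qpe p) pq.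
by rewrite /qconcat3 r1 t1 pq -et ts r2 t2 catA !eqxx.
Qed.

Lemma qconcat3r (p q s r : qpath) (R : nzRingType) :
  \sum_t ((qconcat q s t && qconcat p t r)%:R : R) = (qconcat3 p q s r)%:R.
Proof.
case H : (qconcat3 p q s r).
  case/and4P: H => /eqP h1 /eqP h2 /eqP h3 /eqP h4.
  have [||t [t1 t2]] := @qpath_ex (qps q) (qpl q ++ qpl s).
  - by rewrite qwalk_cat qpath_wf /= -/(qpe q) h3 qpath_wf.
  - apply: leq_trans (qpath_size r).
    by rewrite h4 [X in (_ <= X)%N]size_cat leq_addl.
  rewrite (bigD1 t) //= big1 ?addr0 => [|u ut].
    by rewrite /qconcat t1 t2 h1 h2 h3 h4 !eqxx.
  case: andP => // -[/and3P[/eqP u1 _ /eqP u2] _].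
  by case/eqP: ut; apply: qpath_inj; rewrite ?u1 ?u2 ?t1 ?t2.
apply: big1 => t _; case: andP => // -[/and3P[/eqP t1 /eqP pq /eqP t2]].
case/and3P => /eqP r1 /eqP ts /eqP r2; move/negP: H; case.
by rewrite /qconcat3 r1 ts t1 pq r2 t2 !eqxx.
Qed.

End Quivers.

Section PathAlgebra.
Variables (k : fieldType) (Q : quiver).

(* The path algebra kQ: linear combinations of paths, with p q the path p
   followed by q if p ends where q starts and 0 otherwise. *)
Definition pathalg : Type := {ffun qpath Q -> k^o}.

HB.instance Definition _ := Vector.copy pathalg {ffun qpath Q -> k^o}.

Definition pa_one : pathalg := [ffun r => (qpl r == [::])%:R].
Definition pa_mul (f g : pathalg) : pathalg :=
  [ffun r => \sum_p \sum_q (qconcat p q r)%:R * ((f p : k) * (g q : k))].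

Lemma pa_mulA : associative pa_mul.
Proof.
move=> f g h; apply/ffunP => r; rewrite !ffunE.
transitivity (\sum_p \sum_q \sum_s
   (qconcat3 p q s r)%:R * ((f p : k) * (g q : k) * (h s : k))).
  apply: eq_bigr => p _.
  under eq_bigr => t _.
    rewrite ffunE !mulr_sumr; under eq_bigr => q _.
      rewrite !mulr_sumr; over.
    over.
  rewrite exchange_big; apply: eq_bigr => q _; rewrite exchange_big.
  apply: eq_bigr => s _; rewrite -qconcat3r mulr_suml; apply: eq_bigr => t _.
  by rewrite andbC -mulnb natrM; ring.
symmetry.
under eq_bigr => t _.
  under eq_bigr => s _.
    rewrite ffunE mulr_suml mulr_sumr; under eq_bigr => p _.
      rewrite mulr_suml mulr_sumr; over.
    over.
  over.
under eq_bigr => t _ do rewrite exchange_big.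
rewrite exchange_big; apply: eq_bigr => p _.
under eq_bigr => t _ do rewrite exchange_big.
rewrite exchange_big; apply: eq_bigr => q _.
rewrite exchange_big; apply: eq_bigr => s _.
rewrite -qconcat3l mulr_suml; apply: eq_bigr => t _.
by rewrite -mulnb natrM; ring.
Qed.

Lemma qtriv_ex (v : qvert Q) : exists p : qpath Q, qps p = v /\ qpl p = [::].
Proof. exact: qpath_ex. Qed.

Lemma pa_mul1x : left_id pa_one pa_mul.
Proof.
move=> f; apply/ffunP => r; rewrite ffunE.
have [t [t1 t2]] := qtriv_ex (qps r).
have et : qpe t = qps r by rewrite /qpe t1 t2.
rewrite (bigD1 t) //= [X in _ + X]big1 ?addr0 => [|p pt].
  rewrite (bigD1 r) //= big1 ?addr0 => [|q qr].
    by rewrite ffunE /qconcat t1 et t2 !eqxx !mul1r.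
  rewrite ffunE t2 eqxx mul1r; case H: (qconcat _ _ _); rewrite ?mul0r //.
  case/and3P: H => _ /eqP h1 /eqP h2; case/eqP: qr; apply: qpath_inj.
    by rewrite -h1.
  by rewrite h2 t2.
apply: big1 => q _; rewrite ffunE; case: eqP => [p0|_]; last by rewrite mul0r mulr0.
case H: (qconcat _ _ _); rewrite ?mul0r //.
case/and3P: H => /eqP h1 _ _; case/eqP: pt; apply: qpath_inj.
  by rewrite t1 h1.
by rewrite t2.
Qed.

Lemma pa_mulx1 : right_id pa_one pa_mul.
Proof.
move=> f; apply/ffunP => r; rewrite ffunE.
have [t [t1 t2]] := qtriv_ex (qpe r).
rewrite (bigD1 r) //= [X in _ + X]big1 ?addr0 => [|p pr].
  rewrite (bigD1 t) //= big1 ?addr0 => [|q qt].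
    by rewrite ffunE /qconcat t1 t2 cats0 !eqxx mulr1 mul1r.
  rewrite ffunE; case: eqP => [q0|_]; last by rewrite !mulr0.
  case H: (qconcat _ _ _); rewrite ?mul0r //.
  case/and3P: H => _ /eqP h1 _; case/eqP: qt; apply: qpath_inj.
    by rewrite -h1.
  by rewrite t2.
apply: big1 => q _; rewrite ffunE; case: eqP => [q0|_]; last by rewrite !mulr0.
case H: (qconcat _ _ _); rewrite ?mul0r //.
case/and3P: H => /eqP h1 _ /eqP h2; case/eqP: pr; apply: qpath_inj => //.
by rewrite h2 q0 cats0.
Qed.

Lemma pa_mulDl : left_distributive pa_mul +%R.
Proof.
move=> f g h; apply/ffunP => r; rewrite !ffunE -big_split; apply: eq_bigr => p _.
rewrite -big_split; apply: eq_bigr => q _ /=.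
by rewrite ffunE mulrDl mulrDr.
Qed.

Lemma pa_mulDr : right_distributive pa_mul +%R.
Proof.
move=> f g h; apply/ffunP => r; rewrite !ffunE -big_split; apply: eq_bigr => p _.
rewrite -big_split; apply: eq_bigr => q _ /=.
by rewrite ffunE !mulrDr.
Qed.

Lemma pa_one_neq0 : pa_one != 0.
Proof.
have /card_gt0P[v _] := qvert_gt0 Q; have [t [_ t2]] := qtriv_ex v.
apply/eqP => /ffunP/(_ t)/eqP; rewrite !ffunE t2 eqxx.
by rewrite (negbTE (oner_neq0 k)).
Qed.

HB.instance Definition _ := GRing.Zmodule_isNzRing.Build pathalg
  pa_mulA pa_mul1x pa_mulx1 pa_mulDl pa_mulDr pa_one_neq0.

Lemma pa_scaleAl (a : k) (f g : pathalg) : a *: (f * g) = (a *: f) * g.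
Proof.
apply/ffunP => r; rewrite !ffunE scaler_sumr; apply: eq_bigr => p _.
rewrite scaler_sumr; apply: eq_bigr => q _.
by rewrite ffunE -[a *: _]/(a * _) -[(a *: f p)]/(a * f p); ring.
Qed.

HB.instance Definition _ := GRing.Lmodule_isLalgebra.Build k pathalg pa_scaleAl.

Lemma pa_scaleAr (a : k) (f g : pathalg) : a *: (f * g) = f * (a *: g).
Proof.
apply/ffunP => r; rewrite !ffunE scaler_sumr; apply: eq_bigr => p _.
rewrite scaler_sumr; apply: eq_bigr => q _.
by rewrite ffunE -[a *: _]/(a * _) -[(a *: g q)]/(a * g q); ring.
Qed.

HB.instance Definition _ := GRing.Lalgebra_isAlgebra.Build k pathalg pa_scaleAr.
HB.instance Definition _ := Algebra_isFalgebra.Build k pathalg.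

End PathAlgebra.

Definition tilted (k : fieldType) (C : falgType k) : Prop :=
  exists (Q : quiver) (T : rmod (pathalg k Q)),
    [/\ qacyclic Q, qconnected Q, tilting T, basic T & is_endalg T C].

(* Main.v *)
(* Let T be the tilting module, viewed as a C-A-bimodule; A is hereditary and C = End_A T.
   If a C-module Y embeds into a power of DT, then the trace of T in the kernel of the map
   from Y (x) T to a power of T shows that the syzygy of Y is projective, and that
   Ext^1_C(Y, C) is generated by T as a left C-module.  All syzygies are cogenerated by DT,
   so E = Ext^1_C(syz DC, C) is generated by T; hence DE is cogenerated by DT and
   pd DE <= 1.  As DC is injective, a chain homotopy argument on its projective resolution
   gives Ext^1(E, E) = 0 for left modules, so Ext^1(DE, DE) = 0.  The bimodule DT is tilting
   over the opposite algebras and Ext^2(DC, C) may be computed from either side, so the same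
   holds for E as a right module; moreover Ext^1_C(DE, E) = 0, since DE is cogenerated by DT
   and D(E_C) by T.  As B is the sum of C and E, the vanishing of Ext^1_C(DE, DE) and of
   Ext^1_C(DE, E) gives projective dimension at most one and rigidity for the induced module
   over B.  Coinduced modules are dual to induced modules over the opposite algebras.
   Finally, for modules of projective dimension at most one, rigidity implies
   tau-rigidity. *)
From HB Require Import structures.
From Stdlib Require Import Classical_Prop.
Require Import Defs.
From mathcomp Require Import all_boot all_algebra all_field.
Set Implicit Arguments.
Unset Strict Implicit.
Unset Printing Implicit Defensive.
Import GRing.Theory.
Local Open Scope ring_scope.

(** * Linear maps and maps of bimodules *)

(** The tensor product Y (x) T of the overview is taken over k, so it is a power of T, and Hom_A(T,
    Y (x) T) = Y (x) C is the free module at the start of the standard resolution of Y. The trace N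
    is preferred to the whole kernel because it is a quotient of (syz Y) (x) T, while Hom_A(T, N) is
    still exactly syz Y. Being also a submodule of a power of T, it inherits vanishing of Ext^1_A(-,
    K) from T by heredity, and so becomes a direct summand of (syz Y) (x) T. Applying Hom_A(T, -)
    makes syz Y a summand of a free module. The main obstacle is that E is computed by right modules
    while (b) needs it as an Ext of left modules. No comparison of derived functors is made: classes
    are represented by forms on words (x, p, q, y) with x, y in DC and p, q in C, and reading the
    words backwards exchanges the two sides. One-sided modules are bimodules with k^o on the other
    side, so vanishing of Ext^1 is formulated once, as an extension property for short exact
    sequences of bimodules. *)

Section LinearAlgebra.
Variable k : fieldType.
Implicit Types U V W Z : vectType k.

Lemma surjP V W (f : 'Hom(V, W)) : (limg f = fullv) <-> (forall y, exists x, y = f x).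
Proof.
split=> [e y|h]; first by have := memvf y; rewrite -e => /memv_imgP[x _ ->]; exists x.
apply/vspaceP => y; rewrite memvf; have [x ->] := h y.
by rewrite memv_img ?memvf.
Qed.

Lemma injP V W (f : 'Hom(V, W)) : (lker f = 0%VS) <-> (forall x, f x = 0 -> x = 0).
Proof.
split=> [e x /eqP|h]; first by rewrite -memv_ker e memv0 => /eqP.
apply/vspaceP => x; rewrite memv_ker memv0; apply/eqP/eqP => [/h //|->].
exact: linear0.
Qed.

Lemma lker_inj V W (f : 'Hom(V, W)) x y : lker f = 0%VS -> f x = f y -> x = y.
Proof.
move=> /injP h e; apply/eqP; rewrite -subr_eq0; apply/eqP/h.
by rewrite linearB /= e subrr.
Qed.

Lemma inv_lfunE V W (f : 'Hom(V, W)) x : f (f^-1%VF (f x)) = f x.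
Proof. by rewrite limg_lfunVK // memv_img ?memvf. Qed.

Lemma hom_factor U V W (p : 'Hom(U, V)) (f : 'Hom(U, W)) :
  (forall x, p x = 0 -> f x = 0) -> exists h : 'Hom(V, W), forall x, h (p x) = f x.
Proof.
move=> h; exists (f \o p^-1)%VF => x; rewrite comp_lfunE.
apply/eqP; rewrite -subr_eq0 -linearB; apply/eqP/h.
by rewrite linearB /= inv_lfunE subrr.
Qed.

Lemma hom_lift U V W (p : 'Hom(V, W)) (f : 'Hom(U, W)) :
  limg p = fullv -> exists h : 'Hom(U, V), forall x, p (h x) = f x.
Proof.
move=> h; exists (p^-1 \o f)%VF => x; rewrite comp_lfunE limg_lfunVK //.
by rewrite h memvf.
Qed.

Lemma hom_factor_inj U V W (i : 'Hom(V, W)) (f : 'Hom(U, W)) :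
  (forall x, exists y, f x = i y) -> exists h : 'Hom(U, V), forall x, i (h x) = f x.
Proof.
move=> h; exists (i^-1 \o f)%VF => x; rewrite comp_lfunE.
by have [y ->] := h x; rewrite inv_lfunE.
Qed.

Lemma hom_extend U V W (i : 'Hom(U, V)) (f : 'Hom(U, W)) :
  (forall x, i x = 0 -> x = 0) -> exists h : 'Hom(V, W), forall x, h (i x) = f x.
Proof. by move=> h; apply: hom_factor => x /h ->; rewrite linear0. Qed.

Lemma vcoordE V i (x : V) : vcoord i x = coord (vbasis {:V}) i x.
Proof. exact: mklinE. Qed.

Lemma vbasis_sum V (x : V) : x = \sum_(i < \dim {:V}) (vcoord i x : k) *: (vbasis {:V})`_i.
Proof. by rewrite {1}(coord_vbasis (memvf x)); apply: eq_bigr => i _; rewrite vcoordE. Qed.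

Lemma dual_sep V (x : V) : (forall phi : dualv V, phi x = 0) -> x = 0.
Proof. by move=> h; rewrite (vbasis_sum x) big1 // => i _; rewrite h scale0r. Qed.

Lemma dual_sum V (phi : dualv V) :
  phi = \sum_(i < \dim {:V}) (phi (vbasis {:V})`_i : k) *: vcoord i.
Proof.
apply/lfunP => x; rewrite sum_lfunE {1}(vbasis_sum x) linear_sum.
by apply: eq_bigr => i _; rewrite linearZ scale_lfunE /=; exact: mulrC.
Qed.

Lemma tens_ext0 V W Z (f : 'Hom('Hom(dualv V, W), Z)) :
  (forall x y, f (tens x y) = 0) -> forall t, f t = 0.
Proof.
move=> h t; suff -> : f = 0 by rewrite zero_lfunE.
by apply: (@tens_ext k V W Z) => x y; rewrite h zero_lfunE.
Qed.

Lemma linf_sum V W (f : V -> W) (hf : linear f) (I : finType) (F : I -> V) :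
  f (\sum_i F i) = \sum_i f (F i).
Proof.
rewrite -(mklinE hf) linear_sum; apply: eq_bigr => i _; exact: mklinE.
Qed.

Lemma linf_sub V W (f : V -> W) (hf : linear f) x y : f (x - y) = f x - f y.
Proof. by rewrite -!(mklinE hf) linearB. Qed.

Lemma linf0 V W (f : V -> W) (hf : linear f) : f 0 = 0.
Proof. by rewrite -!(mklinE hf) linear0. Qed.

(** This is the universal property of V (x)_k W in its encoding by linear maps out of the dual of V;
    the map is read off at the coordinate functionals, as in [tens_sum]. *)
Lemma hom_of_bilin V W Z (b : V -> W -> Z) :
  (forall y, linear (b^~ y)) -> (forall x, linear (b x)) ->
  exists h : 'Hom('Hom(dualv V, W), Z), forall x y, h (tens x y) = b x y.
Proof.
move=> bl br.
pose F (t : 'Hom(dualv V, W)) := \sum_(i < \dim {:V}) b (vbasis {:V})`_i (t (vcoord i)).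
have lF : linear F.
  move=> c t t'; rewrite /F scaler_sumr -big_split; apply: eq_bigr => i _ /=.
  by rewrite add_lfunE scale_lfunE br.
exists (mklin lF) => x y; rewrite mklinE /F -(mklinE (bl y)) {2}(vbasis_sum x) linear_sum.
by apply: eq_bigr => i _; rewrite tensE linearZ /= mklinE -(mklinE (br _)) linearZ /= mklinE.
Qed.

End LinearAlgebra.

Section BimodMaps.
Variable k : fieldType.
Variables A B : falgType k.
Implicit Types X Y Z S Q : bimod A B.

Lemma bhoml X Y (f : bhom X Y) a x : f (lact a x) = lact a (f x).
Proof. exact: (bhomP f).1. Qed.
Lemma bhomr X Y (f : bhom X Y) x b : f (ract x b) = ract (f x) b.
Proof. exact: (bhomP f).2. Qed.

Lemma lact0 X a : lact a (0 : X) = 0. Proof. by rewrite -lacthE linear0. Qed.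
Lemma ract0 X b : ract (0 : X) b = 0. Proof. by rewrite -racthE linear0. Qed.
Lemma lactD X a (x y : X) : lact a (x + y) = lact a x + lact a y.
Proof. by rewrite -!lacthE linearD. Qed.
Lemma ractD X b (x y : X) : ract (x + y) b = ract x b + ract y b.
Proof. by rewrite -!racthE linearD. Qed.
Lemma lactZ X a c (x : X) : lact a (c *: x) = c *: lact a x.
Proof. by rewrite -!lacthE linearZ. Qed.
Lemma ractZ X b c (x : X) : ract (c *: x) b = c *: ract x b.
Proof. by rewrite -!racthE linearZ. Qed.
Lemma lact_sum X a I (r : seq I) (P : pred I) (F : I -> X) :
  lact a (\sum_(i <- r | P i) F i) = \sum_(i <- r | P i) lact a (F i).
Proof. by rewrite -lacthE linear_sum; apply: eq_bigr => i _; exact: lacthE. Qed.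
Lemma ract_sum X b I (r : seq I) (P : pred I) (F : I -> X) :
  ract (\sum_(i <- r | P i) F i) b = \sum_(i <- r | P i) ract (F i) b.
Proof. by rewrite -racthE linear_sum; apply: eq_bigr => i _; exact: racthE. Qed.
Lemma lact0l X (x : X) : lact (0 : A) x = 0.
Proof. by rewrite -(mklinE (@lact_linl _ _ _ X x)) linear0. Qed.
Lemma ract0r X (x : X) : ract x (0 : B) = 0.
Proof. by rewrite -(mklinE (@ract_linr _ _ _ X x)) linear0. Qed.
Lemma lactDl X a a' (x : X) : lact (a + a') x = lact a x + lact a' x.
Proof. by rewrite -!(mklinE (@lact_linl _ _ _ X x)) linearD. Qed.
Lemma ractDr X b b' (x : X) : ract x (b + b') = ract x b + ract x b'.
Proof. by rewrite -!(mklinE (@ract_linr _ _ _ X x)) linearD. Qed.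
Lemma lactZl X a c (x : X) : lact (c *: a) x = c *: lact a x.
Proof. by rewrite -!(mklinE (@lact_linl _ _ _ X x)) linearZ. Qed.
Lemma lactNl X a (x : X) : lact (- a) x = - lact a x.
Proof. by rewrite -!(mklinE (@lact_linl _ _ _ X x)) linearN. Qed.
Lemma lact_suml X (x : X) I (r : seq I) (P : pred I) (F : I -> A) :
  lact (\sum_(i <- r | P i) F i) x = \sum_(i <- r | P i) lact (F i) x.
Proof. 
rewrite -(mklinE (@lact_linl _ _ _ X x)) linear_sum; apply: eq_bigr => i _.
exact: mklinE.
Qed.
Lemma ract_sumr X (x : X) I (r : seq I) (P : pred I) (F : I -> B) :
  ract x (\sum_(i <- r | P i) F i) = \sum_(i <- r | P i) ract x (F i).
Proof. 
rewrite -(mklinE (@ract_linr _ _ _ X x)) linear_sum; apply: eq_bigr => i _.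
exact: mklinE.
Qed.

Lemma bhom_of X Y (f : 'Hom(X, Y)) :
  (forall a x, f (lact a x) = lact a (f x)) ->
  (forall x b, f (ract x b) = ract (f x) b) ->
  exists g : bhom X Y, forall x, g x = f x.
Proof. by move=> h1 h2; exists (Bhom (conj h1 h2)). Qed.

Definition bidh X : bhom X X.
Proof. by exists \1%VF; split=> *; rewrite !id_lfunE. Defined.

Definition bcomp X Y Z (g : bhom Y Z) (f : bhom X Y) : bhom X Z.
Proof. by exists (g \o f)%VF; split=> *; rewrite !comp_lfunE ?bhoml ?bhomr. Defined.

Definition bsubh X Y (f g : bhom X Y) : bhom X Y.
Proof.
exists ((f : 'Hom(X, Y)) - (g : 'Hom(X, Y))); split=> *; rewrite !add_lfunE !opp_lfunE ?bhoml ?bhomr.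
  by rewrite lactB.
by rewrite ractB.
Defined.

Definition baddh X Y (f g : bhom X Y) : bhom X Y.
Proof.
exists ((f : 'Hom(X, Y)) + (g : 'Hom(X, Y))); split=> *; rewrite !add_lfunE ?bhoml ?bhomr.
  by rewrite lactD.
by rewrite ractD.
Defined.

Lemma bidhE X x : bidh X x = x. Proof. exact: id_lfunE. Qed.
Lemma bcompE X Y Z (g : bhom Y Z) (f : bhom X Y) x : bcomp g f x = g (f x).
Proof. exact: comp_lfunE. Qed.
Lemma bsubhE X Y (f g : bhom X Y) x : bsubh f g x = f x - g x.
Proof. by rewrite /= add_lfunE opp_lfunE. Qed.
Lemma baddhE X Y (f g : bhom X Y) x : baddh f g x = f x + g x.
Proof. by rewrite /= add_lfunE. Qed.

Lemma bhom_sum X Y (f : bhom X Y) (I : finType) (F : I -> X) :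
  f (\sum_i F i) = \sum_i f (F i).
Proof. exact: linear_sum. Qed.

Lemma bhomD X Y (f : bhom X Y) x y : f (x + y) = f x + f y.
Proof. exact: linearD. Qed.

Lemma bhom0 X Y (f : bhom X Y) : f 0 = 0.
Proof. exact: linear0. Qed.

Lemma bhom_factor X Y Z (p : bhom X Y) (f : bhom X Z) : limg p = fullv ->
  (forall x, p x = 0 -> f x = 0) -> exists h : bhom Y Z, forall x, h (p x) = f x.
Proof.
move=> /surjP sp hk; have [h hE] := hom_factor hk.
have [| |g gE] := @bhom_of _ _ h.
- by move=> a y; have [x ->] := sp y; rewrite -bhoml !hE bhoml.
- by move=> y b; have [x ->] := sp y; rewrite -bhomr !hE bhomr.
by exists g => x; rewrite gE hE.
Qed.

Lemma bhom_factor_inj X Y Z (i : bhom Y Z) (f : bhom X Z) : lker i = 0%VS ->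
  (forall x, exists y, f x = i y) -> exists h : bhom X Y, forall x, i (h x) = f x.
Proof.
move=> /injP ii hk; have [h hE] := hom_factor_inj hk.
have inj y y' : i y = i y' -> y = y'.
  by move=> e; apply/eqP; rewrite -subr_eq0; apply/eqP/ii; rewrite linearB /= e subrr.
have [| |g gE] := @bhom_of _ _ h.
- by move=> a x; apply: inj; rewrite bhoml !hE bhoml.
- by move=> x b; apply: inj; rewrite bhomr !hE bhomr.
by exists g => x; rewrite gE hE.
Qed.

Definition bincl X (U : {vspace X}) (sU : stable U) : bhom (bsub sU) X.
Proof.
exists (linfun (@vsval _ _ U)); split=> [a x|x b]; rewrite !lfunE /= vsprojK //.
  by apply: sU.1; apply: subvsP.
by apply: sU.2; apply: subvsP.
Defined.

Lemma binclE X (U : {vspace X}) (sU : stable U) x : bincl sU x = vsval x.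
Proof. by rewrite /= lfunE. Qed.

Lemma bincl_inj X (U : {vspace X}) (sU : stable U) : lker (bincl sU) = 0%VS.
Proof. by apply/injP => x; rewrite binclE => e; apply: subvs_inj; rewrite e linear0. Qed.

Lemma bincl_im X (U : {vspace X}) (sU : stable U) : limg (bincl sU) = U.
Proof.
apply/vspaceP => x; apply/idP/idP => [/memv_imgP[y _ ->]|xU].
  by rewrite binclE subvsP.
apply/memv_imgP; exists (vsproj U x); rewrite ?memvf // binclE vsprojK //.
Qed.

Lemma bker_inclE X Y (f : bhom X Y) x : bker_incl f x = vsval x.
Proof. by rewrite /= lfunE. Qed.

Lemma bker_valr X Y (f : bhom X Y) (x : bker f) b : vsval (ract x b) = ract (vsval x) b.
Proof. by rewrite -!bker_inclE bhomr. Qed.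

Lemma bker_vall X Y (f : bhom X Y) (x : bker f) a : vsval (lact a x) = lact a (vsval x).
Proof. by rewrite -!bker_inclE bhoml. Qed.

Lemma bker_incl_inj X Y (f : bhom X Y) : lker (bker_incl f) = 0%VS.
Proof. by apply/injP => x; rewrite bker_inclE => e; apply: subvs_inj; rewrite e linear0. Qed.

Lemma bker_incl_im X Y (f : bhom X Y) : limg (bker_incl f) = lker f.
Proof.
apply/vspaceP => x; apply/idP/idP => [/memv_imgP[y _ ->]|xU].
  by rewrite bker_inclE subvsP.
apply/memv_imgP; exists (vsproj (lker f) x); rewrite ?memvf // bker_inclE vsprojK //.
Qed.

Lemma bker_val0 X Y (f : bhom X Y) (x : bker f) : f (vsval x) = 0.
Proof. by apply/eqP; rewrite -memv_ker subvsP. Qed.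

Lemma bker_elt X Y (f : bhom X Y) x : f x = 0 -> exists y : bker f, vsval y = x.
Proof.
move=> e; exists (vsproj (lker f) x); rewrite vsprojK //.
by rewrite memv_ker e.
Qed.

Lemma bker_short X Y (f : bhom X Y) : limg f = fullv -> short_exact (bker_incl f) f.
Proof. by move=> h; split; rewrite ?bker_incl_inj ?bker_incl_im. Qed.

Definition bproj X (U : {vspace X}) (sU : stable U) : bhom X (bquot sU).
Proof.
exists (mklin (@vpi_linear _ _ U)); split=> [a x|x b]; rewrite !mklinE.
  by rewrite -(bquot_l sU).
by rewrite -(bquot_r sU).
Defined.

Lemma bprojE X (U : {vspace X}) (sU : stable U) x : bproj sU x = vpi U x.
Proof. exact: mklinE. Qed.

Lemma bproj_surj X (U : {vspace X}) (sU : stable U) : limg (bproj sU) = fullv.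
Proof. by apply/surjP => y; exists (vrepr y); rewrite bprojE vpiK. Qed.

Lemma bproj_ker X (U : {vspace X}) (sU : stable U) : lker (bproj sU) = U.
Proof. by apply/vspaceP => x; rewrite memv_ker bprojE vpi_eq0. Qed.

Lemma bproj_im_eq X Y (f : bhom X Y) y y' d : y = y' + f d ->
  bproj (im_stable f) y = bproj (im_stable f) y'.
Proof.
by move=> ->; rewrite !bprojE; apply/vpi_eq; rewrite addrC addKr memv_img ?memvf.
Qed.

Lemma bproj_im_ker X Y (f : bhom X Y) y : bproj (im_stable f) y = 0 -> exists d, y = f d.
Proof. by move/eqP; rewrite -memv_ker bproj_ker => /memv_imgP[d _ ->]; exists d. Qed.

Lemma short_exactP X Y Z (f : bhom X Y) (g : bhom Y Z) :
  short_exact f g <-> [/\ forall x, f x = 0 -> x = 0, forall x, g (f x) = 0,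
    forall y, g y = 0 -> exists x, y = f x & forall z, exists y, z = g y].
Proof.
split=> [[/injP h1 h2 /surjP h3]|[h1 h2 h3 h4]]; split=> //.
- by move=> x; apply/eqP; rewrite -memv_ker -h2 memv_img ?memvf.
- by move=> y /eqP; rewrite -memv_ker -h2 => /memv_imgP[x _ ->]; exists x.
- exact/injP.
- apply/vspaceP => y; rewrite memv_ker; apply/idP/eqP => [/memv_imgP[x _ ->] //|].
  by case/h3 => x ->; rewrite memv_img ?memvf.
exact/surjP.
Qed.

Lemma bzeroP X : bzero X <-> forall x : X, x = 0.
Proof.
split=> [h x|h]; first by have := memvf x; rewrite h memv0 => /eqP.
by apply/vspaceP => x; rewrite (h x) !mem0v.
Qed.

End BimodMaps.

(** * Duality, projective and injective modules, Ext^1 *)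

Section Duality.
Variable k : fieldType.

Section Maps.
Variables A B : falgType k.
Implicit Types X Y Z : bimod A B.

Lemma bdual_lE X (b : B) (phi : bdual X) (x : X) :
  (lact b phi : dualv X) x = (phi : dualv X) (ract x b).
Proof. by rewrite /= comp_lfunE racthE. Qed.

Lemma bdual_rE X (a : A) (phi : bdual X) (x : X) :
  (ract phi a : dualv X) x = (phi : dualv X) (lact a x).
Proof. by rewrite /= comp_lfunE lacthE. Qed.

End Maps.

Section Maps2.
Variables A B : falgType k.
Implicit Types X Y Z : bimod A B.

Definition dualh X Y (f : bhom X Y) : bhom (bdual Y) (bdual X).
Proof.
exists (mklin (@compr_lin k X Y k^o f)).
split=> [b phi|phi a]; rewrite !mklinE; apply/lfunP => x.
  by rewrite bdual_lE !comp_lfunE racthE bhomr.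
by rewrite bdual_rE !comp_lfunE lacthE bhoml.
Defined.

Lemma dualhE X Y (f : bhom X Y) (phi : bdual Y) x :
  (dualh f phi : dualv X) x = (phi : dualv Y) (f x).
Proof. by rewrite /= mklinE comp_lfunE. Qed.

Lemma dualh_surj X Y (f : bhom X Y) : lker f = 0%VS -> limg (dualh f) = fullv.
Proof.
move=> /injP h; apply/surjP => phi; have [psi e] := hom_extend phi h.
by exists psi; apply/lfunP => x; rewrite dualhE e.
Qed.

Lemma dualh_inj X Y (f : bhom X Y) : limg f = fullv -> lker (dualh f) = 0%VS.
Proof.
move=> /surjP h; apply/injP => phi /lfunP e; apply/lfunP => y.
by have [x ->] := h y; have := e x; rewrite dualhE !zero_lfunE.
Qed.

Lemma dual_short X Y Z (f : bhom X Y) (g : bhom Y Z) :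
  short_exact f g -> short_exact (dualh g) (dualh f).
Proof.
move=> [h1 h2 h3]; split; [exact: dualh_inj| |exact: dualh_surj].
apply/vspaceP => phi; rewrite memv_ker; apply/idP/eqP => [/memv_imgP[psi _ ->]|/lfunP e].
  apply/lfunP => x; rewrite !dualhE zero_lfunE; suff -> : g (f x) = 0 by exact: linear0.
  by apply/eqP; rewrite -memv_ker -h2 memv_img ?memvf.
have [|psi hp] := @hom_factor _ _ _ _ g phi.
  move=> y /eqP; rewrite -memv_ker -h2 => /memv_imgP[x _ ->].
  by have := e x; rewrite dualhE zero_lfunE.
have -> : phi = dualh g psi by apply/lfunP => y; rewrite dualhE hp.
by rewrite memv_img ?memvf.
Qed.

End Maps2.

Section Maps3.
Variables A B : falgType k.
Implicit Types X Y Z : bimod A B.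

Lemma beval_lin (V : vectType k) :
  linear (fun x : V => mklin (fun (c : k) (f g : dualv V) =>
    etrans (add_lfunE _ _ x) (congr1 (+%R^~ (g x)) (scale_lfunE c f x)))).
Proof.
by move=> c x y; apply/lfunP => f; rewrite add_lfunE scale_lfunE !mklinE linearP.
Qed.

Definition evalv (V : vectType k) : 'Hom(V, dualv (dualv V)) := mklin (@beval_lin V).

Lemma evalvE (V : vectType k) (x : V) (f : dualv V) : evalv V x f = f x.
Proof. by rewrite !mklinE. Qed.

Definition beval X : bhom X (bdual (bdual X)).
Proof.
exists (evalv X); split=> [a x|x b]; apply/lfunP => f; rewrite evalvE.
  by rewrite bdual_lE evalvE bdual_rE.
by rewrite bdual_rE evalvE bdual_lE.
Defined.

Lemma bevalE X (x : X) (f : dualv X) : (beval X x : dualv (dualv X)) f = f x.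
Proof. exact: evalvE. Qed.

Lemma evalv_surj (V : vectType k) (F : dualv (dualv V)) :
  F = evalv V (\sum_(i < \dim {:V}) (F (vcoord i) : k) *: (vbasis {:V})`_i).
Proof.
apply/lfunP => f; rewrite evalvE {1}(dual_sum f) !linear_sum.
by apply: eq_bigr => i _; rewrite !linearZ /=; exact: mulrC.
Qed.

Lemma beval_inj X : lker (beval X) = 0%VS.
Proof.
by apply/injP => x e; apply: dual_sep => f; rewrite -bevalE e zero_lfunE.
Qed.

Lemma beval_full X : limg (beval X) = fullv.
Proof. by apply/surjP => F; rewrite (evalv_surj F); eexists. Qed.

Lemma beval_iso X : biso X (bdual (bdual X)).
Proof. by exists (beval X); split; [exact: beval_inj|exact: beval_full]. Qed.

(** By reflexivity: Df composed with X -> DDX takes values in DDY, which is identified with Y by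
    [beval]. *)
Lemma dual_transpose X Y (f : bhom (bdual Y) (bdual X)) :
  exists g : bhom X Y, dualh g = f :> 'Hom(_, _).
Proof.
have [|g gE] := @bhom_factor_inj _ _ _ X Y _ (beval Y) (bcomp (dualh f) (beval X)) (beval_inj Y).
  by move=> x; have /surjP h := beval_full Y; apply: h.
exists g; apply/lfunP => phi; apply/lfunP => x.
by rewrite [LHS]dualhE -[LHS]bevalE gE bcompE (dualhE f) bevalE.
Qed.

Lemma biso_sym X Y : biso X Y -> biso Y X.
Proof.
case=> f [h1 h2]; have [x e|g gE] := bhom_factor (f := bidh X) h2.
  by rewrite bidhE; move/injP: h1; apply.
exists g; split.
  apply/injP => y; have /surjP h := h2; have [x ->] := h y.
  by rewrite gE bidhE => ->; rewrite linear0.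
by apply/surjP => x; exists (f x); rewrite gE bidhE.
Qed.

Lemma biso_inv X Y : biso X Y -> exists (f : bhom X Y) (g : bhom Y X),
  (forall x, g (f x) = x) /\ (forall y, f (g y) = y).
Proof.
case=> f [h1 h2]; have [x e|g gE] := bhom_factor (f := bidh X) h2.
  by rewrite bidhE; move/injP: h1; apply.
exists f, g; split=> [x|y]; first by rewrite gE bidhE.
by have /surjP h := h2; have [x ->] := h y; rewrite gE bidhE.
Qed.

End Maps3.
End Duality.

(** * Projective presentations, vanishing of Ext^1, projective covers *)

Section Homological.
Variable k : fieldType.
Variables A B : falgType k.
Implicit Types X Y Z S Q P M N K : bimod A B.

Lemma projP P : projective P <-> forall X Y (g : bhom X Y) (f : bhom P Y),
  limg g = fullv -> exists h : bhom P X, forall x, g (h x) = f x.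
Proof.
split=> H X Y g f hg; have [h e] := H X Y g f hg; exists h.
  by move=> x; rewrite -e comp_lfunE.
by apply/lfunP => x; rewrite comp_lfunE e.
Qed.

Lemma inj_modP P : injective_mod P <-> forall X Y (g : bhom X Y) (f : bhom X P),
  lker g = 0%VS -> exists h : bhom Y P, forall x, h (g x) = f x.
Proof.
split=> H X Y g f hg; have [h e] := H X Y g f hg; exists h.
  by move=> x; rewrite -e comp_lfunE.
by apply/lfunP => x; rewrite comp_lfunE e.
Qed.

Lemma proj_retract P Q (i : bhom Q P) (r : bhom P Q) : projective P ->
  (forall x, r (i x) = x) -> projective Q.
Proof.
move=> /projP hP ri; apply/projP => X Y g f hg.
have [h hE] := hP X Y g (bcomp f r) hg; exists (bcomp h i) => x.
by rewrite bcompE hE bcompE ri.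
Qed.

(** The free bimodule A (x)_k X (x)_k B on the vector space X, with a (x) x (x) b written
    [fgen a x b]. With k^o on one side it also supplies enough projectives for one-sided modules. *)
Definition freeb X : bimod A B := btensk (breg A) (btensk X (breg B)).

Definition fgen X (a : A) (x : X) (b : B) : freeb X := tens (a : breg A) (tens x (b : breg B)).

Lemma fgen_lact X a' a (x : X) b : lact a' (fgen a x b) = fgen (a' * a) x b.
Proof. exact: (@lact_tens _ A _ _ _ (breg A) (btensk X (breg B))). Qed.

Lemma fgen_ract X a (x : X) b b' : ract (fgen a x b) b' = fgen a x (b * b').
Proof.
have := @ract_tens _ A _ _ _ (breg A) (btensk X (breg B)) b' a (tens x (b : breg B)).
rewrite /fgen => ->; congr tens.
exact: (@ract_tens _ _ _ _ _ X (breg B)).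
Qed.

Lemma fgen_ext X (V : vectType k) (f g : 'Hom(freeb X, V)) :
  (forall a x b, f (fgen a x b) = g (fgen a x b)) -> f =1 g.
Proof.
move=> h t; apply/eqP; rewrite -subr_eq0; apply/eqP.
have -> : f t - g t = (f - g) t by rewrite add_lfunE opp_lfunE.
apply: (@tens_ext0 _ (breg A) (btensk X (breg B))) => a u.
rewrite add_lfunE opp_lfunE.
have L (w : 'Hom(freeb X, V)) : linear (fun u : 'Hom(dualv X, breg B) => w (tens (a : breg A) u)).
  by move=> c x y; rewrite tens_linr linearP.
rewrite -(mklinE (L f)) -(mklinE (L g)).
have -> : mklin (L f) = mklin (L g) by apply: tens_ext => x b; rewrite !mklinE; apply: h.
by rewrite subrr.
Qed.

Lemma freeb_lift X Y (f : 'Hom(X, Y)) :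
  exists h : bhom (freeb X) Y, forall a x b, h (fgen a x b) = lact a (ract (f x) b).
Proof.
have [| |h1 h1E] := @hom_of_bilin k X B Y (fun x b => ract (f x) b).
- by move=> b c x y; rewrite linearP ract_linl.
- by move=> x c b b'; rewrite ract_linr.
have [| |h2 h2E] := @hom_of_bilin k A 'Hom(dualv X, B) Y (fun a t => lact a (h1 t)).
- by move=> t c a a'; rewrite lact_linl.
- by move=> a c t t'; rewrite linearP lact_linr.
have hE a x b : h2 (fgen a x b) = lact a (ract (f x) b) by rewrite h2E h1E.
have [| |h e] := @bhom_of _ _ _ (freeb X) Y h2.
- move=> a t; have := @fgen_ext X Y (h2 \o lacth (freeb X) a)%VF (lacth Y a \o h2)%VF.
  move=> /(_ _ t); rewrite !comp_lfunE !lacthE; apply=> a' x b.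
  by rewrite !comp_lfunE !lacthE fgen_lact !hE lactM.
- move=> t b; have := @fgen_ext X Y (h2 \o racth (freeb X) b)%VF (racth Y b \o h2)%VF.
  move=> /(_ _ t); rewrite !comp_lfunE !racthE; apply=> a x b'.
  by rewrite !comp_lfunE !racthE fgen_ract !hE ractM lractA.
by exists h => a x b; rewrite e hE.
Qed.

Lemma freeb_proj X : projective (freeb X).
Proof.
apply/projP => Y Z g f hg.
have L : linear (fun x : X => f (fgen 1 x 1)).
  by move=> c x y; rewrite /fgen tens_linl tens_linr linearP.
have [u uE] := hom_lift (mklin L) hg.
have [h hE] := freeb_lift u; exists h => t.
have := @fgen_ext X Z (g \o h)%VF f; move=> /(_ _ t); rewrite comp_lfunE; apply=> a x b.
rewrite comp_lfunE hE bhoml bhomr uE mklinE -bhomr -bhoml fgen_ract fgen_lact.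
by rewrite mul1r mulr1.
Qed.

Lemma enough_proj X : exists P (p : bhom P X), projective P /\ limg p = fullv.
Proof.
have [h hE] := freeb_lift (bidh X); exists (freeb X), h; split; first exact: freeb_proj.
by apply/surjP => x; exists (fgen 1 x 1); rewrite hE ract1 lact1 bidhE.
Qed.

Lemma proj_pres X : exists K P (i : bhom K P) (p : bhom P X),
  projective P /\ short_exact i p.
Proof.
have [P [p [h1 h2]]] := enough_proj X.
by exists (bker p), P, (bker_incl p), p; split=> //; apply: bker_short.
Qed.

(* Ext^1(X, Z) = 0 *)
Definition ext1z X Z : Prop := forall S Q (i : bhom S Q) (q : bhom Q X),
  short_exact i q -> forall f : bhom S Z, exists h : bhom Q Z, forall s, h (i s) = f s.

(** Every extension Q of X by S is a pushout of the given presentation: lifting p to l : P -> Q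
    writes Q as the quotient of S + P by K. So f on S and an extension u of f restricted to K glue
    to a map on Q. *)
Lemma ext1z_pres X Z K P (i : bhom K P) (p : bhom P X) :
  projective P -> short_exact i p ->
  (forall f : bhom K Z, exists h : bhom P Z, forall s, h (i s) = f s) -> ext1z X Z.
Proof.
move=> /projP hP /short_exactP[i1 i2 i3 i4] H S Q j q /[dup] hjq.
move=> /short_exactP[j1 j2 j3 j4] f.
have [l lE] := hP Q X q p (let: And3 _ _ e := hjq in e).
have [|lk lkE] := @bhom_factor_inj _ _ _ _ _ _ j (bcomp l i) (let: And3 e _ _ := hjq in e).
  by move=> x; rewrite bcompE; apply: j3; rewrite lE i2.
have [u uE] := H (bcomp f lk).
have psurj : limg p = fullv by apply/surjP.
have [s sE] := hom_lift q psurj.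
have [|r rE] := @hom_factor_inj _ _ _ _ j (\1%VF - (bfun l \o s)%VF).
  move=> x; apply: j3; rewrite add_lfunE opp_lfunE id_lfunE comp_lfunE linearB /=.
  by rewrite lE sE subrr.
have rdef x : j (r x) = x - l (s x).
  by rewrite rE add_lfunE opp_lfunE id_lfunE comp_lfunE.
(* The lift s of q is merely linear. [hE] shows that the value of h does not depend on the chosen
   decomposition x = j y + l z, and this makes h a map of bimodules. *)
pose h := ((bfun f \o r)%VF + (bfun u \o s)%VF).
have hE x y z : x = j y + l z -> h x = f y + u z.
  move=> e; rewrite add_lfunE !comp_lfunE.
  have [w wE] : exists w, s x - z = i w.
    apply: i3; rewrite linearB /= sE e linearD /= j2 add0r lE subrr //.
  have sx : s x = z + i w by rewrite -wE addrC subrK.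
  have ry : r x = y - lk w.
    apply/eqP; rewrite -subr_eq0; apply/eqP/j1; rewrite linearB linearB /= rdef lkE bcompE.
    by rewrite sx linearD {1}e opprD addrA addrK subrr.
  by rewrite ry sx linearB linearD /= uE bcompE addrACA addNr addr0.
have dec x : x = j (r x) + l (s x) by rewrite rdef subrK.
have [a x|x b|g gE] := @bhom_of _ _ _ _ _ h.
- rewrite (hE _ _ _ (dec x)) (hE _ (lact a (r x)) (lact a (s x))).
    by rewrite !bhoml lactD.
  by rewrite !bhoml -lactD -dec.
- rewrite (hE _ _ _ (dec x)) (hE _ (ract (r x) b) (ract (s x) b)).
    by rewrite !bhomr ractD.
  by rewrite !bhomr -ractD -dec.
exists g => x; rewrite gE (hE _ x 0) ?linear0 ?addr0 //.
Qed.

(** Lift f on P first. The restriction of the lift to K has values in Z and represents the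
    connecting class of f; since that class is zero, v extends to P and corrects the lift so that it
    descends to X. *)
Lemma ext1z_lift X Z Q R (i : bhom Z Q) (q : bhom Q R) :
  ext1z X Z -> short_exact i q ->
  forall f : bhom X R, exists h : bhom X Q, forall x, q (h x) = f x.
Proof.
move=> H /[dup] hiq /short_exactP[i1 i2 i3 i4] f.
have [K [P [j [p [/projP hP /[dup] hjp /short_exactP[j1 j2 j3 j4]]]]]] := proj_pres X.
have psurj : limg p = fullv by apply/surjP.
have qsurj : limg q = fullv by apply/surjP.
have [u uE] := hP _ _ q (bcomp f p) qsurj.
have [|v vE] := @bhom_factor_inj _ _ _ _ _ _ i (bcomp u j) (let: And3 e _ _ := hiq in e).
  by move=> x; rewrite bcompE; apply: i3; rewrite uE bcompE j2 linear0.
have [w wE] := H _ _ _ _ hjp v.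
have [|h hE] := bhom_factor (f := bsubh u (bcomp i w)) psurj.
  move=> y /j3[x ->]; rewrite bsubhE bcompE wE vE bcompE subrr //.
exists h => x; have [y ->] := j4 x.
by rewrite hE bsubhE bcompE linearB /= i2 subr0 uE bcompE.
Qed.

Lemma proj_ext1z P Z : projective P -> ext1z P Z.
Proof.
move=> /projP hP S Q i q /[dup] hiq /short_exactP[i1 i2 i3 i4] f.
have qsurj : limg q = fullv by apply/surjP.
have [s sE] := hP _ _ q (bidh P) qsurj.
have [|r rE] := @bhom_factor_inj _ _ _ _ _ _ i (bsubh (bidh Q) (bcomp s q)) (let: And3 e _ _ := hiq in e).
  by move=> x; apply: i3; rewrite bsubhE linearB bcompE /= sE !bidhE subrr.
exists (bcomp f r) => x; rewrite bcompE; congr (f _).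
apply/eqP; rewrite -subr_eq0; apply/eqP/i1; rewrite linearB /= rE bsubhE bcompE i2.
by rewrite linear0 subr0 bidhE subrr.
Qed.

Lemma ext1z_proj P : (forall Z, ext1z P Z) -> projective P.
Proof. by move=> H; apply/projP => X Y g f /bker_short hg; apply: ext1z_lift (H _) hg f. Qed.

(* By Schanuel's lemma. *)
Lemma pd_kernel M P (p : bhom P M) : pd_le1 M -> projective P -> limg p = fullv ->
  projective (bker p).
Proof.
case=> P1 [P0 [f [g [/projP h1 /projP h0 /[dup] hfg /short_exactP[f1 f2 f3 f4]]]]] /projP hP hp.
have gs : limg g = fullv by apply/surjP.
have [a aE] := hP _ _ g p gs; have [b bE] := h0 _ _ p g hp.
have [|a' a'E] := @bhom_factor_inj _ _ _ _ _ _ f (bcomp a (bker_incl p)) (let: And3 e _ _ := hfg in e).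
  by move=> x; apply: f3; rewrite bcompE aE bker_inclE bker_val0.
have kin : forall x : P, p x = 0 -> exists y, x = bker_incl p y.
  by move=> x /bker_elt[y <-]; exists y; rewrite bker_inclE.
have [|b' b'E] := @bhom_factor_inj _ _ _ _ _ _ (bker_incl p) (bcomp b f) (bker_incl_inj p).
  by move=> x; apply: kin; rewrite bcompE bE f2.
have [|t tE] := @bhom_factor_inj _ _ _ _ _ _ (bker_incl p) (bsubh (bidh P) (bcomp b a)) (bker_incl_inj p).
  by move=> x; apply: kin; rewrite bsubhE bcompE linearB /= bE aE bidhE subrr.
apply/projP => X Y y u hy.
have [v1 v1E] := h1 _ _ y (bcomp u b') hy; have [v2 v2E] := hP _ _ y (bcomp u t) hy.
exists (baddh (bcomp v1 a') (bcomp v2 (bker_incl p))) => x.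
rewrite baddhE !bcompE linearD /= v1E v2E !bcompE -linearD; congr (u _).
apply: subvs_inj; rewrite -!(bker_inclE (f := p)) linearD /= b'E tE bcompE a'E bsubhE !bcompE bidhE.
by rewrite addrC subrK.
Qed.

(** The kernel term P1 is projective, so a map P1 -> Z lifts to Y before it is extended to P0. *)
Lemma ext1z_quot M Y Z (g : bhom Y Z) : pd_le1 M -> limg g = fullv ->
  ext1z M Y -> ext1z M Z.
Proof.
case=> P1 [P0 [i [p [/projP h1 h0 hip]]]] hg hY; apply: (ext1z_pres h0 hip) => f.
have [v vE] := h1 _ _ g f hg; have [w wE] := hY _ _ _ _ hip v.
by exists (bcomp g w) => s; rewrite bcompE wE vE.
Qed.

Lemma ext1z_middle M Y1 Y Y2 (i : bhom Y1 Y) (q : bhom Y Y2) : short_exact i q ->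
  ext1z M Y1 -> ext1z M Y2 -> ext1z M Y.
Proof.
move=> /[dup] hiq /short_exactP[i1 i2 i3 i4] H1 H2.
have [K [P [j [p [hP /[dup] hjp /short_exactP[j1 j2 j3 j4]]]]]] := proj_pres M.
have qsurj : limg q = fullv by apply/surjP.
apply: (ext1z_pres hP hjp) => f.
have [u uE] := H2 _ _ _ _ hjp (bcomp q f).
have [v vE] := (projP P).1 hP _ _ q u qsurj.
have [|w wE] := @bhom_factor_inj _ _ _ _ _ _ i (bsubh f (bcomp v j)) (let: And3 e _ _ := hiq in e).
  by move=> x; apply: i3; rewrite bsubhE linearB bcompE /= vE uE bcompE subrr.
have [z zE] := H1 _ _ _ _ hjp w.
exists (baddh v (bcomp i z)) => x.
by rewrite baddhE bcompE zE wE bsubhE bcompE addrC subrK.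
Qed.

(** Exactness of Hom(M, G) -> Hom(M, R) -> Ext^1(M, K) -> Ext^1(M, G), in the form used later to
    test kernels of maps out of powers of T. *)
Lemma ext1z_ker M K G R (i : bhom K G) (q : bhom G R) : short_exact i q ->
  (forall f : bhom M R, exists h : bhom M G, forall x, q (h x) = f x) ->
  ext1z M G -> ext1z M K.
Proof.
move=> /[dup] hiq /short_exactP[i1 i2 i3 i4] hl H.
have [L [P [j [p [hP /[dup] hjp /short_exactP[j1 j2 j3 j4]]]]]] := proj_pres M.
apply: (ext1z_pres hP hjp) => f.
have [u uE] := H _ _ _ _ hjp (bcomp i f).
have psurj : limg p = fullv by apply/surjP.
have [|v vE] := bhom_factor (f := bcomp q u) psurj.
  by move=> x /j3[y ->]; rewrite bcompE uE bcompE i2.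
have [w wE] := hl v.
have [|z zE] := @bhom_factor_inj _ _ _ _ _ _ i (bsubh u (bcomp w p)) (let: And3 e _ _ := hiq in e).
  by move=> x; apply: i3; rewrite bsubhE linearB bcompE /= wE vE bcompE subrr.
exists z => x; apply/eqP; rewrite -subr_eq0; apply/eqP/i1.
by rewrite linearB /= zE bsubhE bcompE j2 linear0 subr0 uE bcompE subrr.
Qed.

Lemma ext1z_iso_l X X' Z : biso X X' -> ext1z X Z -> ext1z X' Z.
Proof.
move=> /biso_inv[u [v [uv vu]]] H S Q i q /short_exactP[i1 i2 i3 i4] f.
apply: (H S Q i (bcomp v q)); apply/short_exactP; split=> //.
- by move=> x; rewrite bcompE i2 linear0.
- move=> y; rewrite bcompE => e; apply: i3.
  by rewrite -(vu (q y)) e linear0.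
by move=> x; have [y e] := i4 (u x); exists y; rewrite bcompE -e uv.
Qed.

Lemma ext1z_iso_r X Z Z' : biso Z Z' -> ext1z X Z -> ext1z X Z'.
Proof.
move=> /biso_inv[u [v [uv vu]]] H S Q i q h f.
have [g gE] := H _ _ _ _ h (bcomp v f).
by exists (bcomp u g) => s; rewrite bcompE gE bcompE vu.
Qed.

Lemma pd_le1_iso X X' : biso X X' -> pd_le1 X -> pd_le1 X'.
Proof.
move=> /biso_inv[u [v [uv vu]]] [P1 [P0 [f [g [h1 h0 /short_exactP[i1 i2 i3 i4]]]]]].
exists P1, P0, f, (bcomp u g); split=> //; apply/short_exactP; split=> //.
- by move=> x; rewrite bcompE i2 linear0.
- move=> y; rewrite bcompE => e; apply: i3.
  by rewrite -(uv (g y)) e linear0.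
by move=> x; have [y e] := i4 (v x); exists y; rewrite bcompE -e vu.
Qed.

Lemma id_le1_iso X X' : biso X X' -> id_le1 X -> id_le1 X'.
Proof.
move=> /biso_inv[u [v [uv vu]]] [P1 [P0 [f [g [h1 h0 /short_exactP[i1 i2 i3 i4]]]]]].
exists P1, P0, (bcomp f v), g; split=> //; apply/short_exactP; split=> //.
- by move=> x; rewrite bcompE => /i1 e; rewrite -(vu x) e linear0.
- by move=> y; rewrite bcompE i2.
by move=> x /i3[y ->]; exists (u y); rewrite bcompE uv.
Qed.

Lemma proj_cover M : exists P (p : bhom P M),
  [/\ projective P, limg p = fullv & superfluous (lker p)].
Proof.
have [P [p [hP sp]]] := enough_proj M.
(* The cover is the image of an endomorphism of P over M of minimal rank. *)
pose good n := exists h : bhom P P, (forall x, p (h x) = p x) /\ \dim (limg h) = n.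
have [n [[h [hh dn]] nmin]] : exists n, good n /\ forall m, good m -> (n <= m)%N.
  have ex : exists n, good n.
    by exists (\dim (limg (bidh P))), (bidh P); split=> // x; rewrite bidhE.
  (* The least number principle for [good], a predicate with no decision procedure; excluded middle
     is applied at each number. *)
  have W : forall n, (forall m, (m < n)%N -> ~ good m) \/ exists n0, good n0 /\ forall m, good m -> (n0 <= m)%N.
    elim=> [|n [IH|IH]]; [by left|  |by right].
    case: (classic (good n)) => [g|ng].
      by right; exists n; split=> // m gm; rewrite leqNgt; apply/negP => /IH; apply.
    left=> m; rewrite ltnS leq_eqVlt => /orP[/eqP->//|]; exact: IH.
  case: ex => n gn; case: (W n.+1) => // H; by case: (H n (ltnSn n)).
pose Q := bsub (im_stable h); pose i : bhom Q P := bincl (im_stable h).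
have iE x : i x = vsval x by rewrite binclE.
have iinj : lker i = 0%VS by apply: bincl_inj.
have inQ x : exists y : Q, h x = i y.
  by exists (vsproj (limg h) (h x)); rewrite iE vsprojK // memv_img ?memvf.
have [h' h'E] := bhom_factor_inj (f := h) iinj inQ.
have min2 (g : bhom P P) : (forall x, p (g x) = p x) -> (limg g <= limg h)%VS -> limg g = limg h.
  move=> hg le; apply/eqP; rewrite eqEdim le dn; apply: nmin; exists g; split=> //.
have hhs : limg (bcomp h h) = limg h.
  apply: min2 => [x|]; first by rewrite bcompE !hh.
  by rewrite /= limg_comp; apply: limgS; apply: subvf.
(* h restricts to an automorphism of its image *)
have hQ y : exists z : Q, i y = h (i z).
  have : i y \in limg (bcomp h h) by rewrite hhs iE subvsP.
  case/memv_imgP => x _; rewrite bcompE => ->.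
  by exists (h' x); rewrite h'E.
pose a : bhom Q Q := bcomp h' i.
have as_ : limg a = fullv.
  apply/surjP => y; have [z e] := hQ y; exists z.
  by apply: subvs_inj; rewrite -!iE bcompE h'E.
have ai : lker a = 0%VS.
  apply/eqP; rewrite -dimv_eq0.
  have := limg_ker_dim a fullv; rewrite as_ capfv => /eqP.
  by rewrite -[X in _ == X]add0n eqn_add2r.
have [y e|a1 a1E] := bhom_factor (f := bidh Q) as_.
  by rewrite bidhE; move/injP: ai; apply.
have pQ : projective Q.
  apply: (@proj_retract _ _ i (bcomp a1 h') hP) => y.
  by rewrite bcompE -[h' (i y)](bcompE h' i) a1E bidhE.
pose q := bcomp p i.
have qs : limg q = fullv.
  apply/surjP => m; have /surjP H := sp; have [x ->] := H m.
  by exists (h' x); rewrite bcompE h'E hh.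
exists Q, q; split=> // V sV KV.
(* If V supplements the kernel of q, then q lifts through V. The resulting endomorphism of P over M
   has its image inside that of h, hence equal to it by minimality of the rank, and this forces V to
   be all of Q. *)
pose j := bincl sV; pose qj := bcomp q j.
have qjs : limg qj = fullv.
  apply/surjP => m; have /surjP H := qs; have [x ->] := H m.
  have : x \in (lker q + V)%VS by rewrite KV memvf.
  case/memv_addP => u; rewrite memv_ker => /eqP qu [v vV ->].
  have [w ->] : exists w, v = j w.
    by exists (vsproj V v); rewrite binclE vsprojK.
  by exists w; rewrite [qj _]bcompE -[X in _ = X]add0r -qu -linearD.
have [g gE] := (projP Q).1 pQ _ _ qj q qjs.
pose hg := bcomp i (bcomp j (bcomp g h')).
have : limg hg = limg h.
  apply: min2 => [x|].
    rewrite /hg bcompE -(bcompE p i) -/q bcompE -(bcompE q j) -/qj bcompE gE.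
    by rewrite /q bcompE h'E hh.
  apply/subvP => x /memv_imgP[y _ ->]; rewrite bcompE iE; exact: subvsP.
move=> ehg; apply/vspaceP => y; rewrite memvf.
have : i y \in limg hg by rewrite ehg iE subvsP.
case/memv_imgP => x _; rewrite /hg bcompE => e.
have -> : y = j (g (h' x)).
  by apply: subvs_inj; rewrite -!iE e !bcompE.
by rewrite binclE subvsP.
Qed.

Lemma minpres_ex M : inhabited (minpres M).
Proof.
have [P0 [e [h0 s0 m0]]] := proj_cover M.
have [P1 [d [h1 s1 m1]]] := proj_cover (bker e).
have kE : lker (bcomp (bker_incl e) d) = lker d.
  apply/vspaceP => x; rewrite !memv_ker bcompE bker_inclE.
  apply/eqP/eqP => [h|->]; last by rewrite linear0.
  by apply: subvs_inj; rewrite h linear0.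
constructor; apply: (@Minpres _ _ _ M P1 P0 (bcomp (bker_incl e) d) e) => //.
- by rewrite /= limg_comp s1 bker_incl_im.
- by rewrite kE.
Qed.

Lemma minpres_inj M (p : minpres M) : pd_le1 M -> lker (mpd p) = 0%VS.
Proof.
move=> hM; have hK := pd_kernel hM (@mp0_proj _ _ _ _ p) (mpe_surj p).
have [x|d dE] := @bhom_factor_inj _ _ _ _ _ _ (bker_incl (mpe p)) (mpd p) (bker_incl_inj _).
  have : mpd p x \in limg (mpd p) by rewrite memv_img ?memvf.
  by rewrite mp_exact -(bker_incl_im (mpe p)) => /memv_imgP[y _ ->]; exists y.
have ds : limg d = fullv.
  apply/surjP => y; have : bker_incl (mpe p) y \in limg (mpd p).
    by rewrite mp_exact -(bker_incl_im (mpe p)) memv_img ?memvf.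
  case/memv_imgP => x _ e; exists x; apply: subvs_inj.
  by rewrite -!(bker_inclE (f := mpe p)) dE.
have [s sE] := (projP _).1 hK _ _ d (bidh _) ds.
have sV := im_stable s.
have full : limg s = fullv.
  apply: (@mpd_min _ _ _ _ p) => //; apply/vspaceP => x; rewrite memvf.
  have -> : x = (x - s (d x)) + s (d x) by rewrite subrK.
  apply: memv_add; last by rewrite memv_img ?memvf.
  by rewrite memv_ker -dE linearB /= sE bidhE subrr linear0.
apply/injP => x e; have /surjP h := full; have [y ey] := h x.
have : d x = 0 by apply: subvs_inj; rewrite -(bker_inclE (f := mpe p)) dE e linear0.
by rewrite ey sE bidhE => ->; rewrite linear0.
Qed.

End Homological.

(** * Injective modules, duality of Ext^1, heredity *)

Section HomologicalDuality.
Variable k : fieldType.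

Section Dual1.
Variables A B : falgType k.
Implicit Types X Y Z P : bimod A B.

Lemma biso_dual X Y : biso X Y -> biso (bdual Y) (bdual X).
Proof.
by case=> f [h1 h2]; exists (dualh f); split; [apply: dualh_inj|apply: dualh_surj].
Qed.

Lemma injective_iso X Y : biso X Y -> injective_mod X -> injective_mod Y.
Proof.
move=> /biso_inv[u [v [uv vu]]] /inj_modP h; apply/inj_modP => S Q g f hg.
have [w wE] := h _ _ g (bcomp v f) hg.
by exists (bcomp u w) => x; rewrite bcompE wE bcompE vu.
Qed.

Lemma dual_injective P : projective P -> injective_mod (bdual P).
Proof.
move=> /projP hP; apply/inj_modP => X Y g f hg.
have [h hE] := hP _ _ (dualh g) (bcomp (dualh f) (beval P)) (dualh_surj hg).
exists (bcomp (dualh h) (beval Y)) => x; apply/lfunP => y.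
by rewrite bcompE dualhE bevalE -dualhE hE bcompE dualhE bevalE.
Qed.

End Dual1.

Section Dual2.
Variables A B : falgType k.
Implicit Types X Y Z P : bimod A B.

Lemma enough_inj X : exists I (i : bhom X I), injective_mod I /\ lker i = 0%VS.
Proof.
have [P [p [hP hp]]] := enough_proj (bdual X).
exists (bdual P), (bcomp (dualh p) (beval X)); split; first exact: dual_injective.
apply/injP => x; rewrite bcompE => e; move/injP: (beval_inj X); apply.
by move/injP: (dualh_inj hp); apply.
Qed.

Lemma inj_pres X : exists I J (i : bhom X I) (p : bhom I J),
  injective_mod I /\ short_exact i p.
Proof.
have [I [i [h1 h2]]] := enough_inj X.
exists I, (bcoker i), i, (bproj (im_stable i)); split=> //; split=> //.
  by rewrite bproj_ker.
exact: bproj_surj.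
Qed.

(** Converse of [ext1z_lift]. Embed Z in an injective I; f extends to Q with values in I, and the
    induced map from X to I/Z lifts to I by hypothesis. Subtracting the lift brings the extension
    back into Z. *)
Lemma ext1z_of_lift X Z : (forall Q R (i : bhom Z Q) (q : bhom Q R), short_exact i q ->
  forall f : bhom X R, exists h : bhom X Q, forall x, q (h x) = f x) -> ext1z X Z.
Proof.
move=> H S Q s t /[dup] hst /short_exactP[s1 s2 s3 s4] f.
have [I [J [i [p [/inj_modP hI /[dup] hip /short_exactP[i1 i2 i3 i4]]]]]] := inj_pres Z.
have [u uE] := hI _ _ s (bcomp i f) (let: And3 e _ _ := hst in e).
have tsurj : limg t = fullv by apply/surjP.
have [|v vE] := bhom_factor (f := bcomp p u) tsurj.
  by move=> x /s3[y ->]; rewrite bcompE uE bcompE i2.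
have [w wE] := H _ _ _ _ hip v.
have [|h hE] := @bhom_factor_inj _ _ _ _ _ _ i (bsubh u (bcomp w t)) (let: And3 e _ _ := hip in e).
  by move=> x; apply: i3; rewrite bsubhE linearB bcompE /= wE vE bcompE subrr.
exists h => x; apply/eqP; rewrite -subr_eq0; apply/eqP/i1.
by rewrite linearB /= hE bsubhE bcompE s2 linear0 subr0 uE bcompE subrr.
Qed.

Lemma inj_ext1z X Z : injective_mod Z -> ext1z X Z.
Proof. by move=> /inj_modP hZ S Q i q [hi _ _] f; apply: hZ. Qed.

Lemma ext1z_inj Z : (forall X, ext1z X Z) -> injective_mod Z.
Proof.
move=> H; apply/inj_modP => X Y g f hg.
apply: (H (bcoker g) X Y g (bproj (im_stable g))); split=> //.
  by rewrite bproj_ker.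
exact: bproj_surj.
Qed.

End Dual2.

Section Dual3.
Variables A B : falgType k.
Implicit Types X Y Z P : bimod A B.

(** Dualising 0 -> S -> Q -> DZ -> 0 gives an extension of DS by Z, and f : S -> DX becomes X -> DS.
    Extending f is then the transpose of lifting this map to DQ. *)
Lemma ext1z_dual X Z : ext1z X Z -> ext1z (bdual Z) (bdual X).
Proof.
move=> H S Q i q h f.
have [d1 d2 d3] := dual_short h.
have [e1 e2] := conj (beval_inj Z) (beval_full Z).
have hs : short_exact (bcomp (dualh q) (beval Z)) (dualh i).
  split=> //.
    by apply/injP => x; rewrite bcompE => e; move/injP: e1; apply; move/injP: d1; apply.
  by rewrite /= limg_comp e2.
have [u uE] := ext1z_lift H hs (bcomp (dualh f) (beval X)).
exists (bcomp (dualh u) (beval Q)) => s; apply/lfunP => x.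
by rewrite bcompE dualhE bevalE -dualhE uE bcompE dualhE bevalE.
Qed.

Lemma pd_dual M : pd_le1 M -> id_le1 (bdual (M : bimod A B)).
Proof.
case=> P1 [P0 [f [g [h1 h0 h]]]]; exists (bdual P0), (bdual P1), (dualh g), (dualh f).
by split; [exact: dual_injective|exact: dual_injective|exact: dual_short].
Qed.

End Dual3.

Section Hereditary.
Variables A B : falgType k.

(** Heredity in terms of vanishing alone, in the first variable; [hered_quot] is the version for the
    second variable. Both follow from Ext^2 = 0 by the long exact sequences. *)
Definition hered_sub := forall (X Y Z : bimod A B) (i : bhom X Y),
  lker i = 0%VS -> ext1z Y Z -> ext1z X Z.

Definition hered_quot := forall (X Y Z : bimod A B) (g : bhom Y Z),
  limg g = fullv -> ext1z X Y -> ext1z X Z.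

(** [hered_quot] makes quotients of injective modules injective. In 0 -> Z -> I -> J -> 0 a map X ->
    J therefore extends to Y, lifts to I there since Ext^1(Y, Z) = 0, and restricts to X again. *)
Lemma hered_quot_sub : hered_quot -> hered_sub.
Proof.
move=> H X Y Z i hi hY.
have [I [J [j [p [hI /[dup] hjp /short_exactP[j1 j2 j3 j4]]]]]] := inj_pres Z.
have hJ : injective_mod J.
  apply: ext1z_inj => W; apply: (H W I J p); last exact: inj_ext1z.
  exact/surjP.
apply: (@ext1z_ker _ _ _ X Z I J j p) => // [f|]; last exact: inj_ext1z.
have [u uE] := (inj_modP J).1 hJ _ _ i f hi.
have [v vE] := ext1z_lift hY hjp u.
by exists (bcomp v i) => x; rewrite bcompE vE uE.
Qed.

Lemma hered_sub_proj (X P : bimod A B) (i : bhom X P) : hered_sub -> lker i = 0%VS ->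
  projective P -> projective X.
Proof.
move=> H hi hP; apply: ext1z_proj => Z; apply: (H X P Z i hi); exact: proj_ext1z.
Qed.

End Hereditary.

Lemma hered_quot_dual (A B : falgType k) : hered_quot A B -> hered_sub B A.
Proof.
move=> H X Y Z i hi hY.
have h : ext1z (bdual Z) (bdual X).
  apply: (H _ (bdual Y) _ (dualh i)); first exact: dualh_surj.
  exact: ext1z_dual.
apply: (ext1z_iso_r (biso_sym (beval_iso Z))).
by apply: (ext1z_iso_l (biso_sym (beval_iso X))); apply: ext1z_dual.
Qed.

End HomologicalDuality.

(** * One-sided linear maps and dual bases *)

Section OneSided.
Variable k : fieldType.

(** X and Y may carry left actions of different algebras, which [bhom] does not allow; [llin] is the
    mirror image. *)
Definition rlin (A A' B : falgType k) (X : bimod A B) (Y : bimod A' B) (f : 'Hom(X, Y)) :=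
  forall x b, f (ract x b) = ract (f x) b.

Definition llin (A B B' : falgType k) (X : bimod A B) (Y : bimod A B') (f : 'Hom(X, Y)) :=
  forall a x, f (lact a x) = lact a (f x).

Section Right.
Variables (A A' A'' B : falgType k).
Implicit Types (X : bimod A B) (Y : bimod A' B).

Definition rapp X Y (f : rhom X Y) (x : X) : Y := (vsval f : 'Hom(X, Y)) x.

Lemma rhomP X Y (f : rhom X Y) : rlin (vsval f : 'Hom(X, Y)).
Proof. by apply/rhomvP; apply: subvsP. Qed.

Lemma rapp_r X Y (f : rhom X Y) x b : rapp f (ract x b) = ract (rapp f x) b.
Proof. exact: rhomP. Qed.

Lemma rapp_ext X Y (f g : rhom X Y) : (forall x, rapp f x = rapp g x) -> f = g.
Proof. by move=> h; apply: subvs_inj; apply/lfunP. Qed.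

Lemma rapp_linear X Y (f : rhom X Y) : linear (rapp f).
Proof. by move=> c x y; rewrite /rapp linearP. Qed.

Lemma rapp_sum X Y (f : rhom X Y) (I : finType) (F : I -> X) :
  rapp f (\sum_i F i) = \sum_i rapp f (F i).
Proof. by rewrite /rapp linear_sum. Qed.

Lemma rapp_linearf X Y c (f g : rhom X Y) x : rapp (c *: f + g) x = c *: rapp f x + rapp g x.
Proof. by rewrite /rapp linearP add_lfunE scale_lfunE. Qed.

Lemma rapp_sumf X Y (I : finType) (F : I -> rhom X Y) x :
  rapp (\sum_i F i) x = \sum_i rapp (F i) x.
Proof. by rewrite /rapp linear_sum sum_lfunE. Qed.

Lemma rapp0 X Y x : rapp (0 : rhom X Y) x = 0.
Proof. by rewrite /rapp linear0 zero_lfunE. Qed.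

Lemma rhom_of X Y (f : 'Hom(X, Y)) : rlin f ->
  exists g : rhom X Y, forall x, rapp g x = f x.
Proof.
by move=> h; exists (vsproj (rhomv X Y) f) => x; rewrite /rapp vsprojK //; apply/rhomvP.
Qed.

Lemma rapp_lact X Y c (f : rhom X Y) x : rapp (lact c f) x = lact c (rapp f x).
Proof. by rewrite /rapp /= vsprojK ?rhom_rmem ?subvsP // comp_lfunE lacthE. Qed.

Lemma rapp_ract X Y (f : rhom X Y) a x : rapp (ract f a) x = rapp f (lact a x).
Proof. by rewrite /rapp /= vsprojK ?rhom_lmem ?subvsP // comp_lfunE lacthE. Qed.

Lemma rapp_pre X (X' : bimod A B) (g : bhom X X') Y (f : rhom X' Y) x :
  rapp (rhom_pre g Y f) x = rapp f (g x).
Proof. by rewrite /rapp /= mklinE /rhom_pre_fun vsprojK ?rhom_pre_mem // comp_lfunE. Qed.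

End Right.

Section Left.
Variables (A B B' : falgType k).
Implicit Types (X : bimod A B) (Y : bimod A B').

Definition lapp X Y (f : lhom X Y) (x : X) : Y := (vsval f : 'Hom(X, Y)) x.

Lemma lhomP X Y (f : lhom X Y) : llin (vsval f : 'Hom(X, Y)).
Proof. by apply/lhomvP; apply: subvsP. Qed.

Lemma lapp_l X Y (f : lhom X Y) x a : lapp f (lact a x) = lact a (lapp f x).
Proof. exact: lhomP. Qed.

Lemma lapp_ext X Y (f g : lhom X Y) : (forall x, lapp f x = lapp g x) -> f = g.
Proof. by move=> h; apply: subvs_inj; apply/lfunP. Qed.

Lemma lapp_linear X Y (f : lhom X Y) : linear (lapp f).
Proof. by move=> c x y; rewrite /lapp linearP. Qed.

Lemma lapp_linearf X Y c (f g : lhom X Y) x : lapp (c *: f + g) x = c *: lapp f x + lapp g x.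
Proof. by rewrite /lapp linearP add_lfunE scale_lfunE. Qed.

Lemma lapp_sum X Y (f : lhom X Y) (I : finType) (F : I -> X) :
  lapp f (\sum_i F i) = \sum_i lapp f (F i).
Proof. by rewrite /lapp linear_sum. Qed.

Lemma lapp_sumf X Y (I : finType) (F : I -> lhom X Y) x :
  lapp (\sum_i F i) x = \sum_i lapp (F i) x.
Proof. by rewrite /lapp linear_sum sum_lfunE. Qed.

Lemma lhom_of X Y (f : 'Hom(X, Y)) : llin f ->
  exists g : lhom X Y, forall x, lapp g x = f x.
Proof.
by move=> h; exists (vsproj (lhomv X Y) f) => x; rewrite /lapp vsprojK //; apply/lhomvP.
Qed.

Lemma lapp_ract X Y (f : lhom X Y) a x : lapp (ract f a) x = ract (lapp f x) a.
Proof. by rewrite /lapp /= vsprojK ?lhom_rmem ?subvsP // comp_lfunE racthE. Qed.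

Lemma lapp_pre X (X' : bimod A B) (g : bhom X X') Y (f : lhom X' Y) x :
  lapp (lhom_pre g Y f) x = lapp f (g x).
Proof. by rewrite /lapp /= mklinE /lhom_pre_fun vsprojK ?lhom_pre_mem // comp_lfunE. Qed.

End Left.

Lemma kright (A : falgType k) (X : lmod A) (x : X) (c : k^o) : ract x c = (c : k) *: x.
Proof.
have -> : c = (c : k) *: (1 : k^o) by rewrite /GRing.scale /= mulr1.
rewrite -(mklinE (@ract_linr _ _ _ X x)) linearZ /= mklinE ract1.
by congr (_ *: _); rewrite /GRing.scale /= mulr1.
Qed.

Lemma kleft (A : falgType k) (X : rmod A) (x : X) (c : k^o) : lact c x = (c : k) *: x.
Proof.
have -> : c = (c : k) *: (1 : k^o) by rewrite /GRing.scale /= mulr1.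
rewrite -(mklinE (@lact_linl _ _ _ X x)) linearZ /= mklinE lact1.
by congr (_ *: _); rewrite /GRing.scale /= mulr1.
Qed.

Lemma rbhom (A : falgType k) (X Y : rmod A) (f : 'Hom(X, Y)) : rlin f ->
  exists g : bhom X Y, forall x, g x = f x.
Proof. by move=> h; apply: bhom_of => // a x; rewrite !kleft linearZ. Qed.

Lemma lbhom (A : falgType k) (X Y : lmod A) (f : 'Hom(X, Y)) : llin f ->
  exists g : bhom X Y, forall x, g x = f x.
Proof. by move=> h; apply: bhom_of => // x a; rewrite !kright linearZ. Qed.

Lemma bhom_rlin (A B : falgType k) (X Y : bimod A B) (f : bhom X Y) : rlin f.
Proof. by move=> x b; rewrite bhomr. Qed.

End OneSided.

Section TensorLinear.
Variable k : fieldType.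
Variables (A C C' B : falgType k) (X : bimod A C) (Y : bimod C' B).

Lemma tens_llin (B' : falgType k) (Z : bimod A B') (m : 'Hom(btensk X Y, Z)) :
  (forall a (x : X) (y : Y), m (tens (lact a x) y) = lact a (m (tens x y))) -> llin m.
Proof.
move=> h a t; apply/eqP; rewrite -subr_eq0; apply/eqP.
have <- : ((m \o lacth (btensk X Y) a) - (lacth Z a \o m))%VF t = m (lact a t) - lact a (m t).
  by rewrite add_lfunE opp_lfunE !comp_lfunE (@lacthE _ _ _ (btensk X Y)) lacthE.
apply: (@tens_ext0 k X Y Z) => x y.
by rewrite add_lfunE opp_lfunE !comp_lfunE (@lacthE _ _ _ (btensk X Y)) lacthE lact_tens h subrr.
Qed.

Lemma tens_rlin (A' : falgType k) (Z : bimod A' B) (m : 'Hom(btensk X Y, Z)) :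
  (forall (x : X) (y : Y) b, m (tens x (ract y b)) = ract (m (tens x y)) b) -> rlin m.
Proof.
move=> h t b; apply/eqP; rewrite -subr_eq0; apply/eqP.
have <- : ((m \o racth (btensk X Y) b) - (racth Z b \o m))%VF t = m (ract t b) - ract (m t) b.
  by rewrite add_lfunE opp_lfunE !comp_lfunE (@racthE _ _ _ (btensk X Y)) racthE.
apply: (@tens_ext0 k X Y Z) => x y.
by rewrite add_lfunE opp_lfunE !comp_lfunE (@racthE _ _ _ (btensk X Y)) racthE ract_tens h subrr.
Qed.

End TensorLinear.

Section DualBasis.
Variable k : fieldType.

(** The dual basis criterion for finitely generated projective right modules. It is also used for
    bimodules that are projective on the right without being projective as bimodules. *)
Definition rdual_basis (A B : falgType k) (S : bimod A B) :=
  exists n (s : 'I_n -> S) (c : 'I_n -> rhom S (breg B)),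
    forall x, x = \sum_j ract (s j) (rapp (c j) x).

Definition ldual_basis (A B : falgType k) (S : bimod A B) :=
  exists n (s : 'I_n -> S) (c : 'I_n -> lhom S (breg A)),
    forall x, x = \sum_j lact (lapp (c j) x) (s j).

Lemma multmapE (A B : falgType k) (X : bimod A B) (t : btensk X (breg B)) :
  multmap X t = \sum_(i < \dim {:X}) ract (vbasis {:X})`_i ((t : 'Hom(dualv X, B)) (vcoord i)).
Proof. by rewrite /= mklinE. Qed.

Lemma multmap1 (A B : falgType k) (X : bimod A B) (x : X) b :
  multmap X (tens x (b : breg B)) = ract x b.
Proof. by rewrite /= mklinE multmap_tens. Qed.

Lemma multmap_surj (A B : falgType k) (X : bimod A B) : limg (multmap X) = fullv.
Proof.
by apply/surjP => x; exists (tens x (1 : breg B)); rewrite multmap1 ract1.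
Qed.

Lemma btensk_ractE (A C C' B : falgType k) (X : bimod A C) (Y : bimod C' B)
  (t : btensk X Y) b phi :
  (ract t b : 'Hom(dualv X, Y)) phi = ract ((t : 'Hom(dualv X, Y)) phi) b.
Proof. by rewrite /= comp_lfunE racthE. Qed.

Lemma btens_reg_basis (A C B : falgType k) (X : bimod A C) :
  rdual_basis (btensk X (breg B)).
Proof.
have L i : exists f : rhom (btensk X (breg B)) (breg B),
    forall t, rapp f t = (t : 'Hom(dualv X, B)) (vcoord i).
  have l : linear (fun t : 'Hom(dualv X, B) => t (vcoord i)).
    by move=> c x y; rewrite add_lfunE scale_lfunE.
  have [|f fE] := @rhom_of _ _ _ _ (btensk X (breg B)) (breg B) (mklin l).
    by move=> t b; rewrite !(mklinE l); exact: (@btensk_ractE _ _ _ _ X (breg B)).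
  by exists f => t; rewrite fE mklinE.
have [f fE] := fin_all_exists L.
exists _, (fun i => tens (vbasis {:X})`_i (1 : breg B)), f => t.
rewrite {1}(tens_sum (V := X) (W := breg B) t); apply: eq_bigr => i _.
by rewrite fE (@ract_tens _ _ _ _ _ X (breg B)) /= mul1r.
Qed.

Lemma rdual_basis_proj (A : falgType k) (P : rmod A) : rdual_basis P -> projective P.
Proof.
case=> n [s [c e]]; apply/projP => X Y g f /surjP hg.
have [x xE] : exists x : 'I_n -> X, forall j, g (x j) = f (s j).
  by exists (fun j => (g^-1)%VF (f (s j))) => j; have [y ->] := hg (f (s j)); rewrite inv_lfunE.
have L : linear (fun p : P => \sum_j ract (x j) (rapp (c j) p)).
  move=> a p q; rewrite scaler_sumr -big_split; apply: eq_bigr => j _ /=.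
  by rewrite rapp_linear ract_linr.
have [|h hE] := @rbhom _ _ P X (mklin L).
  move=> p b; rewrite !mklinE ract_sum; apply: eq_bigr => j _.
  by rewrite rapp_r ractM.
exists h => p; rewrite hE mklinE bhom_sum {2}(e p) bhom_sum.
by apply: eq_bigr => j _; rewrite !bhomr xE.
Qed.

Lemma proj_rdual_basis (A : falgType k) (P : rmod A) : projective P -> rdual_basis P.
Proof.
move=> /projP hP; have [s sE] := hP _ _ (multmap P) (bidh P) (multmap_surj P).
have [n [t [c e]]] := btens_reg_basis A P.
have [d dE] : exists d : 'I_n -> rhom P (breg A), forall j x,
   rapp (d j) x = rapp (c j) (s x).
  exists (fun j => rhom_pre s (breg A) (c j)) => j x; by rewrite rapp_pre.
exists n, (fun j => multmap P (t j)), d => x.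
rewrite -{1}(bidhE x) -sE {1}(e (s x)) bhom_sum.
by apply: eq_bigr => j _; rewrite bhomr dE.
Qed.

Lemma proj_ldual_basis (A : falgType k) (P : lmod A) : projective P -> ldual_basis P.
Proof.
move=> /projP hP; pose F : lmod A := btensk (breg A) P.
have [| |m0 m0E] := @hom_of_bilin k (breg A) P P (fun a x => lact a x).
- by move=> x c a a'; rewrite lact_linl.
- by move=> a c x y; rewrite lact_linr.
have [|m mE] := @lbhom _ _ F P m0.
  by apply: tens_llin => a b x; rewrite !m0E /= lactM.
have ms : limg m = fullv.
  by apply/surjP => x; exists (tens (1 : breg A) x); rewrite mE m0E lact1.
have G i : exists f : 'Hom(F, breg A), llin f /\
    forall a x, f (tens (a : breg A) x) = (vcoord i x : k) *: a.
  have [| |f fE] := @hom_of_bilin k (breg A) P A (fun a x => (vcoord i x : k) *: a).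
  - by move=> x c a a'; rewrite scalerDr !scalerA mulrC.
  - by move=> a c x y; rewrite linearP scalerDl scalerA.
  exists f; split=> //.
  by apply: (@tens_llin _ _ _ _ _ (breg A) P _ (breg A)) => a b x; rewrite !fE /= scalerAr.
have [s sE] := hP _ _ m (bidh P) ms.
have [c cE] : exists c : 'I_(\dim {:P}) -> lhom F (breg A), forall i a x,
    lapp (c i) (tens (a : breg A) x) = (vcoord i x : k) *: a.
  have [c cE] : exists c : 'I_(\dim {:P}) -> 'Hom(F, breg A), forall i, llin (c i) /\
    forall a x, (c i) (tens (a : breg A) x) = (vcoord i x : k) *: a.
    by have [c h] := fin_all_exists G; exists c.
  have c' i := lhom_of (cE i).1; have [d dE] := fin_all_exists c'.
  by exists d => i a x; rewrite dE (cE i).2.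
exists _, (fun i => (vbasis {:P})`_i), (fun i => lhom_pre s (breg A) (c i)) => x.
rewrite -{1}(bidhE x) -sE.
have L : linear (fun t : F => \sum_(i < \dim {:P}) lact (lapp (c i) t) (vbasis {:P})`_i).
  move=> a p q; rewrite scaler_sumr -big_split; apply: eq_bigr => j _ /=.
  by rewrite lapp_linear lact_linl.
have -> : m (s x) = mklin L (s x).
  have -> : (m : 'Hom(_, _)) = mklin L :> 'Hom('Hom(dualv A, P), P); last by [].
  apply: (@tens_ext k (breg A) P P) => a y; rewrite mklinE mE m0E {1}(vbasis_sum y) lact_sum.
  by apply: eq_bigr => i _; rewrite cE lactZl lactZ.
by rewrite mklinE; apply: eq_bigr => i _; rewrite lapp_pre.
Qed.

(** The same elements with their roles exchanged form a dual basis of Hom_C(S, C): p is the sum of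
    the p(s_j) c_j. *)
Lemma rdual_basis_dual_proj (A C : falgType k) (S : bimod A C) :
  rdual_basis S -> projective (lforget (rhom S (breg C))).
Proof.
case=> n [s [c e]]; apply/projP => X Y g f /surjP hg.
have [x xE] : exists x : 'I_n -> X, forall j, g (x j) = f (c j).
  by exists (fun j => (g^-1)%VF (f (c j))) => j; have [y ->] := hg (f (c j)); rewrite inv_lfunE.
have L : linear (fun p : rhom S (breg C) => \sum_j lact (rapp p (s j)) (x j)).
  move=> a p q; rewrite scaler_sumr -big_split; apply: eq_bigr => j _ /=.
  by rewrite rapp_linearf lact_linl.
have [|h hE] := @lbhom _ _ (lforget (rhom S (breg C))) X (mklin L).
  move=> a p; rewrite !mklinE lact_sum; apply: eq_bigr => j _.
  by rewrite rapp_lact lactM.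
exists h => p; rewrite hE mklinE bhom_sum.
have pE : p = \sum_j lact (rapp p (s j)) (c j).
  apply: rapp_ext => z; rewrite rapp_sumf {1}(e z) rapp_sum.
  by apply: eq_bigr => j _; rewrite rapp_r rapp_lact.
rewrite {2}pE bhom_sum; apply: eq_bigr => j _.
by rewrite bhoml xE -bhoml.
Qed.

End DualBasis.

Section RExt.
Variable k : fieldType.

Lemma rExt1P (A B C : falgType k) (X : bimod A B) (Y : bimod C B) :
  bzero (rExt 1 X Y) <-> (forall f : 'Hom(syz X, Y), rlin f ->
    exists h : 'Hom(btensk X (breg B), Y), rlin h /\ forall s, h (bker_incl (multmap X) s) = f s).
Proof.
pose d := rhom_pre (bker_incl (multmap X)) Y; rewrite bzeroP; split=> H.
  move=> f /rhom_of[g gE].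
  have : bproj (im_stable d) g = 0 by apply: H.
  move/eqP; rewrite -memv_ker bproj_ker => /memv_imgP[h _ hE].
  by exists (vsval h); split=> [|s]; [exact: rhomP|rewrite -gE hE rapp_pre].
move=> q; have /surjP/(_ q)[g ->] := bproj_surj (im_stable d).
apply/eqP; rewrite -memv_ker bproj_ker.
have [h [hh he]] := H _ (rhomP g); have [h' h'E] := rhom_of hh.
apply/memv_imgP; exists h'; rewrite ?memvf //.
by apply: rapp_ext => s; rewrite rapp_pre h'E he.
Qed.

Lemma ext1z_rExt (A : falgType k) (X Y : rmod A) : ext1z X Y <-> bzero (rExt 1 X Y).
Proof.
have hs := bker_short (multmap_surj X).
rewrite rExt1P; split=> [H f /rbhom[g gE]|H].
  have [h hE] := H _ _ _ _ hs g; exists h; split; first exact: bhom_rlin.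
  by move=> s; rewrite hE gE.
apply: (ext1z_pres _ hs) => [|f].
  by apply: rdual_basis_proj; apply: btens_reg_basis.
have [h [/rbhom[g gE] he]] := H f (@bhom_rlin _ _ _ _ _ f).
by exists g => s; rewrite gE he.
Qed.

End RExt.

(** * Rigidity and the Auslander-Reiten translation *)

Section TauRigid.
Variables (k : fieldType) (A : falgType k).

(* The trace-like functional lambda |-> sum_i g(lambda p_i)(phi_i) on Hom(P1, M)
   takes the value g(m)(phi) at x |-> m phi(x), and vanishes on the maps that
   extend to P0. *)
Lemma tau_rigid_of_ext (M : rmod A) : pd_le1 M -> ext1z M M -> tau_rigid M.
Proof.
move=> hM hE; have [p] := minpres_ex M; exists p; apply/bzeroP => g0.
pose P1 := mp1 p; pose P0 := mp0 p; pose d := mpd p.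
have [n [s [c cE]]] := proj_rdual_basis (@mp1_proj _ _ _ _ p).
have [m [t [e eE]]] := proj_rdual_basis (@mp0_proj _ _ _ _ p).
have ms : short_exact d (mpe p).
  by split; [exact: minpres_inj|exact: mp_exact|exact: mpe_surj].
pose pr := bproj (im_stable (rhom_pre d (breg A))).
pose G (x : M) (phi : rhom P1 (breg A)) : k :=
  (rapp g0 x : dualv (rTr p)) (pr phi).
have Gsum x (I : finType) (F : I -> rhom P1 (breg A)) : G x (\sum_i F i) = \sum_i G x (F i).
  by rewrite /G !linear_sum.
have Gsuml phi (I : finType) (F : I -> M) : G (\sum_i F i) phi = \sum_i G (F i) phi.
  by rewrite /G rapp_sum sum_lfunE.
have Ga x a phi : G (ract x a) phi = G x (lact a phi).
  by rewrite /G rapp_r (@bdual_rE _ _ _ (rTr p)) bhoml.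
have G0 x (psi : rhom P0 (breg A)) : G x (rhom_pre d (breg A) psi) = 0.
  rewrite /G; suff -> : pr (rhom_pre d (breg A) psi) = 0 by rewrite linear0.
  by apply/eqP; rewrite -memv_ker bproj_ker memv_img ?memvf.
apply: rapp_ext => x; rewrite rapp0; apply/lfunP => q.
have /surjP/(_ q)[phi ->] := bproj_surj (im_stable (rhom_pre d (breg A))).
rewrite zero_lfunE -/pr -/(G x phi).
have L : linear (fun y : P1 => ract x (rapp phi y)).
  by move=> a y z; rewrite rapp_linear ract_linr.
have [|h hE'] := @rbhom _ _ P1 M (mklin L).
  by move=> y b; rewrite !mklinE rapp_r ractM.
have [h' h'E] := hE _ _ _ _ ms h.
have phiE : phi = \sum_j lact (rapp phi (s j)) (c j).
  apply: rapp_ext => z; rewrite rapp_sumf {1}(cE z) rapp_sum.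
  by apply: eq_bigr => j _; rewrite rapp_r rapp_lact.
have -> : G x phi = \sum_j G (h (s j)) (c j).
  by rewrite phiE Gsum; apply: eq_bigr => j _; rewrite hE' mklinE Ga.
have -> : \sum_j G (h (s j)) (c j) = \sum_j \sum_i G (h' (t i))
     (lact (rapp (e i) (d (s j))) (c j)).
  apply: eq_bigr => j _; rewrite -h'E {1}(eE (d (s j))) bhom_sum Gsuml.
  by apply: eq_bigr => i _; rewrite bhomr Ga.
(* For fixed i the sum over j is the pairing of h'(t_i) with the restriction of e_i along d, and
   that restriction is zero in the transpose. *)
rewrite exchange_big big1 // => i _; rewrite -Gsum.
have <- : rhom_pre d (breg A) (e i) = \sum_j lact (rapp (e i) (d (s j))) (c j).
  apply: rapp_ext => z; rewrite rapp_sumf rapp_pre {1}(cE z) bhom_sum rapp_sum.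
  by apply: eq_bigr => j _; rewrite bhomr rapp_r rapp_lact.
exact: G0.
Qed.

(** The trace argument of [tau_rigid_of_ext] on the left module DM: a map g from the transpose of DM
    to M pairs x in DM with phi by x(g(phi)), and the class of phi is the cokernel class that enters
    [tauinv]. *)
Lemma tau_corigid_of_ext (M : rmod A) : pd_le1 (bdual M) -> ext1z (bdual M) (bdual M) ->
  tau_corigid M.
Proof.
move=> hM hE; have [p] := minpres_ex (bdual M); exists p; apply/bzeroP => g0.
pose P1 := mp1 p; pose P0 := mp0 p; pose d := mpd p.
have [n [s [c cE]]] := proj_ldual_basis (@mp1_proj _ _ _ _ p).
have [m [t [e eE]]] := proj_ldual_basis (@mp0_proj _ _ _ _ p).
have ms : short_exact d (mpe p).
  by split; [exact: minpres_inj|exact: mp_exact|exact: mpe_surj].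
pose pr := bproj (im_stable (lhom_pre d (breg A))).
pose G (x : bdual M) (phi : lhom P1 (breg A)) : k :=
  (x : dualv M) (rapp g0 (pr phi)).
have Gsum x (I : finType) (F : I -> lhom P1 (breg A)) : G x (\sum_i F i) = \sum_i G x (F i).
  by rewrite /G linear_sum rapp_sum linear_sum.
have Gsuml phi (I : finType) (F : I -> bdual M) : G (\sum_i F i) phi = \sum_i G (F i) phi.
  by rewrite /G sum_lfunE.
have Ga x a phi : G (lact a x) phi = G x (ract phi a).
  by rewrite /G bdual_lE bhomr rapp_r.
have G0 x (psi : lhom P0 (breg A)) : G x (lhom_pre d (breg A) psi) = 0.
  rewrite /G; suff -> : pr (lhom_pre d (breg A) psi) = 0 by rewrite /rapp !linear0.
  by apply/eqP; rewrite -memv_ker bproj_ker memv_img ?memvf.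
apply: rapp_ext => q; rewrite rapp0; apply: dual_sep => x.
have /surjP/(_ q)[phi ->] := bproj_surj (im_stable (lhom_pre d (breg A))).
rewrite -/pr -/(G x phi).
have L : linear (fun y : P1 => lact (lapp phi y) (x : bdual M)).
  by move=> a y z; rewrite lapp_linear lact_linl.
have [|h hE'] := @lbhom _ _ P1 (bdual M) (mklin L).
  by move=> b y; rewrite !mklinE lapp_l lactM.
have [h' h'E] := hE _ _ _ _ ms h.
have phiE : phi = \sum_j ract (c j) (lapp phi (s j)).
  apply: lapp_ext => z; rewrite lapp_sumf {1}(cE z) lapp_sum.
  by apply: eq_bigr => j _; rewrite lapp_l lapp_ract.
have -> : G x phi = \sum_j G (h (s j)) (c j).
  by rewrite phiE Gsum; apply: eq_bigr => j _; rewrite hE' mklinE Ga.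
have -> : \sum_j G (h (s j)) (c j) = \sum_j \sum_i G (h' (t i))
     (ract (c j) (lapp (e i) (d (s j)))).
  apply: eq_bigr => j _; rewrite -h'E {1}(eE (d (s j))) bhom_sum Gsuml.
  by apply: eq_bigr => i _; rewrite bhoml Ga.
rewrite exchange_big big1 // => i _; rewrite -Gsum.
have <- : lhom_pre d (breg A) (e i) = \sum_j ract (c j) (lapp (e i) (d (s j))).
  apply: lapp_ext => z; rewrite lapp_sumf lapp_pre {1}(cE z) bhom_sum lapp_sum.
  by apply: eq_bigr => j _; rewrite bhoml lapp_l lapp_ract.
exact: G0.
Qed.

End TauRigid.

(** * Modules cogenerated by DT *)

Section TensorPower.
Variables (k : fieldType) (A A1 A2 C : falgType k) (V : bimod A1 A2) (T : bimod C A).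

(** A basis of V identifies V (x)_k T with a direct sum of dim V copies of T, and the copies are
    treated separately; likewise in the other variable in [ext1z_tens_r]. *)
Lemma ext1z_tens_l (Z : rmod A) : ext1z (rforget T) Z -> ext1z (rforget (btensk V T)) Z.
Proof.
move=> H; apply: ext1z_of_lift => Q R i q hiq f.
have L (j : 'I_(\dim {:V})) : exists h : bhom (rforget T) Q, forall x, q (h x) = f (tens (vbasis {:V})`_j x).
  have l : linear (fun x : T => f (tens (vbasis {:V})`_j x)).
    by move=> c x y; rewrite tens_linr linearP.
  have [|g gE] := @rbhom _ _ (rforget T) R (mklin l).
    move=> x b; rewrite !mklinE -bhomr; congr (f _); symmetry.
    exact: (@ract_tens _ _ _ _ _ V T).
  by have [h hE] := ext1z_lift H hiq g; exists h => x; rewrite hE gE mklinE.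
have [h hE] := fin_all_exists L.
have l : linear (fun t : 'Hom(dualv V, T) => \sum_j h j (t (vcoord j))).
  move=> c x y; rewrite scaler_sumr -big_split; apply: eq_bigr => j _ /=.
  by rewrite add_lfunE scale_lfunE linearP.
have [|g gE] := @rbhom _ _ (rforget (btensk V T)) Q (mklin l).
  move=> t b; rewrite !(mklinE l) ract_sum; apply: eq_bigr => j _.
  by rewrite -bhomr; congr (h j _); apply: (@btensk_ractE _ _ _ _ _ V T).
exists g => t; rewrite gE mklinE bhom_sum {2}(tens_sum (V := V) (W := T) t).
by rewrite linear_sum; apply: eq_bigr => j _; rewrite hE.
Qed.

Lemma ext1z_tens_r (X : rmod A) : ext1z X (rforget T) -> ext1z X (rforget (btensk V T)).
Proof.
move=> H S Q i q hiq f.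
have L (j : 'I_(\dim {:V})) : exists h : bhom Q (rforget T), forall s, h (i s) = (f s : 'Hom(dualv V, T)) (vcoord j).
  have l : linear (fun x : S => (f x : 'Hom(dualv V, T)) (vcoord j)).
    by move=> c x y; rewrite linearP add_lfunE scale_lfunE.
  have [|g gE] := @rbhom _ _ S (rforget T) (mklin l).
    move=> x b; rewrite !mklinE bhomr; exact: (@btensk_ractE _ _ _ _ _ V T).
  by have [h hE] := H _ _ _ _ hiq g; exists h => x; rewrite hE gE mklinE.
have [h hE] := fin_all_exists L.
have l : linear (fun x : Q => (\sum_(j < \dim {:V}) tens (vbasis {:V})`_j (h j x : T) : btensk V T)).
  move=> c x y; rewrite scaler_sumr -big_split; apply: eq_bigr => j _ /=.
  by rewrite linearP tens_linr.
have [|g gE] := @rbhom _ _ Q (rforget (btensk V T)) (mklin l).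
  move=> x b; rewrite !(mklinE l) ract_sum; apply: eq_bigr => j _.
  by rewrite bhomr; symmetry; apply: (@ract_tens _ _ _ _ _ V T).
exists g => s; rewrite gE mklinE [RHS](tens_sum (V := V) (W := T)).
by apply: eq_bigr => j _; rewrite hE.
Qed.

End TensorPower.

Section TiltedCore.
Variables (k : fieldType) (A C : falgType k) (T : bimod C A).

Section Act.
Variables (A' : falgType k) (Y : bimod A' C).

Definition evT (t : T) : 'Hom(breg C, T) := mklin (@lact_linl _ _ _ T t).

(* Y (x) C acts on T with values in Y (x) T: (y (x) c) t = y (x) ct *)
Definition sT (s : btensk Y (breg C)) (t : T) : btensk Y T :=
  (evT t \o (s : 'Hom(dualv Y, breg C)))%VF.

Lemma sTE s t phi : (sT s t : 'Hom(dualv Y, T)) phi = lact ((s : 'Hom(dualv Y, breg C)) phi : C) t.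
Proof. by rewrite /sT comp_lfunE mklinE. Qed.

Lemma sT_linl t : linear (sT^~ t).
Proof.
by move=> c s s'; apply/lfunP => phi; rewrite add_lfunE scale_lfunE !sTE add_lfunE scale_lfunE lact_linl.
Qed.

Lemma sT_linr s : linear (sT s).
Proof.
by move=> c t t'; apply/lfunP => phi; rewrite add_lfunE scale_lfunE !sTE lact_linr.
Qed.

Lemma sT_tens y c t : sT (tens y (c : breg C)) t = tens y (lact c t).
Proof.
apply/lfunP => phi; rewrite sTE !tensE.
by rewrite -[(phi y : k) *: (c : breg C)]/((phi y : k) *: (c : C)) lactZl.
Qed.

Lemma sT_ract s c t : sT (ract s c) t = sT s (lact c t).
Proof.
apply/lfunP => phi; rewrite !sTE -lactM; congr (lact _ t).
exact: (@btensk_ractE _ _ _ _ _ Y (breg C)).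
Qed.

Lemma sT_r s t a : sT s (ract t a) = ract (sT s t) a.
Proof.
apply/lfunP => phi; rewrite sTE lractA.
by have := @btensk_ractE _ _ _ _ _ Y T (sT s t) a phi; rewrite sTE => ->.
Qed.

End Act.

Hypothesis hA : hered_sub k^o A.
Hypothesis hT : ext1z (rforget T) (rforget T).
Hypothesis hEnd : forall g : 'Hom(T, T), rlin (X := T) (Y := T) g ->
  exists c, forall t, g t = lact c t.
Hypothesis hF : forall c : C, (forall t : T, lact c t = 0) -> c = 0.

Section Syz.
Variables (A' : falgType k) (Y : bimod A' C).

Lemma sT_faithful (s : btensk Y (breg C)) : (forall t, sT s t = 0) -> s = 0.
Proof.
move=> h; apply/lfunP => phi; rewrite zero_lfunE; apply: hF => t.
by rewrite -sTE h zero_lfunE.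
Qed.

(** Coordinatewise this is [hEnd]. Together with [sT_faithful] it identifies Y (x) C with Hom_A(T, Y
    (x) T). *)
Lemma sT_full (f : 'Hom(T, btensk Y T)) : rlin (X := T) (Y := btensk Y T) f ->
  exists s, forall t, f t = sT s t.
Proof.
move=> hf.
have L (j : 'I_(\dim {:Y})) : exists c : C, forall t, (f t : 'Hom(dualv Y, T)) (vcoord j) = lact c t.
  have l : linear (fun x : T => (f x : 'Hom(dualv Y, T)) (vcoord j)).
    by move=> c x y; rewrite linearP add_lfunE scale_lfunE.
  have [|c cE] := hEnd (g := mklin l).
    move=> x b; rewrite !mklinE hf; exact: (@btensk_ractE _ _ _ _ _ Y T).
  by exists c => t; rewrite -cE mklinE.
have [c cE] := fin_all_exists L.
exists (\sum_(j < \dim {:Y}) tens (vbasis {:Y})`_j (c j : breg C)) => t.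
rewrite (linf_sum (sT_linl (Y := Y) t)) [LHS](tens_sum (V := Y) (W := T)).
by apply: eq_bigr => j _; rewrite sT_tens cE.
Qed.

(** Each b y is an endomorphism of T and so is multiplication by an element of C; faithfulness makes
    this element unique, hence C-linear in y. *)
Lemma coeff_rhom (b : Y -> T -> T) : (forall t, linear (b^~ t)) -> (forall y, linear (b y)) ->
  (forall y t a, b y (ract t a) = ract (b y t) a) ->
  (forall y c t, b (ract y c) t = b y (lact c t)) ->
  exists c : rhom Y (breg C), forall y t, lact (rapp c y : C) t = b y t.
Proof.
move=> bl br ba bc.
have l : linear (fun y => mklin (br y)).
  move=> c x y; apply/lfunP => t; rewrite add_lfunE scale_lfunE !mklinE.
  exact: bl.
have [|c0 c0E] := @hom_factor_inj _ _ _ _ (mklin (@lacth_lin _ _ _ T)) (mklin l).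
  move=> y; have [|c cE] := hEnd (g := mklin (br y)); first by move=> t a; rewrite !mklinE ba.
  exists c; rewrite (mklinE l) (mklinE (@lacth_lin _ _ _ T)); apply/lfunP => t.
  by rewrite lacthE cE.
have c1E y t : lact (c0 y : C) t = b y t.
  have /lfunP e := c0E y; have := e t; rewrite (mklinE l) (mklinE (@lacth_lin _ _ _ T)).
  by rewrite lacthE => ->; rewrite mklinE.
have [|c cE] := @rhom_of _ _ _ _ Y (breg C) c0; last by exists c => y t; rewrite cE c1E.
move=> y c; apply/eqP; rewrite -subr_eq0; apply/eqP/hF => t.
rewrite -[c0 (ract y c) - _]/(c0 (ract y c) - c0 y * c) lactDl lactNl lactM !c1E bc.
exact: subrr.
Qed.

End Syz.

Section Syz2.
Variables (A' : falgType k) (Y : bimod A' C).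

(* Y embeds into a power of DT *)
Definition cogenerated := forall y : Y,
  (forall chi : 'Hom(Y, bdual T), rlin (X := Y) (Y := bdual T) chi -> chi y = 0) -> y = 0.

(* N is the trace of T in the kernel of the map from Y (x) T determined by Y -> (DT)^n. *)
Lemma syz_trace : cogenerated ->
  exists (N : rmod A) (inc : bhom N (rforget (btensk Y T)))
    (m : bhom (rforget (btensk (syz Y) T)) N),
  [/\ forall z, inc z = 0 -> z = 0,
      forall (s : syz Y) t, inc (m (tens s t)) = sT (vsval s) t,
      forall z, exists u, z = m u &
  exists n (s : 'I_n -> syz Y) (i : 'I_n -> bhom N (rforget T)) (c : 'I_n -> rhom (syz Y) (breg C)),
  [/\ forall j x t, lact (rapp (c j) x : C) t = i j (m (tens x t)),
      forall z, z = \sum_j m (tens (s j) (i j z : T))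
    & forall x, x = \sum_j ract (s j) (rapp (c j) x)]].
Proof.
move=> hY; pose YT : rmod A := rforget (btensk Y T).
pose G : rmod A := rforget (btensk (syz Y) T).
have [| |f0 f0E] := @hom_of_bilin k (syz Y) T (btensk Y T) (fun s t => sT (vsval s) t).
- by move=> t c s s'; rewrite linearP sT_linl.
- by move=> s; apply: sT_linr.
have [|f1 f1E] := @rbhom _ _ G YT f0.
  apply: (@tens_rlin _ _ _ _ _ (syz Y) T _ YT) => s t b.
  by rewrite !f0E sT_r.
pose N := bsub (im_stable f1); pose inc : bhom N YT := bincl (im_stable f1).
have iinj : lker inc = 0%VS by apply: bincl_inj.
have [|m mE] := @bhom_factor_inj _ _ _ G N YT inc f1 iinj.
  move=> x; exists (vsproj (limg f1) (f1 x)).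
  by rewrite binclE vsprojK // memv_img ?memvf.
have iinj' z z' : inc z = inc z' -> z = z'.
  exact: lker_inj iinj.
have incm s t : inc (m (tens (s : syz Y) t)) = sT (vsval s) t by rewrite mE f1E f0E.
have ms : forall z, exists u, z = m u.
  move=> z; have := subvsP z => /memv_imgP[u _ e]; exists u.
  by apply: iinj'; rewrite mE binclE e.
have msurj : limg m = fullv by apply/surjP.
have isyz (z : N) : exists u, inc z = f0 u by have [u ->] := ms z; exists u; rewrite mE f1E.
(* A map chi : Y -> DT defines the functional y (x) t |-> chi(y)(t) on Y (x) T. It kills N, because
   N is spanned by the s t with s in the kernel of the multiplication Y (x) C -> Y. *)
have vanish (chi : 'Hom(Y, bdual T)) : rlin (X := Y) (Y := bdual T) chi ->
    exists g : 'Hom('Hom(dualv Y, T), k^o),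
      (forall s t, g (sT s t) = (chi (multmap Y s) : dualv T) t) /\ forall z : N, g (inc z) = 0.
  move=> hchi.
  have [| |g gE] := @hom_of_bilin k Y T k^o (fun y t => (chi y : dualv T) t).
  - by move=> t c y y'; rewrite linearP add_lfunE scale_lfunE.
  - by move=> y c t t'; rewrite linearP.
  have gsT s t : g (sT s t) = (chi (multmap Y s) : dualv T) t.
    have l1 : linear (fun s => g (sT s t)) by move=> c x y; rewrite sT_linl linearP.
    have l2 : linear (fun s => (chi (multmap Y s) : dualv T) t).
      by move=> c x y; rewrite !linearP add_lfunE scale_lfunE.
    rewrite -(mklinE l1) -(mklinE l2); congr (fun_of_lfun _ s).
    apply: (@tens_ext k Y (breg C)) => y c; rewrite (mklinE l1) (mklinE l2) sT_tens gE multmap1.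
    by rewrite hchi bdual_rE.
  exists g; split=> // z; have [u ->] := isyz z.
  rewrite -[g _](comp_lfunE g f0); apply: (@tens_ext0 k (syz Y) T) => s t.
  by rewrite comp_lfunE f0E gsT bker_val0 linear0 zero_lfunE.
(* Every map T -> N comes from an element of syz Y. It is the action of some s in Y (x) C; by
   [vanish] all chi kill the product of s in Y, so this product is zero by cogeneration. *)
have lift1 (f : bhom (rforget T) N) : exists h : bhom (rforget T) G, forall t, m (h t) = f t.
  have [|s sE] := @sT_full _ Y (bcomp inc f).
    by move=> t a; apply: (@bhomr _ _ _ _ _ (bcomp inc f)).
  have [|s' s'E] := @bker_elt _ _ _ _ _ (multmap Y) s.
    apply: hY => chi hchi; apply/lfunP => t; rewrite zero_lfunE.
    have [g [gE g0]] := vanish _ hchi.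
    by have := g0 (f t); rewrite -(bcompE inc f) sE gE.
  have l : linear (fun t : T => (tens s' t : btensk (syz Y) T)) by apply: tens_linr.
  have [|h hE] := @rbhom _ _ (rforget T) G (mklin l).
    by move=> t a; rewrite !(mklinE l); symmetry; apply: (@ract_tens _ _ _ _ _ (syz Y) T).
  by exists h => t; apply: iinj'; rewrite hE (mklinE l) incm s'E -sE; exact: (bcompE inc f t).
have hsm := bker_short msurj.
(* [lift1] gives Ext^1(T, ker m) = 0. As N lies in a power of T, heredity carries the vanishing over
   to N, and m acquires the section [sg]. *)
have eTK : ext1z (rforget T) (bker m).
  by apply: (ext1z_ker hsm lift1); apply: ext1z_tens_r.
have eNK : ext1z N (bker m) by apply: (hA iinj); apply: ext1z_tens_l.
have [sg sgE] := ext1z_lift eNK hsm (bidh N).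
pose s (j : 'I_(\dim {:syz Y})) : syz Y := (vbasis {:syz Y})`_j.
have I (j : 'I_(\dim {:syz Y})) : exists i : bhom N (rforget T), forall z, i z = (sg z : 'Hom(dualv (syz Y), T)) (vcoord j).
  have l : linear (fun z : N => (sg z : 'Hom(dualv (syz Y), T)) (vcoord j)).
    by move=> c x y; rewrite linearP add_lfunE scale_lfunE.
  have [|i iE] := @rbhom _ _ N (rforget T) (mklin l).
    by move=> x b; rewrite !mklinE bhomr; exact: (@btensk_ractE _ _ _ _ _ (syz Y) T).
  by exists i => z; rewrite iE (mklinE l).
have [i iE] := fin_all_exists I.
have decz z : z = \sum_j m (tens (s j) (i j z : T)).
  rewrite -{1}(bidhE z) -sgE {1}(tens_sum (V := syz Y) (W := T) (sg z)) bhom_sum.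
  by apply: eq_bigr => j _; rewrite iE.
have C1 j : exists c : rhom (syz Y) (breg C), forall x t, lact (rapp c x : C) t = i j (m (tens x t)).
  apply: (@coeff_rhom _ (syz Y) (fun x t => i j (m (tens x t)) : T)) => [t|x|x t a|x c t].
  - by move=> c x y; rewrite tens_linl !linearP.
  - by move=> c t t'; rewrite tens_linr !linearP.
  - have -> : m (tens x (ract t a)) = ract (m (tens x t)) a.
      by rewrite -bhomr; congr (m _); symmetry; apply: (@ract_tens _ _ _ _ _ (syz Y) T).
    exact: (@bhomr _ _ _ _ _ (i j)).
  - congr (i j _); apply: iinj'.
    by rewrite !incm; rewrite -sT_ract; congr (sT _ t); apply: bker_valr.
have [c cE] := fin_all_exists C1.
exists N, inc, m; split=> //; first exact/injP.
exists _, s, i, c; split=> // x.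
(* Elements of Y (x) C are compared by their action on T, where the identity is [decz] at m(x (x)
   t). *)
apply: subvs_inj; apply/eqP; rewrite -subr_eq0; apply/eqP/sT_faithful => t.
have l := sT_linl (Y := Y) t.
have e0 : sT (vsval x) t = inc (m (tens x t)) by rewrite incm.
have l2 : linear (fun x : syz Y => sT (vsval x) t) by move=> c' x' y'; rewrite linearP sT_linl.
rewrite (linf_sub l) (linf_sum l2) e0 {1}(decz (m (tens x t))) bhom_sum.
apply/eqP; rewrite subr_eq0; apply/eqP; apply: eq_bigr => j _.
rewrite incm -cE -sT_ract; congr (sT _ t); symmetry; exact: bker_valr.
Qed.


Lemma syz_rdual_basis : cogenerated -> rdual_basis (syz Y).
Proof. by case/syz_trace=> N [inc [m [_ _ _ [n [s [i [c [_ _ h]]]]]]]]; exists n, s, c. Qed.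

End Syz2.

(** The syzygy lies in X (x) C, a power of C, and the maps c |-> theta(c -) from C to DT separate
    the elements of C as T is faithful. *)
Lemma syz_cogenerated (A' : falgType k) (X : bimod A' C) : cogenerated (syz X).
Proof.
move=> y h; apply: subvs_inj; apply/lfunP => phi; rewrite linear0 zero_lfunE.
apply: hF => t; apply: dual_sep => theta.
have l : linear (fun y : syz X =>
    (theta \o lacth T ((vsval y : 'Hom(dualv X, breg C)) phi : C))%VF : bdual T).
  move=> c x x'; rewrite linearP add_lfunE scale_lfunE.
  rewrite -[X in lacth T X]/(c *: ((vsval x : 'Hom(dualv X, breg C)) phi : C) +
    ((vsval x' : 'Hom(dualv X, breg C)) phi : C)).
  by rewrite lacth_lin comp_lfunDr comp_lfunZr.
have := h (mklin l); rewrite !mklinE => /(_ _)/lfunP/(_ t).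
rewrite comp_lfunE lacthE zero_lfunE; apply=> x b.
rewrite !(mklinE l); apply/lfunP => t'; rewrite bdual_rE !comp_lfunE !lacthE -lactM.
congr (theta (lact _ t')); rewrite bker_valr.
exact: (@btensk_ractE _ _ _ _ _ X (breg C)).
Qed.

Lemma cogenerated_pd (Y : rmod C) : cogenerated Y -> pd_le1 Y.
Proof.
move=> hY; exists (syz Y), (btensk Y (breg C)), (bker_incl (multmap Y)), (multmap Y); split.
- by apply: rdual_basis_proj; apply: syz_rdual_basis.
- by apply: rdual_basis_proj; apply: btens_reg_basis.
exact: bker_short (multmap_surj Y).
Qed.

Definition lcogenerated (L : lmod C) := forall l : L,
  (forall chi : lhom L T, lapp chi l = 0) -> l = 0.

(** Ext^1(Y, DL) is dual to Tor_1(Y, L), so the point is that syz Y (x)_C L embeds into Y (x)_k L.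
    This is tested after mapping L to T, where injectivity of N -> Y (x) T can be used. *)
Lemma ext1z_cogenerated (Y : rmod C) (L : lmod C) :
  cogenerated Y -> lcogenerated L -> ext1z Y (bdual L).
Proof.
move=> hY hL; have [N [inc [m [iinj incm ms [n [s [i [c [cE decz xE]]]]]]]]] := syz_trace hY.
have hs := bker_short (multmap_surj Y).
apply: (ext1z_pres _ hs) => [|f]; first by apply: rdual_basis_proj; apply: btens_reg_basis.
have W (x : btensk Y (breg C)) (l : L) : linear (fun chi : lhom L T => sT x (lapp chi l)).
  by move=> a u v; rewrite lapp_linearf sT_linr.
pose w x l := mklin (W x l).
have wE x l chi : w x l chi = sT x (lapp chi l) by apply: mklinE.
have wl l : linear (w^~ l).
  by move=> a x y; apply/lfunP => chi; rewrite add_lfunE scale_lfunE !wE sT_linl.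
have wr x : linear (w x).
  by move=> a l l'; apply/lfunP => chi; rewrite add_lfunE scale_lfunE !wE lapp_linear sT_linr.
have [| |O OE] := @hom_of_bilin k (syz Y) L _ (fun x l => w (vsval x) l).
- by move=> l a x y; rewrite linearP wl.
- by move=> x; apply: wr.
have [| |h0 h0E] := @hom_of_bilin k (syz Y) L k^o (fun x l => (f x : dualv L) l).
- by move=> l a x y; rewrite linearP add_lfunE scale_lfunE.
- by move=> x a l l'; rewrite linearP.
(* [O] sends x (x) l to the family of the x chi(l), for chi : L -> T. On its kernel the relation
   holds in N; the coordinates i_j move it to L by cogeneration, and the dual basis of syz Y shows
   that f kills it. So f factors through [O], and the factor [La] extends it to Y (x) C. *)
have [|La LaE] := @hom_factor _ _ _ _ O h0.
  move=> d; rewrite (tens_sum (V := syz Y) (W := L) d) => Od.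
  pose v (j : 'I_(\dim {:syz Y})) : syz Y := (vbasis {:syz Y})`_j.
  pose ll j := d (vcoord j).
  have e1 j : \sum_q lact (rapp (c j) (v q) : C) (ll q) = 0.
    apply: hL => chi; rewrite lapp_sum.
    have : \sum_q m (tens (v q) (lapp chi (ll q))) = 0.
      apply: iinj; rewrite bhom_sum.
      have /lfunP/(_ chi) := Od; rewrite linear_sum sum_lfunE zero_lfunE => e.
      by apply: etrans e; apply: eq_bigr => q _; rewrite incm /= OE wE.
    move/(congr1 (i j)); rewrite bhom_sum linear0 => e.
    by apply: etrans e; apply: eq_bigr => q _; rewrite lapp_l cE.
  rewrite linear_sum (eq_bigr (fun q => \sum_j (f (s j) : dualv L) (lact (rapp (c j) (v q) : C) (ll q)))).
    rewrite exchange_big big1 // => j _.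
    by rewrite -linear_sum e1 linear0.
  move=> q _; rewrite /= h0E {1}(xE (vbasis {:syz Y})`_q) bhom_sum sum_lfunE.
  by apply: eq_bigr => j _; rewrite bhomr bdual_rE.
have l : linear (fun x : btensk Y (breg C) => (La \o mklin (wr x))%VF : bdual L).
  move=> a x y; apply/lfunP => t; rewrite add_lfunE scale_lfunE !comp_lfunE !mklinE wl linearP.
  by [].
have [|h hE] := @rbhom _ _ (btensk Y (breg C)) (bdual L) (mklin l).
  move=> x b; rewrite !(mklinE l); apply/lfunP => t; rewrite bdual_rE !comp_lfunE !mklinE.
  by congr (La _); apply/lfunP => chi; rewrite !wE sT_ract lapp_l.
exists h => x; rewrite hE (mklinE l) bker_inclE; apply/lfunP => t.
by rewrite comp_lfunE mklinE -h0E -LaE OE.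
Qed.

(* Ext^1_C(Y, C) = Ext^1_A(W, T), where W is the cokernel of N -> Y (x) T, and the latter
   is a quotient of Hom_A(P1, T) for a projective presentation P1 -> P0 of W. *)
Lemma rExt1_generated (A' : falgType k) (Y : bimod A' C) : cogenerated Y ->
  forall lambda : dualv (rExt 1 Y (breg C)),
  (forall theta : 'Hom(T, rExt 1 Y (breg C)), llin (X := T) (Y := rExt 1 Y (breg C)) theta ->
     forall t, lambda (theta t) = 0) -> lambda = 0.
Proof.
move=> hY lambda hl; have [N [inc [m [iinj incm ms [n [s [i [c [cE decz xE]]]]]]]]] := syz_trace hY.
pose YT : rmod A := rforget (btensk Y T).
pose P0 : rmod A := btensk YT (breg A).
pose l0 : bhom P0 YT := multmap YT.
have P0p : projective P0 by apply: rdual_basis_proj; apply: btens_reg_basis.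
have l0s : limg l0 = fullv by apply: multmap_surj.
(* P1 is the preimage of N in P0, that is, the kernel of P0 -> W; it is projective by heredity. *)
have sU : stable (l0 @^-1: limg inc)%VS.
  split=> [a x|x b]; rewrite -!memv_preim => /memv_imgP[z _ e].
    by rewrite bhoml e -bhoml memv_img ?memvf.
  by rewrite bhomr e -bhomr memv_img ?memvf.
pose P1 : rmod A := bsub sU; pose j : bhom P1 P0 := bincl sU.
have jinj : lker j = 0%VS by apply: bincl_inj.
have P1p : projective P1 by apply: hered_sub_proj hA jinj P0p.
have incinj : lker inc = 0%VS by apply/injP.
have [|l1 l1E] := bhom_factor_inj (f := bcomp l0 j) incinj.
  move=> x; have := subvsP x; rewrite -memv_preim => /memv_imgP[z _ e]; exists z.
  by rewrite bcompE -e /j binclE.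
have inP1 p z : l0 p = inc z -> exists x : P1, j x = p.
  move=> e; exists (vsproj (l0 @^-1: limg inc)%VS p); rewrite binclE vsprojK //.
  by rewrite -memv_preim e memv_img ?memvf.
have iinj' z z' : inc z = inc z' -> z = z'.
  exact: lker_inj incinj.
have l1s : limg l1 = fullv.
  apply/surjP => z; have /surjP/(_ (inc z))[p e] := l0s.
  have [x ex] := inP1 p z (esym e); exists x; apply: iinj'.
  by rewrite l1E bcompE ex.
have [n1 [p1 [c1 c1E]]] := proj_rdual_basis P1p.
pose S2 := syz Y; pose R := rhom S2 (breg C).
(* A map f : syz Y -> C induces N -> T, m(x (x) t) |-> f(x) t (see [fhat]), here written with the
   dual basis of syz Y. F sends f to the composite P1 -> N -> T. *)
have rl (f : R) : rlin (X := P1) (Y := T)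
    (\sum_q (lacth T (rapp f (s q) : C) \o (bfun (i q) \o bfun l1))%VF).
  move=> x b; rewrite !sum_lfunE ract_sum; apply: eq_bigr => q _.
  rewrite !comp_lfunE !lacthE !bhomr.
  by rewrite -lractA; congr (lact _ _); apply: (bhomr (i q)).
have lF : linear (fun f : R => vsproj (rhomv P1 T)
   (\sum_q (lacth T (rapp f (s q) : C) \o (bfun (i q) \o bfun l1))%VF)).
  move=> a f g; rewrite -linearP; congr vsproj.
  rewrite scaler_sumr -big_split; apply: eq_bigr => q _ /=.
  by rewrite rapp_linearf lacth_lin comp_lfunDl comp_lfunZl.
have FE f x : rapp (mklin lF f) x = \sum_q lact (rapp f (s q) : C) (i q (l1 x) : T).
  rewrite /rapp (mklinE lF) vsprojK; last by apply/rhomvP; apply: rl.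
  by rewrite sum_lfunE; apply: eq_bigr => q _; rewrite !comp_lfunE lacthE.
have [|F FE'] := @lbhom _ _ (lforget R) (rhom P1 T) (mklin lF).
  move=> a f; apply: rapp_ext => x; rewrite rapp_lact !FE lact_sum.
  by apply: eq_bigr => q _; rewrite rapp_lact lactM.
have FEx f x : rapp (F f) x = \sum_q lact (rapp f (s q) : C) (i q (l1 x) : T).
  by rewrite FE' FE.
have fhat (f : R) x t : \sum_q lact (rapp f (s q) : C) (i q (m (tens x t)) : T) = lact (rapp f x : C) t.
  rewrite {2}(xE x) rapp_sum lact_suml; apply: eq_bigr => q _.
  by rewrite -cE rapp_r -lactM.
pose res := rhom_pre j T; pose q2 := bproj (im_stable res).
pose dS := rhom_pre (bker_incl (multmap Y)) (breg C).
have [|pi piE] := @lbhom _ _ (lforget R) (lforget (rExt 1 Y (breg C))) (bproj (im_stable dS)).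
  by move=> a f; apply: (@bhoml _ _ _ _ _ (bproj (im_stable dS))).
(* Given h : P1 -> T, its restriction to the kernel of P0 -> Y (x) T extends to some u on P0,
   because Ext^1(Y (x) T, T) = 0. The difference h - u j factors through N, and maps N -> T come
   from maps syz Y -> C. *)
have surj2 : limg (bcomp q2 F) = fullv.
  apply/surjP => e; have /surjP/(_ e)[h ->] := bproj_surj (im_stable res).
  have [|ka kaE] := bhom_factor_inj (f := bker_incl l0) jinj.
    move=> x; have [|x1 <-] := @inP1 (bker_incl l0 x) 0; last by exists x1.
    by rewrite bker_inclE bker_val0 linear0.
  have eT : ext1z YT (rforget T) by apply: ext1z_tens_l.
  have [h1 h1E] : exists h1 : bhom P1 (rforget T), forall x, h1 x = rapp h x.
    have [|h1 h1E] := @rbhom _ _ P1 (rforget T) (vsval h); first exact: rhomP.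
    by exists h1 => x; rewrite h1E.
  have [u uE] := eT _ _ _ _ (bker_short l0s) (bcomp h1 ka).
  have [|g gE] := bhom_factor (f := bsubh h1 (bcomp u j)) l1s.
    move=> x lx; rewrite bsubhE bcompE.
    have [|y ye] := @bker_elt _ _ _ _ _ l0 (j x).
      by rewrite -(bcompE l0 j) -l1E lx linear0.
    have -> : x = ka y.
      by apply: (lker_inj jinj); rewrite kaE bker_inclE ye.
    by rewrite kaE uE bcompE subrr.
  have [||||f fE] := @coeff_rhom _ S2 (fun x t => g (m (tens x t)) : T).
  - by move=> t a x y; rewrite tens_linl !linearP.
  - by move=> x a t t'; rewrite tens_linr !linearP.
  - move=> x t a; have -> : m (tens x (ract t a)) = ract (m (tens x t)) a.
      by rewrite -bhomr; congr (m _); symmetry; apply: (@ract_tens _ _ _ _ _ (syz Y) T).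
    exact: (@bhomr _ _ _ _ _ g).
  - move=> x a t; congr (g _); apply: iinj'.
    by rewrite !incm -sT_ract; congr (sT _ t); apply: bker_valr.
  exists f; rewrite bcompE; apply/eqP; rewrite -subr_eq0 -linearB.
  rewrite /q2 -memv_ker bproj_ker.
  have [|u' u'E] := @rhom_of _ _ _ _ P0 T u; first by move=> x b; apply: (bhomr u).
  apply/memv_imgP; exists u'; rewrite ?memvf //; apply: rapp_ext => x.
  rewrite rapp_pre u'E -[h - F f]addrC -[- F f]scaleN1r rapp_linearf scaleN1r FEx.
  rewrite (eq_bigr (fun q => (g (m (tens (s q) (i q (l1 x) : T))) : T))); last by move=> q _; rewrite fE.
  rewrite -(bhom_sum g) -decz gE bsubhE bcompE h1E opprB.
  exact: subrK.
(* If F f extends to P0, the extension vanishes on the kernel of [l0] and descends to Y (x) T -> T;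
   by [coeff_rhom] this is an extension of f to Y (x) C. *)
have ker2 f : bcomp q2 F f = 0 -> pi f = 0.
  move/eqP; rewrite bcompE /q2 -memv_ker bproj_ker => /memv_imgP[u _ eu].
  have uj x : rapp u (j x) = rapp (F f) x by rewrite eu rapp_pre.
  have [|u1 u1E] := @rbhom _ _ P0 (rforget T) (vsval u); first exact: rhomP.
  have u1j x : u1 (j x) = rapp (F f) x by rewrite u1E -uj.
  have [|G GE] := bhom_factor (f := u1) l0s.
    move=> p l0p; have [|x ex] := @inP1 p 0; first by rewrite l0p linear0.
    rewrite -ex u1j FEx; have -> : l1 x = 0.
      by apply: iinj; rewrite l1E bcompE ex.
    by rewrite big1 // => q _; rewrite linear0; exact: lact0.
  have [||||f' f'E] := @coeff_rhom _ (btensk Y (breg C)) (fun x t => G (sT x t) : T).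
  - by move=> t a x y; rewrite sT_linl linearP.
  - by move=> x a t t'; rewrite sT_linr linearP.
  - by move=> x t a; rewrite sT_r; apply: (bhomr G).
  - by move=> x a t; rewrite sT_ract.
  suff e0 : bproj (im_stable dS) f = 0 by rewrite piE; exact: e0.
  apply/eqP; rewrite -memv_ker bproj_ker; apply/memv_imgP.
  exists f'; rewrite ?memvf //; apply: rapp_ext => x; rewrite rapp_pre.
  apply/eqP; rewrite -subr_eq0; apply/eqP/hF => t.
  rewrite -[rapp f x - _]/((rapp f x : C) - (rapp f' (bker_incl (multmap Y) x) : C)).
  rewrite lactDl lactNl f'E bker_inclE -incm -fhat.
  have /surjP/(_ (m (tens x t)))[x1 e1] := l1s.
  rewrite e1 l1E bcompE GE u1j FEx; exact: subrr.
have [H HE] := bhom_factor (f := pi) surj2 ker2.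
apply/lfunP => e; rewrite zero_lfunE.
have /surjP/(_ e)[f ef] := bproj_surj (im_stable dS).
have -> : e = H (q2 (F f)).
  by have := HE f; rewrite bcompE piE => ->; exact: ef.
(* The left module Hom_A(P1, T) is generated by T: a dual basis of P1 gives the maps t |-> t c_a(-),
   whose images span it. *)
have TA a : exists ta : 'Hom(T, rhom P1 T), (llin (X := T) (Y := rhom P1 T) ta) /\
    forall t x, rapp (ta t) x = ract t (rapp (c1 a) x).
  have l (t : T) : linear (fun x : P1 => ract t (rapp (c1 a) x)).
    by move=> b x y; rewrite rapp_linear ract_linr.
  have lr t : mklin (l t) \in rhomv P1 T.
    by apply/rhomvP => x b; rewrite !(mklinE (l t)) rapp_r -ractM.
  have l' : linear (fun t => vsproj (rhomv P1 T) (mklin (l t))).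
    move=> b t t'; rewrite -linearP; congr vsproj; apply/lfunP => x.
    by rewrite add_lfunE scale_lfunE !mklinE ract_linl.
  have ex t x : rapp (mklin l' t) x = ract t (rapp (c1 a) x).
    by rewrite /rapp (mklinE l') vsprojK // mklinE.
  exists (mklin l'); split=> // b t; apply: rapp_ext => x.
  by rewrite rapp_lact !ex lractA.
have [ta taE] := fin_all_exists TA.
have -> : F f = \sum_a ta a (rapp (F f) (p1 a)).
  apply: rapp_ext => x; rewrite rapp_sumf {1}(c1E x) rapp_sum.
  by apply: eq_bigr => a _; rewrite (taE a).2 rapp_r.
rewrite !bhom_sum linear_sum big1 // => a _.
have := hl (bfun H \o (bfun q2 \o ta a))%VF.
move=> /(_ _ (rapp (F f) (p1 a))); rewrite !comp_lfunE; apply=> b t.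
rewrite !comp_lfunE (taE a).1 !bhoml.
exact: (bhoml H).
Qed.

End TiltedCore.

(** * Rigidity of Ext^2 *)

Section Forget.
Variables (k : fieldType) (A C : falgType k).
Implicit Types X Y Z : bimod A C.

Definition rforgeth X Y (f : bhom X Y) : bhom (rforget X) (rforget Y).
Proof.
refine (let g : 'Hom(X, Y) := f in @Bhom _ _ _ (rforget X) (rforget Y) g _).
by split=> [a x|x b]; [exact: linearZ|exact: (@bhomr _ _ _ X Y f)].
Defined.

Definition lforgeth X Y (f : bhom X Y) : bhom (lforget X) (lforget Y).
Proof.
refine (let g : 'Hom(X, Y) := f in @Bhom _ _ _ (lforget X) (lforget Y) g _).
by split=> [a x|x b]; [exact: (@bhoml _ _ _ X Y f)|exact: linearZ].
Defined.

Lemma rforgethE X Y (f : bhom X Y) x : rforgeth f x = f x. Proof. by []. Qed.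

Lemma lforgeth_surj X Y (f : bhom X Y) : limg f = fullv -> limg (lforgeth f) = fullv.
Proof. by move=> /surjP h; apply/surjP => y; have [x e] := h y; exists x. Qed.

Lemma rforget_hom X Y (f : 'Hom(X, Y)) : rlin f ->
  exists g : bhom (rforget X) (rforget Y), forall x, g x = f x.
Proof. by move=> h; have [|g gE] := @rbhom _ _ (rforget X) (rforget Y) f; [|exists g]. Qed.

Lemma lforget_hom X Y (f : 'Hom(X, Y)) : llin f ->
  exists g : bhom (lforget X) (lforget Y), forall x, g x = f x.
Proof. by move=> h; have [|g gE] := @lbhom _ _ (lforget X) (lforget Y) f; [|exists g]. Qed.

Lemma rforgeth_short X Y Z (f : bhom X Y) (g : bhom Y Z) : short_exact f g ->
  short_exact (rforgeth f) (rforgeth g).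
Proof. by move=> /short_exactP[h1 h2 h3 h4]; apply/short_exactP; split. Qed.

Lemma rdual_basis_rforget X : rdual_basis X -> rdual_basis (rforget X).
Proof.
case=> n [s [c e]].
have L j : exists d : rhom (rforget X) (breg C), forall x, rapp d x = rapp (c j) x.
  by have [|d dE] := @rhom_of _ _ _ _ (rforget X) (breg C) (vsval (c j)); [exact: rhomP|exists d].
have [d dE] := fin_all_exists L.
by exists n, s, d => x; rewrite {1}(e x); apply: eq_bigr => j _; rewrite dE.
Qed.

Lemma rforget_proj X : rdual_basis X -> projective (rforget X).
Proof. by move=> h; apply: rdual_basis_proj; apply: rdual_basis_rforget. Qed.

End Forget.

(** The composite e0 c kills the image of i2, so it is a map S1 -> X; injectivity of X extends it to
    P0, and it lifts to h0 : P0 -> P0. From there the homotopy is built as usual: c - h0 i1 m1 has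
    values in S1 and lifts to h1, and b - h1 i2 has values in S2. *)
Lemma chain_null_homotopic (k : fieldType) (A B : falgType k) (X P0 P1 S1 S2 : bimod A B)
  (e0 : bhom P0 X) (i1 : bhom S1 P0) (m1 : bhom P1 S1) (i2 : bhom S2 P1)
  (b : bhom S2 P1) (c : bhom P1 P0) :
  injective_mod X -> projective P0 -> projective P1 ->
  short_exact i1 e0 -> short_exact i2 m1 -> (forall x, i1 (m1 (b x)) = c (i2 x)) ->
  exists (h1 : bhom P1 P1) (h2 : bhom S2 S2), forall x, b x = i2 (h2 x) + h1 (i2 x).
Proof.
move=> /inj_modP hI /projP P0p /projP P1p /[dup] he0 /short_exactP[i1i e0i1 e0K /surjP e0s].
move=> /[dup] hm1 /short_exactP[i2i m1i2 m1K /surjP m1s] chain.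
have i1i' : lker i1 = 0%VS by apply/injP.
have i2i' : lker i2 = 0%VS by apply/injP.
have [|g gE] := bhom_factor (f := bcomp e0 c) m1s.
  by move=> y /m1K[x ->]; rewrite bcompE -chain e0i1.
have [h0' h0'E] := hI _ _ i1 g i1i'.
have [h0 h0E] := P0p _ _ e0 h0' e0s.
have [|w wE] := bhom_factor_inj (f := bsubh c (bcomp h0 (bcomp i1 m1))) i1i'.
  by move=> y; apply: e0K; rewrite bsubhE linearB !bcompE /= h0E h0'E gE bcompE subrr.
have [h1 h1E] := P1p _ _ m1 w m1s.
have [|h2 h2E] := bhom_factor_inj (f := bsubh b (bcomp h1 i2)) i2i'.
  move=> x; apply: m1K; apply: (lker_inj i1i').
  have e : i1 (m1 (h1 (i2 x))) = c (i2 x).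
    by rewrite h1E wE bsubhE !bcompE m1i2 linear0 linear0 subr0.
  by rewrite bsubhE bcompE linearB /= linearB /= e chain subrr linear0.
by exists h1, h2 => x; rewrite h2E bsubhE bcompE subrK.
Qed.

Section CokernelRigid.
Variables (k : fieldType) (A C : falgType k) (X P0 P1 S1 S2 : bimod A C).
Variables (e0 : bhom P0 X) (i1 : bhom S1 P0) (m1 : bhom P1 S1) (i2 : bhom S2 P1).

(* For the projective resolution P2 -> P1 -> P0 -> X, let E be the cokernel of
   P1^* -> P2^*.  A homomorphism from the image of P1^* to E comes from some b : P2 -> P1
   that extends to a chain map P -> P[-1]; as X is injective, that chain map is
   null-homotopic, and the homotopy extends the homomorphism to P2^*. *)
Lemma cokernel_rigid : injective_mod (rforget X) ->
  rdual_basis P0 -> rdual_basis P1 -> rdual_basis S2 ->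
  short_exact i1 e0 -> short_exact i2 m1 ->
  let E := bcoker (rhom_pre i2 (breg C)) in ext1z (lforget E) (lforget E).
Proof.
move=> hI b0 b1 b2 he0 hm1 E.
have [_ m1i2 _ _] := (short_exactP _ _).1 hm1.
have R2p := rdual_basis_dual_proj b2; have R1p := rdual_basis_dual_proj b1.
pose pi0 := bproj (im_stable (rhom_pre i2 (breg C))).
have pi0K f : pi0 f = 0 -> exists psi, f = rhom_pre i2 (breg C) psi.
  by move/eqP; rewrite -memv_ker bproj_ker => /memv_imgP[psi _ ->]; exists psi.
have pi0d psi : pi0 (rhom_pre i2 (breg C) psi) = 0.
  by apply/eqP; rewrite -memv_ker bproj_ker memv_img ?memvf.
have pi0s : limg pi0 = fullv by apply: bproj_surj.
pose pi := lforgeth pi0; have pis : limg pi = fullv by apply: lforgeth_surj.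
have Ki := bker_incl_inj pi.
apply: (ext1z_pres R2p (bker_short pis)) => f.
have [|ka kaE] := bhom_factor_inj (f := lforgeth (rhom_pre i2 (breg C))) Ki.
  move=> psi; have [|y ye] := @bker_elt _ _ _ _ _ pi (rhom_pre i2 (breg C) psi).
    exact: pi0d.
  by exists y; rewrite bker_inclE ye.
have [be beE] := (projP _).1 R1p _ _ pi (bcomp f ka) pis.
have [n1 [y1 [c1 c1E]]] := b1.
(* b is the transpose of [be], obtained from a dual basis of P1, so that [be psi] is psi b for every
   psi in Hom(P1, C). *)
have lb : linear (fun x : S2 => \sum_j ract (y1 j) (rapp (be (c1 j) : rhom S2 (breg C)) x : C)).
  move=> a x y; rewrite scaler_sumr -big_split; apply: eq_bigr => j _ /=.
  by rewrite rapp_linear ract_linr.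
have [|b bE] := @rforget_hom _ _ _ S2 P1 (mklin lb).
  move=> x c; rewrite !(mklinE lb) ract_sum; apply: eq_bigr => j _.
  by rewrite rapp_r -ractM.
have dualexp (psi : rhom P1 (breg C)) : psi = \sum_j lact (rapp psi (y1 j) : C) (c1 j).
  apply: rapp_ext => x; rewrite rapp_sumf {1}(c1E x) rapp_sum.
  by apply: eq_bigr => j _; rewrite rapp_r rapp_lact.
have bb (psi : rhom P1 (breg C)) x : rapp (be psi : rhom S2 (breg C)) x = rapp psi (b x).
  rewrite bE (mklinE lb) rapp_sum {1}(dualexp psi) bhom_sum (rapp_sumf (X := S2)).
  apply: eq_bigr => j _; rewrite bhoml rapp_r.
  exact: (@rapp_lact _ _ _ _ S2 (breg C)).
(* A form ze on P0 pulls back to a form on P1 that vanishes on S2, so its image under f is zero;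
   therefore ze i1 m1 b extends to P1. These extensions for a dual basis of P0 make up c. *)
have chiex (ze : rhom P0 (breg C)) : exists chi : rhom P1 (breg C), forall x,
    rapp chi (i2 x) = rapp ze (i1 (m1 (b x))).
  pose psi := rhom_pre (bcomp i1 m1) (breg C) ze.
  have psi0 : rhom_pre i2 (breg C) psi = 0.
    by apply: rapp_ext => x; rewrite !rapp_pre bcompE m1i2 linear0 rapp0 /rapp linear0.
  have k0 : ka psi = 0 by apply: (lker_inj Ki); rewrite kaE linear0; apply: psi0.
  have : pi0 (be psi) = 0 by have := beE psi; rewrite bcompE k0 bhom0.
  by move=> /pi0K[chi e]; exists chi => x; rewrite -rapp_pre -e bb rapp_pre bcompE.
have [n0 [z0 [c0 c0E]]] := b0.
have [chi chiE] := fin_all_exists (fun l => chiex (c0 l)).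
have lc : linear (fun y : P1 => \sum_l ract (z0 l) (rapp (chi l) y : C)).
  move=> a x y; rewrite scaler_sumr -big_split; apply: eq_bigr => j _ /=.
  by rewrite rapp_linear ract_linr.
have [|c cE] := @rforget_hom _ _ _ P1 P0 (mklin lc).
  move=> x a; rewrite !(mklinE lc) ract_sum; apply: eq_bigr => j _.
  by rewrite rapp_r -ractM.
have chain x : rforgeth i1 (rforgeth m1 (b x)) = c (rforgeth i2 x).
  rewrite cE (mklinE lc) !rforgethE {1}(c0E (i1 (m1 (b x)))); apply: eq_bigr => l _.
  by rewrite chiE.
have [h1 [h2 hE]] := chain_null_homotopic hI (rforget_proj b0) (rforget_proj b1)
  (rforgeth_short he0) (rforgeth_short hm1) chain.
have rh2 (phi : rhom S2 (breg C)) : exists g : rhom S2 (breg C), forall x, rapp g x = rapp phi (h2 x).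
  have [|g gE] := @rhom_of _ _ _ _ S2 (breg C) (vsval phi \o bfun h2)%VF.
    by move=> x a; rewrite !comp_lfunE (bhomr h2); apply: rapp_r.
  by exists g => x; rewrite gE comp_lfunE.
have lH : linear (fun phi : rhom S2 (breg C) =>
    vsproj (rhomv S2 (breg C)) (vsval phi \o bfun h2)%VF).
  by move=> a x y; rewrite -linearP; congr vsproj; rewrite linearP comp_lfunDl comp_lfunZl.
have ph2 phi x : rapp (mklin lH phi) x = rapp phi (h2 x).
  rewrite (mklinE lH) /rapp vsprojK ?comp_lfunE //; apply/rhomvP => y a.
  by rewrite !comp_lfunE (bhomr h2); apply: rapp_r.
have [|H HE] := @lforget_hom _ _ _ _ E (bfun pi0 \o mklin lH)%VF.
  move=> a phi; rewrite !comp_lfunE -bhoml; congr (pi0 _).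
  by apply: rapp_ext => x; rewrite rapp_lact !ph2 rapp_lact.
exists H => z; rewrite HE comp_lfunE.
have [psi psiE] : exists psi, vsval z = rhom_pre i2 (breg C) psi.
  by apply: pi0K; apply: (bker_val0 (f := pi)).
have zE : z = ka psi by apply: (lker_inj Ki); rewrite kaE bker_inclE psiE.
have fz : f z = pi0 (be psi) by rewrite zE -[LHS](bcompE f ka) -beE.
rewrite fz bker_inclE psiE.
have [|p2 p2E] := @rhom_of _ _ _ _ P1 (breg C) (vsval psi \o bfun h1)%VF.
  by move=> x a; rewrite !comp_lfunE (bhomr h1); apply: rapp_r.
(* By the homotopy psi b = psi i2 h2 + psi h1 i2, and the second term is zero in E. So f agrees with
   composition with h2, which is defined on all of Hom(S2, C). *)
have e : (be psi : rhom S2 (breg C)) = mklin lH (rhom_pre i2 (breg C) psi) + rhom_pre i2 (breg C) p2.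
  apply: rapp_ext => x; rewrite bb hE -[X in rapp (X + _)]scale1r rapp_linearf scale1r ph2 !rapp_pre p2E comp_lfunE.
  by rewrite /rapp linearD.
by rewrite e bhomD pi0d addr0.
Qed.

End CokernelRigid.

Lemma rExt2_rigid (k : fieldType) (A C : falgType k) (X : bimod A C) :
  injective_mod (rforget X) -> rdual_basis (syz (syz X)) ->
  ext1z (lforget (rExt 2 X (breg C))) (lforget (rExt 2 X (breg C))).
Proof.
move=> hI hS2; apply: (cokernel_rigid hI _ _ hS2 _ _ (e0 := multmap X) (m1 := multmap (syz X))
  (i1 := bker_incl (multmap X))).
- exact: btens_reg_basis.
- exact: btens_reg_basis.
- exact: bker_short (multmap_surj X).
exact: bker_short (multmap_surj (syz X)).
Qed.

(** * Path algebras are hereditary *)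

Section PathAlgebraModules.
Variables (k : fieldType) (Q : quiver).
Local Notation A := (pathalg k Q).

Definition pth (p : qpath Q) : A := [ffun r => (r == p)%:R].

Lemma pth_sum (f : A) : f = \sum_p (f p : k) *: pth p.
Proof.
apply/ffunP => r; rewrite sum_ffunE (bigD1 r) //= big1 ?addr0 => [|p pr].
  by rewrite !ffunE eqxx /GRing.scale /= mulr1.
by rewrite !ffunE eq_sym (negbTE pr) /GRing.scale /= mulr0.
Qed.

Lemma pth_mulE p q r : (pth p * pth q : A) r = (qconcat p q r)%:R.
Proof.
rewrite [LHS]ffunE (bigD1 p) //= [X in _ + X]big1 ?addr0 => [|p' pp].
  rewrite (bigD1 q) //= big1 ?addr0 => [|q' qq].
    by rewrite !ffunE !eqxx !mulr1.
  by rewrite !ffunE (negbTE qq) !mulr0.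
by rewrite big1 // => q' _; rewrite !ffunE (negbTE pp) mul0r mulr0.
Qed.

Lemma pth_mul p q r : qconcat p q r -> (pth p * pth q : A) = pth r.
Proof.
move=> h; apply/ffunP => r'; rewrite pth_mulE ffunE; congr (nat_of_bool _)%:R.
apply/idP/eqP => [h'|-> //].
case/and3P: h => /eqP h1 _ /eqP h2; case/and3P: h' => /eqP h1' _ /eqP h2'.
by apply: qpath_inj; rewrite ?h1 ?h2.
Qed.

Lemma pth_mul0 p q : qpe p != qps q -> (pth p * pth q : A) = 0.
Proof.
by move=> h; apply/ffunP => r; rewrite pth_mulE /qconcat (negbTE h) andbF ffunE.
Qed.

Lemma qtriv_fun : exists t : qvert Q -> qpath Q, forall v, qps (t v) = v /\ qpl (t v) = [::].
Proof. by have [t h] := fin_all_exists (@qtriv_ex Q); exists t. Qed.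

Lemma qarr_fun : exists t : qarr Q -> qpath Q, forall a, qps (t a) = qsrc a /\ qpl (t a) = [:: a].
Proof.
have L (a : qarr Q) : exists p : qpath Q, qps p = qsrc a /\ qpl p = [:: a].
  by apply: qpath_ex => /=; [rewrite eqxx|exact: qvert_gt0].
by have [t h] := fin_all_exists L; exists t.
Qed.

Variables (tv : qvert Q -> qpath Q) (ta : qarr Q -> qpath Q).
Hypothesis tvE : forall v, qps (tv v) = v /\ qpl (tv v) = [::].
Hypothesis taE : forall a, qps (ta a) = qsrc a /\ qpl (ta a) = [:: a].

Lemma pth_one : 1 = \sum_v pth (tv v) :> A.
Proof.
apply/ffunP => r; rewrite [LHS]ffunE sum_ffunE.
case: eqP => [r0|rn0].
  rewrite (bigD1 (qps r)) //= big1 ?addr0 => [|v vr]; rewrite ffunE.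
    rewrite (_ : r == tv (qps r)) //; apply/eqP; apply: qpath_inj.
      by rewrite (tvE _).1.
    by rewrite (tvE _).2.
  by case: eqP => // e; rewrite e (tvE v).1 eqxx in vr.
rewrite big1 // => v _; rewrite ffunE; case: eqP => // e.
by case: rn0; rewrite e (tvE v).2.
Qed.

Lemma tv_end v : qpe (tv v) = v. Proof. by rewrite /qpe (tvE v).1 (tvE v).2. Qed.
Lemma ta_end a : qpe (ta a) = qtgt a. Proof. by rewrite /qpe (taE a).1 (taE a).2. Qed.

Lemma tv_mul v w : (pth (tv v) * pth (tv w) : A) = if v == w then pth (tv v) else 0.
Proof.
case: eqP => [<-|/eqP h]; last by apply: pth_mul0; rewrite tv_end (tvE w).1.
by apply: pth_mul; rewrite /qconcat tv_end (tvE v).1 (tvE v).2 !eqxx.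
Qed.

Lemma tv_ta a : (pth (tv (qsrc a)) * pth (ta a) : A) = pth (ta a).
Proof.
by apply: pth_mul; rewrite /qconcat tv_end (tvE _).1 (tvE _).2 (taE a).1 (taE a).2 !eqxx.
Qed.

Lemma ta_tv a : (pth (ta a) * pth (tv (qtgt a)) : A) = pth (ta a).
Proof.
by apply: pth_mul; rewrite /qconcat ta_end (tvE _).1 (tvE _).2 (taE a).1 (taE a).2 !eqxx.
Qed.

Lemma pathalg_rlin (M N : rmod A) (h : 'Hom(M, N)) :
  (forall v x, h (ract x (pth (tv v))) = ract (h x) (pth (tv v))) ->
  (forall a x, h (ract x (pth (ta a))) = ract (h x) (pth (ta a))) -> rlin h.
Proof.
move=> hv ha.
have H l : forall p x, qpl p = l -> h (ract x (pth p)) = ract (h x) (pth p).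
  elim: l => [|a l IH] p x pl.
    have e : p = tv (qps p) by apply: qpath_inj; rewrite ?(tvE _).1 ?(tvE _).2.
    by rewrite e hv.
  have := qpath_wf p; rewrite pl /= => /andP[/eqP sa wl].
  have [|p' [p1 p2]] := @qpath_ex Q (qtgt a) l wl.
    by apply: leq_trans (qpath_size p); rewrite pl /= leqnSn.
  have e : pth p = (pth (ta a) * pth p' : A).
    by symmetry; apply: pth_mul; rewrite /qconcat ta_end (taE a).1 (taE a).2 p1 p2 sa pl /= !eqxx.
  by rewrite e !ractM IH // ha.
move=> x f; rewrite (pth_sum f) !ract_sumr linear_sum; apply: eq_bigr => p _.
by rewrite !ractZr /= linearZ /= (H (qpl p)).
Qed.

Section Representation.
Variables (V : vectType k) (ep : qvert Q -> 'End(V)) (al : qarr Q -> 'End(V)).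
Hypothesis ac : qacyclic Q.
Hypothesis ep_mul : forall v w x, ep w (ep v x) = if v == w then ep v x else 0.
Hypothesis ep_sum : forall x, \sum_v ep v x = x.
Hypothesis al_ep : forall a x, ep (qtgt a) (al a x) = al a x.

Fixpoint repl (l : seq (qarr Q)) (x : V) : V := if l is a :: l' then repl l' (al a x) else x.

Lemma repl_linear l : linear (repl l).
Proof. by elim: l => //= a l IH c x y; rewrite linearP IH. Qed.

Lemma repl_cat l l' x : repl (l ++ l') x = repl l' (repl l x).
Proof. by elim: l x => /=. Qed.

Definition repp (p : qpath Q) (x : V) : V := repl (qpl p) (ep (qps p) x).

Lemma repp_linear p : linear (repp p).
Proof. by move=> c x y; rewrite /repp linearP repl_linear. Qed.

Lemma repp_end p x : ep (qpe p) (repp p x) = repp p x.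
Proof.
rewrite /repp /qpe; have := qpath_wf p.
have : ep (qps p) (ep (qps p) x) = ep (qps p) x by rewrite ep_mul eqxx.
elim: (qpl p) (qps p) (ep (qps p) x) => [|a l IH] v y //= ey /andP[_ w].
by have := IH (qtgt a) (al a y) (al_ep a y) w.
Qed.

(** If p and q compose, acyclicity guarantees that the concatenation respects the length bound built
    into [qpath]; otherwise the two vertex projections are orthogonal. *)
Lemma repp_mul p q x : \sum_r (qconcat p q r)%:R *: repp r x = repp q (repp p x).
Proof.
have [e|ne] := eqVneq (qpe p) (qps q); last first.
  rewrite big1 => [|r _]; last by rewrite /qconcat (negbTE ne) andbF scale0r.
  rewrite {1}/repp -repp_end ep_mul (negbTE ne).
  by rewrite (linf0 (@repl_linear _)).
have w : qwalk (qps p) (qpl p ++ qpl q) by rewrite qwalk_cat qpath_wf /= -/(qpe p) e qpath_wf.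
have [|r [r1 r2]] := qpath_ex w.
  by apply: ltnW; apply: qacyclic_size w.
rewrite (bigD1 r) //= big1 ?addr0 => [|r' rr].
  rewrite /qconcat r1 r2 e !eqxx scale1r [LHS]/repp r1 r2 repl_cat.
  by rewrite -/(repp p x) [RHS]/repp -e repp_end.
case h : (qconcat p q r'); last by rewrite scale0r.
case/and3P: h => /eqP h1 _ /eqP h2; case/eqP: rr.
by apply: qpath_inj; rewrite ?r1 ?r2.
Qed.

(** The module of a representation of Q with total space V, vertex projections [ep] and arrow maps
    [al]. Arrows satisfy no relations among each other; this freedom is the source of heredity. *)
Definition rep_mod : rmod A.
Proof.
refine (@Bimod k k^o A V (fun c x => (c : k) *: x)
  (fun x f => \sum_p (f p : k) *: repp p x) _ _ _ _ _ _ _ _ _).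
- by move=> x c a a' /=; rewrite scalerDl scalerA.
- by move=> a c x y /=; rewrite scalerDr !scalerA mulrC.
- move=> f c x y; rewrite scaler_sumr -big_split; apply: eq_bigr => p _ /=.
  by rewrite repp_linear scalerDr !scalerA mulrC.
- move=> x c f g; rewrite scaler_sumr -big_split; apply: eq_bigr => p _ /=.
  by rewrite !ffunE scalerDl scalerA.
- exact: scale1r.
- by move=> a a' x; rewrite scalerA.
- move=> x; rewrite pth_one; under eq_bigr do rewrite sum_ffunE scaler_suml.
  rewrite exchange_big -[RHS]ep_sum; apply: eq_bigr => v _.
  rewrite (bigD1 (tv v)) //= big1 ?addr0 => [|p pv]; rewrite ffunE.
    by rewrite eqxx scale1r /repp (tvE v).1 (tvE v).2.
  by rewrite (negbTE pv) scale0r.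
- move=> x f g.
  transitivity (\sum_p \sum_q ((f p : k) * (g q : k)) *: repp q (repp p x)).
    under eq_bigr => r _.
      rewrite ffunE scaler_suml; under eq_bigr do rewrite scaler_suml.
      over.
    rewrite exchange_big; apply: eq_bigr => p _; rewrite exchange_big; apply: eq_bigr => q _.
    rewrite -repp_mul scaler_sumr; apply: eq_bigr => r _.
    by rewrite scalerA mulrC.
  rewrite exchange_big; apply: eq_bigr => q _.
  rewrite (linf_sum (@repp_linear q)) scaler_sumr; apply: eq_bigr => p _.
  by rewrite -!(mklinE (@repp_linear q)) linearZ /= scalerA mulrC.
- move=> a x f; rewrite scaler_sumr; apply: eq_bigr => p _.
  by rewrite -!(mklinE (@repp_linear p)) [in RHS]linearZ /= !scalerA mulrC.
Defined.

Lemma rep_mod_pth x p : ract (x : rep_mod) (pth p) = repp p x.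
Proof.
rewrite /= (bigD1 p) //= big1 ?addr0 => [|q qp]; rewrite ffunE ?eqxx ?scale1r //.
by rewrite (negbTE qp) scale0r.
Qed.

End Representation.
End PathAlgebraModules.

(** With a section compatible with the vertices, an extension of X by S is described by arbitrary
    linear maps d_a : X -> S at the arrows a. The maps f d_a lift along g to e_a, and these define
    an extension of X by Y over the one pushed out along f. It splits by hypothesis, and the
    splitting solves the original problem. *)
Theorem pathalg_hereditary (k : fieldType) (Q : quiver) : qacyclic Q ->
  hered_quot k^o (pathalg k Q).
Proof.
move=> ac X Y Z g hg hXY S M i q /[dup] hiq /short_exactP[i1 i2 i3 i4] f.
have [tv tvE] := qtriv_fun Q; have [ta taE] := qarr_fun Q.
pose ev v : pathalg k Q := pth k (tv v); pose aa a : pathalg k Q := pth k (ta a).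
have evE v w (W : rmod (pathalg k Q)) (x : W) :
    ract (ract x (ev v)) (ev w) = if v == w then ract x (ev v) else 0.
  by rewrite -ractM /ev (tv_mul _ tvE); case: eqP => // _; rewrite ract0r.
have ev_sum (W : rmod (pathalg k Q)) (x : W) : \sum_v ract x (ev v) = x.
  by rewrite -ract_sumr -(pth_one _ tvE) ract1.
have eva a (W : rmod (pathalg k Q)) (x : W) : ract (ract x (ev (qsrc a))) (aa a) = ract x (aa a).
  by rewrite -ractM /ev /aa (tv_ta _ tvE taE).
have aev a (W : rmod (pathalg k Q)) (x : W) : ract (ract x (aa a)) (ev (qtgt a)) = ract x (aa a).
  by rewrite -ractM /ev /aa (ta_tv _ tvE taE).
have qs : limg q = fullv by apply/surjP.
have ii : lker i = 0%VS by apply/injP.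
have [sg sgE] := hom_lift \1%VF qs.
(* a linear section of q compatible with the vertex idempotents *)
pose s0 := (\sum_v (racth M (ev v) \o (sg \o racth X (ev v)))%VF).
have s0E x : s0 x = \sum_v ract (sg (ract x (ev v))) (ev v).
  by rewrite sum_lfunE; apply: eq_bigr => v _; rewrite !comp_lfunE !racthE.
have qs0 x : q (s0 x) = x.
  rewrite s0E bhom_sum -[RHS]ev_sum; apply: eq_bigr => v _.
  by rewrite bhomr sgE id_lfunE evE eqxx.
have s0e v x : s0 (ract x (ev v)) = ract (s0 x) (ev v).
  rewrite !s0E ract_sum; apply: eq_bigr => w _; rewrite !evE.
  by rewrite [v == w]eq_sym; case: eqP => [<- //|_]; rewrite linear0 ract0.
(* d_a measures how far the section s0 is from commuting with the arrow a. *)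
have D a : exists d : 'Hom(X, S), forall x, i (d x) = ract (s0 x) (aa a) - s0 (ract x (aa a)).
  have [|d dE] := @hom_factor_inj _ _ _ _ i ((racth M (aa a) \o s0)%VF - (s0 \o racth X (aa a))%VF).
    move=> x; apply: i3; rewrite add_lfunE opp_lfunE !comp_lfunE !racthE linearB /= bhomr !qs0.
    exact: subrr.
  by exists d => x; rewrite dE add_lfunE opp_lfunE !comp_lfunE !racthE.
have [d dE] := fin_all_exists D.
have des a x : d a (ract x (ev (qsrc a))) = d a x.
  by apply: (lker_inj ii); rewrite !dE s0e !eva.
have det a x : ract (d a x) (ev (qtgt a)) = d a x.
  by apply: (lker_inj ii); rewrite bhomr !dE ractB aev -s0e aev.
(* Any linear lift of f d_a along g works once it is cut down by the idempotents of the source and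
   the target of a. *)
have D1 a : exists e : 'Hom(X, Y), [/\ forall x, g (e x) = f (d a x),
    forall x, e (ract x (ev (qsrc a))) = e x & forall x, ract (e x) (ev (qtgt a)) = e x].
  have [e0 e0E] := hom_lift (bfun f \o d a)%VF hg.
  exists (racth Y (ev (qtgt a)) \o (e0 \o racth X (ev (qsrc a))))%VF.
  split=> x; rewrite !comp_lfunE !racthE ?evE ?eqxx //.
  by rewrite bhomr e0E comp_lfunE -bhomr des det.
have [e eP] := fin_all_exists D1.
have eE a x : g (e a x) = f (d a x) by have [] := eP a.
have ees a x : e a (ract x (ev (qsrc a))) = e a x by have [] := eP a.
have eet a x : ract (e a x) (ev (qtgt a)) = e a x by have [] := eP a.
pose V : vectType k := (Y * X)%type.
have lep v : linear (fun z : V => (ract z.1 (ev v), ract z.2 (ev v)) : V).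
  by move=> c z z'; congr (_, _); rewrite /= ract_linl.
have lal a : linear (fun z : V => (ract z.1 (aa a) + e a z.2, ract z.2 (aa a)) : V).
  move=> c z z'; congr (_, _); rewrite /= ?ract_linl //.
  by rewrite linearP scalerDr addrACA.
have [ep epE] : exists ep : qvert Q -> 'End(V), forall v z, ep v z = (ract z.1 (ev v), ract z.2 (ev v)).
  by exists (fun v => mklin (lep v)) => v z; exact: (mklinE (lep v)).
have [al alE] : exists al : qarr Q -> 'End(V), forall a z,
    al a z = (ract z.1 (aa a) + e a z.2, ract z.2 (aa a)).
  by exists (fun a => mklin (lal a)) => a z; exact: (mklinE (lal a)).
have ep_mul v w x : ep w (ep v x) = if v == w then ep v x else 0.
  rewrite (epE w) (epE v) /= !evE; case: ifP => _; [done|exact: erefl].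
have ep_sum x : \sum_v ep v x = x.
  case: x => y x; apply/eqP; rewrite -pair_eqE /pair_eq /=.
  rewrite (linf_sum (f := fst)) ?(linf_sum (f := snd)) //.
  rewrite (eq_bigr (fun v => ract y (ev v))) ?ev_sum ?eqxx //=; last by move=> v _; rewrite epE.
  by rewrite (eq_bigr (fun v => ract x (ev v))) ?ev_sum ?eqxx //= => v _; rewrite epE.
have al_ep a x : ep (qtgt a) (al a x) = al a x.
  by rewrite epE !alE /= ractD !aev eet.
pose F := rep_mod tvE ac ep_mul ep_sum al_ep.
have Fv (z : F) v : ract z (ev v) = (ract (z : V).1 (ev v), ract (z : V).2 (ev v)).
  transitivity (repp ep al (tv v) z); first exact: rep_mod_pth.
  by rewrite /repp (tvE v).1 (tvE v).2 /= epE.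
have Fa (z : F) a : ract z (aa a) = (ract (z : V).1 (aa a) + e a (z : V).2, ract (z : V).2 (aa a)).
  transitivity (repp ep al (ta a) z); first exact: rep_mod_pth.
  by rewrite /repp (taE a).1 (taE a).2 /= epE alE /= !eva ees.
have ly : linear (fun y : Y => (y, 0) : V) by move=> c y y'; congr (_, _); rewrite /= scaler0 addr0.
have lx : linear (fun z : V => z.2) by [].
have [|iF iFE] := @rbhom _ _ Y F (mklin ly).
  apply: (pathalg_rlin tvE taE) => [v y|a y]; rewrite !(mklinE ly).
    by rewrite [RHS]Fv /= ract0.
  by rewrite [RHS]Fa /= ract0 linear0 addr0.
have [|qF qFE] := @rbhom _ _ F X (mklin lx).
  apply: (pathalg_rlin tvE taE) => [v y|a y]; rewrite !(mklinE lx).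
    by rewrite Fv.
  by rewrite Fa.
have hF : short_exact iF qF.
  apply/short_exactP; split.
  - by move=> y; rewrite iFE (mklinE ly) => -[].
  - by move=> y; rewrite iFE qFE (mklinE ly) (mklinE lx).
  - by move=> [y x]; rewrite qFE (mklinE lx) /= => ->; exists y; rewrite iFE (mklinE ly).
  by move=> x; exists (0, x); rewrite qFE (mklinE lx).
have [rho rhoE] := hXY _ _ _ _ hF (bidh Y).
(* u is the restriction of the retraction to the summand X. As X is not a submodule, u fails to
   commute with a by exactly e_a, see [ua]. *)
have lu : linear (fun x : X => rho ((0, x) : V)).
  move=> c x x'; rewrite -linearP; congr (rho _); congr (_, _).
  by rewrite /= scaler0 addr0.
pose u := mklin lu; have uE x : u x = rho ((0, x) : V) by apply: (mklinE lu).
have uv v x : u (ract x (ev v)) = ract (u x) (ev v).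
  by rewrite !uE -bhomr; congr (rho _); rewrite [RHS]Fv /= ract0.
have ua a x : ract (u x) (aa a) = e a x + u (ract x (aa a)).
  rewrite !uE -bhomr -[e a x](bidhE) -rhoE iFE (mklinE ly) -linearD; congr (rho _).
  by rewrite [LHS]Fa /= ract0; congr (_, _); rewrite /= ?add0r ?addr0.
have [|r rE] := @hom_factor_inj _ _ _ _ i (\1%VF - (s0 \o bfun q)%VF).
  move=> z; apply: i3; rewrite add_lfunE opp_lfunE comp_lfunE id_lfunE linearB /= qs0.
  exact: subrr.
have rdef z : i (r z) = z - s0 (q z) by rewrite rE add_lfunE opp_lfunE comp_lfunE id_lfunE.
(* The defect of f r at the arrow a is f d_a, and that of g u q cancels it since g e_a = f d_a. *)
pose h := ((bfun f \o r)%VF + (bfun g \o (u \o bfun q))%VF).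
have hE z : h z = f (r z) + g (u (q z)) by rewrite add_lfunE !comp_lfunE.
have [|h' h'E] := @rbhom _ _ M Z h.
  apply: (pathalg_rlin tvE taE) => [v z|a z]; rewrite !hE bhomr.
    rewrite uv !bhomr ractD -!bhomr; congr (f _ + _); apply: (lker_inj ii).
    by rewrite [RHS]bhomr !rdef bhomr s0e ractB.
  have -> : r (ract z (aa a)) = ract (r z) (aa a) + d a (q z).
    apply: (lker_inj ii); rewrite linearD /= bhomr !rdef dE bhomr ractB addrA.
    by rewrite subrK.
  rewrite linearD /= !ractD -!bhomr ua [g (_ + _)]linearD /= eE.
  by rewrite addrA (bhomr q).
exists h' => x; rewrite h'E hE i2 !linear0 addr0; congr (f _).
by apply: (lker_inj ii); rewrite rdef i2 linear0 subr0.
Qed.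


(** * Universal modules along an algebra map *)

Section Induction.
Variables (k : fieldType) (C B : falgType k) (f : 'Hom(C, B)).
Hypothesis f1 : f 1 = 1.
Hypothesis fM : forall c c', f (c * c') = f c * f c'.

(** Restriction along f. Here f is a linear map with two equations and not a bundled morphism as in
    [rrestrict], because for coinduced modules it is a composite with anti-isomorphisms. *)
Definition rres (Z : rmod B) : rmod C.
Proof.
refine (@Bimod k k^o C Z (fun a x => lact a x) (fun x c => ract x (f c))
  (@lact_linl _ _ _ Z) (@lact_linr _ _ _ Z) _ _ (@lact1 _ _ _ Z) (@lactM _ _ _ Z) _ _ _).
- by move=> b c x y; rewrite ract_linl.
- by move=> x c b b'; rewrite linearP ract_linr.
- by move=> x; rewrite f1 ract1.
- by move=> x b b'; rewrite fM ractM.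
- by move=> a x b; rewrite lractA.
Defined.

Lemma rresE (Z : rmod B) (z : Z) c : ract (z : rres Z) c = ract z (f c).
Proof. by []. Qed.

Lemma rforget_iso (X : rmod C) : biso (rforget X) X.
Proof.
have [|g gE] := @rbhom _ _ (rforget X) X \1%VF; first by move=> x b; rewrite !id_lfunE.
exists g; split; first by apply/injP => x; rewrite gE id_lfunE.
by apply/surjP => x; exists x; rewrite gE id_lfunE.
Qed.

(** The C-linear maps from M to the restriction of Z. M (x)_C B enters below only through its
    universal map [eta], so that one argument covers M (x)_C B and, over the opposite algebras, B
    (x)_C DM. *)
Definition slin (M : rmod C) (Z : rmod B) (g : 'Hom(M, Z)) :=
  forall x c, g (ract x c) = ract (g x) (f c).

Section Universal.
Variables (M : rmod C) (N : rmod B) (eta : 'Hom(M, N)).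
Hypothesis eta_slin : slin eta.
Hypothesis eta_univ : forall (Z : rmod B) (z : 'Hom(M, Z)), slin z ->
  exists h : bhom N Z, forall x, h (eta x) = z x.
Hypothesis eta_gen : forall y : N, exists t : 'Hom(dualv M, B),
  y = \sum_(i < \dim {:M}) ract (eta (vbasis {:M})`_i) (t (vcoord i)).

Let R : rmod B := btensk M (breg B).
Let K := syz M.
Let kap (x : K) : R := (f \o (vsval x : 'Hom(dualv M, C)))%VF.

Let kapE (x : K) phi : (kap x : 'Hom(dualv M, B)) phi = f ((vsval x : 'Hom(dualv M, C)) phi).
Proof. exact: comp_lfunE. Qed.

Let kap_linear : linear kap.
Proof. by move=> a x y; rewrite /kap linearP comp_lfunDr comp_lfunZr. Qed.

Let kap_ract x c : kap (ract x c) = ract (kap x) (f c).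
Proof.
apply/lfunP => phi; rewrite kapE bker_valr.
rewrite [RHS](@btensk_ractE _ _ _ _ _ M (breg B)) kapE /= -fM; congr (f _).
exact: (@btensk_ractE _ _ _ _ _ M (breg C)).
Qed.

Lemma free_slin (Z : rmod B) (u : 'Hom(M, Z)) : exists h : bhom R Z,
  (forall t, h t = \sum_(i < \dim {:M}) ract (u (vbasis {:M})`_i) ((t : 'Hom(dualv M, B)) (vcoord i)))
  /\ forall x b, h (tens x (b : breg B)) = ract (u x) b.
Proof.
have l : linear (fun t : 'Hom(dualv M, B) => \sum_(i < \dim {:M}) ract (u (vbasis {:M})`_i) (t (vcoord i))).
  move=> a x y; rewrite scaler_sumr -big_split; apply: eq_bigr => i _ /=.
  by rewrite add_lfunE scale_lfunE ract_linr.
have [|h hE] := @rbhom _ _ R Z (mklin l).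
  move=> t b; rewrite !(mklinE l) ract_sum; apply: eq_bigr => i _; rewrite -ractM.
  by congr (ract _ _); apply: (@btensk_ractE _ _ _ _ _ M (breg B)).
exists h; split=> [t|x b]; first by rewrite hE (mklinE l).
rewrite hE (mklinE l) {2}(vbasis_sum x) linear_sum ract_sum; apply: eq_bigr => i _.
by rewrite tensE linearZ /= (ractZr (X := Z)) ractZ.
Qed.

(** [kap] embeds the syzygy K of M in M (x)_k B through M (x)_k C. The vanishing extends g to M (x)
    C over C, and its values at the m (x) 1 determine a B-linear map on M (x) B. *)
Lemma slin_extend (Z : rmod B) (g : 'Hom(K, Z)) : ext1z M (rres Z) -> slin g ->
  exists h : bhom R Z, forall x, h (kap x) = g x.
Proof.
move=> HZ hg; have hs := bker_short (multmap_surj M).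
have [|g' g'E] := @rbhom _ _ K (rres Z) g; first exact: hg.
have [u uE] := HZ _ _ _ _ hs g'.
have lu : linear (fun x : M => u (tens x (1 : breg C)) : Z).
  by move=> a x y; rewrite tens_linl linearP.
have [h [hE _]] := free_slin (mklin lu).
exists h => x; rewrite hE -g'E -uE bker_inclE.
rewrite [in RHS](tens_sum (V := M) (W := breg C) (vsval x)) bhom_sum; apply: eq_bigr => i _.
rewrite (mklinE lu) kapE -rresE -bhomr.
by congr (u _); rewrite (@ract_tens _ _ _ _ _ M (breg C)) /= mul1r.
Qed.

Let tens1 (x : M) (b : B) : ract (tens x (1 : breg B) : R) b = tens x (b : breg B).
Proof. by rewrite (@ract_tens _ _ _ _ _ M (breg B)) /= mul1r. Qed.

Lemma kap_hat : exists kh : bhom (rforget (btensk K (breg B))) R,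
  (forall x b, kh (tens x (b : breg B)) = ract (kap x) b) /\
  forall d, kh d = \sum_(i < \dim {:K}) ract (kap (vbasis {:K})`_i) ((d : 'Hom(dualv K, B)) (vcoord i)).
Proof.
have [| |h hE] := @hom_of_bilin k K (breg B) R (fun x b => ract (kap x) b).
- by move=> b c x y; rewrite kap_linear ract_linl.
- by move=> x c b b'; rewrite ract_linr.
have [|kh khE] := @rbhom _ _ (rforget (btensk K (breg B))) R h.
  by apply: (@tens_rlin _ _ _ _ _ K (breg B) _ R) => x b b'; rewrite !hE; apply: (@ractM _ _ _ R).
exists kh; split=> [x b|d]; first by rewrite khE hE.
rewrite [in LHS](tens_sum (V := K) (W := breg B) d) bhom_sum; apply: eq_bigr => i _.
by rewrite khE hE.
Qed.

(** Right exactness: K (x)_k B -> M (x)_k B -> N -> 0 is exact. *)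
Lemma universal_pres : exists p : bhom R N,
  [/\ forall x b, p (tens x (b : breg B)) = ract (eta x) b, limg p = fullv,
      forall x, p (kap x) = 0
    & forall kh : bhom (rforget (btensk K (breg B))) R,
      (forall x b, kh (tens x (b : breg B)) = ract (kap x) b) ->
      forall r, p r = 0 -> exists d, r = kh d].
Proof.
have [p [pE pt]] := free_slin eta; exists p; split=> //.
- by apply/surjP => y; have [t ->] := eta_gen y; exists t; rewrite pE.
- move=> x; rewrite pE (eq_bigr (fun i : 'I_(\dim {:M}) =>
     eta (ract (vbasis {:M})`_i ((vsval x : 'Hom(dualv M, C)) (vcoord i))))).
    by rewrite -(linf_sum (linearP eta)) -multmapE bker_val0 linear0.
  by move=> i _; rewrite kapE eta_slin.
(* The universal property of [eta] is applied to the cokernel Z of [kh]: m |-> [m (x) 1] is C-linear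
   there, so the projection to Z factors through p. *)
move=> kh khE r pr0; pose Z := bquot (im_stable kh); pose pz := bproj (im_stable kh).
have lz : linear (fun x : M => pz (tens x (1 : breg B)) : Z).
  by move=> a x y; rewrite tens_linl linearP.
have [|h hE] := @eta_univ Z (mklin lz).
  move=> x c; rewrite !(mklinE lz) -bhomr tens1.
  have [|y ye] := @bker_elt _ _ _ _ _ (multmap M) (tens x (c : breg C) - tens (ract x c) (1 : breg C)).
    by rewrite linearB /= !multmap1 ract1 subrr.
  symmetry; apply: (@bproj_im_eq _ _ _ _ _ kh _ _ (tens y (1 : breg B))).
  rewrite khE ract1; apply/lfunP => phi; rewrite add_lfunE kapE ye.
  rewrite !add_lfunE !opp_lfunE !tensE linearB !linearZ /= f1.
  by rewrite scalerN [RHS]addrC subrK.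
have hp t : h (p t) = pz t.
  apply/eqP; rewrite -subr_eq0; apply/eqP.
  have <- : (bfun h \o bfun p - bfun pz)%VF t = h (p t) - pz t.
    by rewrite add_lfunE opp_lfunE comp_lfunE.
  apply: (@tens_ext0 k M (breg B)) => x b.
  rewrite add_lfunE opp_lfunE comp_lfunE pt bhomr hE (mklinE lz) -bhomr tens1.
  exact: subrr.
by apply: bproj_im_ker; rewrite -/pz -hp pr0 bhom0.
Qed.

(** Ext^1_C(M, DB) is dual to Tor_1^C(M, B), so its vanishing makes the kernel of p equal to K (x)_C
    B. A dual basis of the projective module K then induces one of this kernel. *)
Lemma universal_pd : pd_le1 M -> ext1z M (rres (rforget (bdual (breg B)))) -> pd_le1 N.
Proof.
move=> hM hDB; have [p [pt ps pk pK]] := universal_pres; have [kh [kht khE]] := kap_hat.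
have Pp : projective (btensk M (breg C) : rmod C).
  by apply: rdual_basis_proj; apply: btens_reg_basis.
have [n [s [c cE]]] := proj_rdual_basis (pd_kernel hM Pp (multmap_surj M)).
pose D := btensk K (breg B).
have Cex j : exists Cj : 'Hom(D, breg B), rlin (X := D) Cj /\
    forall x b, Cj (tens x (b : breg B)) = f (rapp (c j) x) * b.
  have [| |h hE] := @hom_of_bilin k K (breg B) (breg B) (fun x b => f (rapp (c j) x) * b).
  - move=> b a x y; rewrite rapp_linear -[rapp _ x]/(rapp (c j) x : C).
    by rewrite -[X in f X]/(a *: (rapp (c j) x : C) + (rapp (c j) y : C)) linearP mulrDl scalerAl.
  - by move=> x a b b'; rewrite mulrDr scalerAr.
  exists h; split=> //; apply: (@tens_rlin _ _ _ _ _ K (breg B) _ (breg B)) => x b b'.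
  by rewrite !hE /= mulrA.
have [Cj CjE] := fin_all_exists Cex.
have CjL j : linear (Cj j : D -> breg B) by move=> a x y; exact: linearP.
pose DB : rmod B := rforget (bdual (breg B)).
have evDB (th : DB) b : (ract th b : dualv (breg B)) 1 = (th : dualv (breg B)) b.
  by apply: etrans (bdual_rE (X := breg B) _ _ _) _; rewrite /= mulr1.
(* The coordinate [Cj j] must descend to the kernel of p. Composed with a functional th on B it is,
   on K, a map to DB; this map extends to M (x) B and hence vanishes wherever [kh] does. *)
have Cker j d : kh d = 0 -> Cj j d = 0.
  move=> d0; apply: (@dual_sep _ (breg B)) => th.
  have lg : linear (fun x : K => ract (th : DB) (f (rapp (c j) x))).
    by move=> a x y; rewrite rapp_linear -[X in f X]/(a *: (rapp (c j) x : C) + (rapp (c j) y : C)) linearP ract_linr.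
  have [|h hE] := slin_extend (Z := DB) (g := mklin lg) hDB.
    move=> x c'; rewrite !(mklinE lg) rapp_r -[X in f X]/((rapp (c j) x : C) * c') fM.
    exact: (@ractM _ _ _ DB).
  have e t : h (kh t) = ract (th : DB) (Cj j t).
    have lr : linear (fun t : D => ract (th : DB) (Cj j t)).
      by move=> a x y; rewrite CjL; exact: (@ract_linr _ _ _ DB).
    rewrite -(mklinE lr); apply/eqP; rewrite -subr_eq0; apply/eqP.
    have <- : ((bfun h \o bfun kh)%VF - mklin lr) t = h (kh t) - mklin lr t.
      by rewrite add_lfunE opp_lfunE comp_lfunE.
    apply: (@tens_ext0 k K (breg B)) => x b.
    rewrite add_lfunE opp_lfunE comp_lfunE kht bhomr hE (mklinE lg) (mklinE lr) (CjE j).2.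
    by rewrite (@ractM _ _ _ DB) subrr.
  by rewrite -evDB -e d0 bhom0 zero_lfunE.
have Eex j := hom_factor (Cker j).
have [e eE] := fin_all_exists Eex.
pose L := bker p.
have kapL x : exists y : L, vsval y = kap x by apply: bker_elt; apply: pk.
have [s' s'E] := fin_all_exists (fun j => kapL (s j)).
have c'ex j : exists c' : rhom L (breg B), forall y, rapp c' y = e j (vsval y).
  have [|c' c'E] := @rhom_of _ _ _ _ L (breg B) (e j \o bfun (bker_incl p))%VF.
    move=> y b; rewrite !comp_lfunE bhomr bker_inclE.
    have [d ->] := pK kh kht _ (bker_val0 y).
    by rewrite -bhomr !eE; apply: (CjE j).1.
  by exists c' => y; rewrite c'E comp_lfunE bker_inclE.
have [c' c'E] := fin_all_exists c'ex.
have hL : rdual_basis (L : rmod B).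
  exists n, s', c' => y; apply: (lker_inj (bker_incl_inj p)); rewrite bhom_sum bker_inclE.
  have [d dE] := pK kh kht _ (bker_val0 y).
  have ld : linear (fun d : D => \sum_j ract (kap (s j)) (Cj j d)).
    move=> a u v; rewrite scaler_sumr -big_split; apply: eq_bigr => j _.
    by rewrite CjL; exact: (@ract_linr _ _ _ R).
  have E t : kh t = \sum_j ract (kap (s j)) (Cj j t).
    rewrite -(mklinE ld); apply/eqP; rewrite -subr_eq0; apply/eqP.
    have <- : (bfun kh - mklin ld) t = kh t - mklin ld t by rewrite add_lfunE opp_lfunE.
    apply: (@tens_ext0 k K (breg B)) => x b.
    rewrite add_lfunE opp_lfunE (mklinE ld) kht {1}(cE x) (linf_sum kap_linear) ract_sum.
    apply/eqP; rewrite subr_eq0; apply/eqP; apply: eq_bigr => j _.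
    by rewrite (CjE j).2 kap_ract -ractM.
  rewrite dE E; apply: eq_bigr => j _.
  by rewrite bhomr bker_inclE s'E c'E dE eE.
exists L, R, (bker_incl p), p; split; [exact: rdual_basis_proj| |exact: bker_short].
by apply: rdual_basis_proj; apply: btens_reg_basis.
Qed.

(** The kernel of p is generated over B by the image of K, so a map on it is determined by a
    semilinear map on K, and [slin_extend] extends that to the projective cover term of N. *)
Lemma universal_ext : ext1z M (rres N) -> ext1z N N.
Proof.
move=> hN; have [p [pt ps pk pK]] := universal_pres; have [kh [kht khE]] := kap_hat.
apply: (ext1z_pres _ (bker_short ps)); first by apply: rdual_basis_proj; apply: btens_reg_basis.
move=> g; have [|ka kaE] := @hom_factor_inj _ _ _ _ (bker_incl p) (mklin kap_linear).
  move=> x; rewrite (mklinE kap_linear); have [y <-] := @bker_elt _ _ _ _ _ p _ (pk x).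
  by exists y; rewrite bker_inclE.
have kaE' x : bker_incl p (ka x) = kap x by rewrite kaE (mklinE kap_linear).
have [|h hE] := slin_extend (g := (bfun g \o ka)%VF) hN.
  move=> x c; rewrite !comp_lfunE -bhomr; congr (g _).
  by apply: (lker_inj (bker_incl_inj p)); rewrite bhomr !kaE' kap_ract.
exists h => y; have [d] := pK kh kht _ (bker_val0 y); rewrite khE => yE.
have -> : y = \sum_(i < \dim {:K}) ract (ka (vbasis {:K})`_i) ((d : 'Hom(dualv K, B)) (vcoord i)).
  apply: (lker_inj (bker_incl_inj p)); rewrite bker_inclE yE bhom_sum.
  by apply: eq_bigr => i _; rewrite bhomr kaE'.
rewrite !bhom_sum; apply: eq_bigr => i _.
by rewrite !bhomr kaE' hE comp_lfunE.
Qed.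

(** Over C, the module N is an extension of a quotient of M by the image J of M (x)_k E. Since pd M
    is at most one, vanishing of Ext^1(M, -) passes to quotients, so M and E suffice. *)
Lemma universal_ext_res (E : rmod C) (j : 'Hom(E, B)) :
  (forall e c, j (ract e c) = j e * f c) -> (forall b, exists c e, b = f c + j e) ->
  pd_le1 M -> ext1z M M -> ext1z M E -> ext1z M (rres N).
Proof.
move=> jr hB hM hMM hME.
have l : linear (fun t : 'Hom(dualv M, E) =>
    \sum_(i < \dim {:M}) ract (eta (vbasis {:M})`_i) (j (t (vcoord i))) : rres N).
  move=> a x y; rewrite scaler_sumr -big_split; apply: eq_bigr => i _ /=.
  by rewrite add_lfunE scale_lfunE linearP ract_linr.
have [|mu muE] := @rbhom _ _ (rforget (btensk M E)) (rres N) (mklin l).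
  move=> t c; rewrite !(mklinE l) rresE ract_sum; apply: eq_bigr => i _.
  rewrite -ractM -jr; congr (ract _ (j _)); exact: (@btensk_ractE _ _ _ _ _ M E).
have muE' t : mu t = \sum_(i < \dim {:M}) ract (eta (vbasis {:M})`_i) (j ((t : 'Hom(dualv M, E)) (vcoord i))).
  by rewrite muE (mklinE l).
have muT x e : mu (tens x e) = ract (eta x) (j e).
  rewrite muE' {2}(vbasis_sum x) linear_sum ract_sum; apply: eq_bigr => i _.
  by rewrite tensE !linearZ /= (ractZr (X := N)) ractZ.
have e1 : ext1z M (rforget (btensk M E)).
  by apply: ext1z_tens_r; apply: ext1z_iso_r (biso_sym (rforget_iso E)) hME.
pose J := bsub (im_stable mu); pose iJ : bhom J (rres N) := bincl (im_stable mu).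
have [|m mE] := @bhom_factor_inj _ _ _ _ _ _ iJ mu (bincl_inj _).
  move=> x; exists (vsproj (limg mu) (mu x)).
  by rewrite binclE vsprojK // memv_img ?memvf.
have ms : limg m = fullv.
  apply/surjP => z; have : iJ z \in limg mu by rewrite -(bincl_im (im_stable mu)) memv_img ?memvf.
  case/memv_imgP => u _ e; exists u; apply: (lker_inj (bincl_inj (im_stable mu))).
  by rewrite -/iJ e mE.
have eJ : ext1z M J := ext1z_quot hM ms e1.
pose q := bproj (im_stable mu).
have [|et etE] := @rbhom _ _ M (rres N) eta; first exact: eta_slin.
have qs : limg (bcomp q et) = fullv.
  apply/surjP => z; have /surjP/(_ z)[y ->] := bproj_surj (im_stable mu).
  have [t tE] := eta_gen y.
  have C0 (i : 'I_(\dim {:M})) : exists c, exists e, t (vcoord i) = f c + j e by apply: hB.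
  have [c cP] := fin_all_exists C0; have [e eP] := fin_all_exists cP.
  exists (\sum_(i < \dim {:M}) ract (vbasis {:M})`_i (c i)); rewrite bcompE.
  apply: (@bproj_im_eq _ _ _ _ _ mu _ _ (\sum_(i < \dim {:M}) tens (vbasis {:M})`_i (e i))).
  rewrite etE bhom_sum (linf_sum (linearP eta)) tE -big_split; apply: eq_bigr => i _.
  by rewrite /= eta_slin (eP i) ractDr muT.
have hq : short_exact iJ q.
  by split; [exact: bincl_inj|rewrite bincl_im bproj_ker|exact: bproj_surj].
exact: (ext1z_middle hq eJ (ext1z_quot hM qs hMM)).
Qed.

End Universal.
End Induction.

(** * Balanced tensor products *)

Section BalancedTensor.
Variables (k : fieldType) (A C B : falgType k) (X : bimod A C) (Y : bimod C B).

Definition btens_elt (x : X) (y : Y) : btens X Y := bproj (tensrel_stable X Y) (tens x y).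

Lemma btens_eltP (x : X) (c : C) (y : Y) : btens_elt (ract x c) y = btens_elt x (lact c y).
Proof. by rewrite /btens_elt !bprojE; apply/vpi_eq; apply: tensrelP. Qed.

Lemma btens_elt_linl y : linear (btens_elt^~ y).
Proof. by move=> a x x'; rewrite /btens_elt tens_linl linearP. Qed.

Lemma btens_elt_linr x : linear (btens_elt x).
Proof. by move=> a y y'; rewrite /btens_elt tens_linr linearP. Qed.

Lemma btens_elt_l a x y : btens_elt (lact a x) y = lact a (btens_elt x y).
Proof. by rewrite /btens_elt -bhoml lact_tens. Qed.

Lemma btens_elt_r b x y : btens_elt x (ract y b) = ract (btens_elt x y) b.
Proof. by rewrite /btens_elt -bhomr ract_tens. Qed.

Lemma btens_univ (Z : bimod A B) (b : X -> Y -> Z) :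
  (forall y, linear (b^~ y)) -> (forall x, linear (b x)) ->
  (forall x c y, b (ract x c) y = b x (lact c y)) ->
  (forall a x y, b (lact a x) y = lact a (b x y)) ->
  (forall x y d, b x (ract y d) = ract (b x y) d) ->
  exists h : bhom (btens X Y) Z, forall x y, h (btens_elt x y) = b x y.
Proof.
move=> bl br bc ba bd; have [h0 h0E] := hom_of_bilin bl br.
have [||h1 h1E] := @bhom_of _ _ _ (btensk X Y) Z h0.
- by apply: tens_llin => a x y; rewrite !h0E ba.
- by apply: tens_rlin => x y d; rewrite !h0E bd.
have [|h hE] := bhom_factor (f := h1) (bproj_surj (tensrel_stable X Y)).
  move=> t /eqP; rewrite bprojE vpi_eq0 => ht.
  apply/eqP; rewrite h1E -memv_ker; apply: subvP ht.
  apply/subv_sumP => i _; apply/subv_sumP => j _; apply/subv_sumP => l _.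
  by rewrite -memvE memv_ker linearB /= !h0E bc subrr.
by exists h => x y; rewrite hE h1E h0E.
Qed.

Lemma btens_gen (t : btens X Y) : exists u : 'Hom(dualv X, Y),
  t = \sum_(i < \dim {:X}) btens_elt (vbasis {:X})`_i (u (vcoord i)).
Proof.
have /surjP/(_ t)[u ->] := bproj_surj (tensrel_stable X Y).
by exists u; rewrite {1}(tens_sum (V := X) (W := Y) u) bhom_sum.
Qed.

Lemma btens_gen_r (t : btens X Y) : exists u : 'I_(\dim {:Y}) -> X,
  t = \sum_(i < \dim {:Y}) btens_elt (u i) (vbasis {:Y})`_i.
Proof.
have [u ->] := btens_gen t.
exists (fun i => \sum_(j < \dim {:X}) (vcoord i (u (vcoord j)) : k) *: (vbasis {:X})`_j).
under [RHS]eq_bigr => i _.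
  rewrite (linf_sum (btens_elt_linl _)); over.
rewrite exchange_big; apply: eq_bigr => j _.
rewrite {1}(vbasis_sum (u (vcoord j))) (linf_sum (btens_elt_linr _)); apply: eq_bigr => i _.
by rewrite -(mklinE (btens_elt_linr _)) -(mklinE (btens_elt_linl _)) !linearZ /= !mklinE.
Qed.

End BalancedTensor.

Lemma reg_lproj (k : fieldType) (C : falgType k) : projective (lforget (breg C)).
Proof.
apply/projP => X Y g f /surjP hg; have [x xE] := hg (f (1 : C)).
have [|h hE] := @lbhom _ _ (lforget (breg C)) X (mklin (@lact_linl _ _ _ X x)).
  by move=> a c; rewrite !mklinE; apply: (@lactM _ _ _ X).
exists h => c; rewrite hE mklinE bhoml -xE -bhoml; congr (f _).
by rewrite /= mulr1.
Qed.

Lemma dual_lforget_iso (k : fieldType) (A C : falgType k) (X : bimod A C) :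
  biso (bdual (lforget X)) (rforget (bdual X)).
Proof.
have [|g gE] := @rbhom _ _ (bdual (lforget X)) (rforget (bdual X)) \1%VF.
  move=> phi a; rewrite !id_lfunE; apply/lfunP => x.
  exact: etrans (@bdual_rE _ _ _ (lforget X) a phi x) (esym (@bdual_rE _ _ _ X a phi x)).
exists g; split; first by apply/injP => x; rewrite gE id_lfunE.
by apply/surjP => x; exists x; rewrite gE id_lfunE.
Qed.

Lemma dual_rforget_iso (k : fieldType) (A C : falgType k) (X : bimod A C) :
  biso (bdual (rforget X)) (lforget (bdual X)).
Proof.
have [|g gE] := @lbhom _ _ (bdual (rforget X)) (lforget (bdual X)) \1%VF.
  move=> a phi; rewrite !id_lfunE; apply/lfunP => x.
  exact: etrans (@bdual_lE _ _ _ (rforget X) a phi x) (esym (@bdual_lE _ _ _ X a phi x)).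
exists g; split; first by apply/injP => x; rewrite gE id_lfunE.
by apply/surjP => x; exists x; rewrite gE id_lfunE.
Qed.

Lemma dual_reg_injective (k : fieldType) (C : falgType k) :
  injective_mod (rforget (bdual (breg C))).
Proof. by apply: injective_iso (dual_lforget_iso _) _; apply: dual_injective; apply: reg_lproj. Qed.

(** As a left C-module B is the sum of C and L, so DB is an extension of DC by DL, and DC is
    injective. *)
Lemma ext1z_res_dual (k : fieldType) (C B : falgType k) (f : 'Hom(C, B))
  (f1 : f 1 = 1) (fM : forall c c', f (c * c') = f c * f c')
  (M : rmod C) (L : lmod C) (s : 'Hom(L, B)) (p : 'Hom(B, C)) (q : 'Hom(B, L)) :
  (forall c b, p (f c * b) = c * p b) -> (forall c b, q (f c * b) = lact c (q b)) ->
  (forall c, p (f c) = c) -> (forall c, q (f c) = 0) -> (forall e, q (s e) = e) ->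
  (forall b, b = f (p b) + s (q b)) ->
  ext1z M (bdual L) -> ext1z M (rres f1 fM (rforget (bdual (breg B)))).
Proof.
move=> pf qf pK qK qs dec hL.
pose DB := rres f1 fM (rforget (bdual (breg B))).
have DBE (th : DB) c b : (ract th c : dualv B) b = (th : dualv B) (f c * b).
  exact: (@bdual_rE _ _ _ (breg B)).
have [|i iE] := @rbhom _ _ (bdual L) DB (mklin (@compr_lin k B L k^o q)).
  move=> phi c; rewrite !mklinE; apply/lfunP => b.
  by rewrite DBE comp_lfunE bdual_rE comp_lfunE qf.
have [|r rE] := @rbhom _ _ DB (rforget (bdual (breg C))) (mklin (@compr_lin k C B k^o f)).
  move=> phi c; rewrite !mklinE; apply/lfunP => b.
  rewrite comp_lfunE DBE; symmetry; apply: etrans (@bdual_rE _ _ _ (breg C) _ _ _) _.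
  by rewrite comp_lfunE /= fM.
have iE' phi b : (i phi : dualv B) b = (phi : dualv L) (q b) by rewrite iE mklinE comp_lfunE.
have rE' phi c : (r phi : dualv C) c = (phi : dualv B) (f c) by rewrite rE mklinE comp_lfunE.
apply: (@ext1z_middle _ _ _ M (bdual L) DB (rforget (bdual (breg C))) i r) => //; last first.
  by apply: inj_ext1z; apply: dual_reg_injective.
apply/short_exactP; split.
- by move=> phi /lfunP e; apply/lfunP => x; have := e (s x); rewrite iE' qs !zero_lfunE.
- by move=> phi; apply/lfunP => c; rewrite rE' iE' qK linear0 zero_lfunE.
- move=> th /lfunP e; exists ((th : dualv B) \o s)%VF; apply/lfunP => b.
  rewrite iE' comp_lfunE {1}(dec b) linearD /=.
  by have := e (p b); rewrite rE' zero_lfunE => ->; rewrite add0r.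
move=> phi; exists ((phi : dualv C) \o p)%VF; apply/lfunP => c.
by rewrite rE' comp_lfunE pK.
Qed.

(** * Opposite algebras *)

Section Opposite.
Variables (k : fieldType) (C : falgType k).

Definition opalg : Type := C.
HB.instance Definition _ := Vector.copy opalg C.
Definition op_mul (x y : opalg) : opalg := ((y : C) * (x : C) : C).

Lemma op_mulA : associative op_mul. Proof. by move=> x y z; rewrite /op_mul mulrA. Qed.
Lemma op_mul1x : left_id (1 : C) op_mul. Proof. by move=> x; rewrite /op_mul mulr1. Qed.
Lemma op_mulx1 : right_id (1 : C) op_mul. Proof. by move=> x; rewrite /op_mul mul1r. Qed.
Lemma op_mulDl : left_distributive op_mul +%R.
Proof. by move=> x y z; exact: (@mulrDr C). Qed.
Lemma op_mulDr : right_distributive op_mul +%R.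
Proof. by move=> x y z; exact: (@mulrDl C). Qed.
Lemma op_one_neq0 : (1 : C) != 0 :> opalg. Proof. exact: (@oner_neq0 C). Qed.

HB.instance Definition _ := GRing.Zmodule_isNzRing.Build opalg
  op_mulA op_mul1x op_mulx1 op_mulDl op_mulDr op_one_neq0.

Lemma op_scaleAl (a : k) (x y : opalg) : a *: op_mul x y = op_mul (a *: x) y.
Proof. exact: (@scalerAr k C a y x). Qed.
HB.instance Definition _ := GRing.Lmodule_isLalgebra.Build k opalg op_scaleAl.
Lemma op_scaleAr (a : k) (x y : opalg) : a *: op_mul x y = op_mul x (a *: y).
Proof. exact: (@scalerAl k C a y x). Qed.
HB.instance Definition _ := GRing.Lalgebra_isAlgebra.Build k opalg op_scaleAr.
HB.instance Definition _ := Algebra_isFalgebra.Build k opalg.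

End Opposite.

(* Statements about the opposite algebra are made for any A' with an anti-isomorphism
   A' -> A, so that passing to the opposite twice causes no trouble. *)
Record antiiso (k : fieldType) (A A' : falgType k) := Antiiso {
  anti :> 'Hom(A', A);
  antiV : 'Hom(A, A');
  anti1 : anti 1 = 1;
  antiM : forall x y, anti (x * y) = anti y * anti x;
  antiK : cancel anti antiV;
  antiVK : cancel antiV anti }.

Definition anti_inv (k : fieldType) (A A' : falgType k) (a : antiiso A A') : antiiso A' A.
Proof.
exists (antiV a) (anti a); [|move=> x y|exact: antiVK|exact: antiK].
  by rewrite -(anti1 a) antiK.
by apply: (can_inj (antiK a)); rewrite antiM !antiVK.
Defined.

Definition anti_op (k : fieldType) (C : falgType k) : antiiso C (opalg C).
Proof.
refine (@Antiiso k C (opalg C) (linfun (idfun : C -> C)) (linfun (idfun : C -> C)) _ _ _ _).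
- by rewrite lfunE.
- by move=> x y; rewrite !lfunE.
- by move=> x; rewrite !lfunE.
- by move=> x; rewrite !lfunE.
Defined.

Definition anti_k (k : fieldType) : antiiso (k^o : falgType k) k^o.
Proof.
refine (@Antiiso k k^o k^o \1%VF \1%VF _ _ _ _).
- by rewrite id_lfunE.
- by move=> x y; rewrite !id_lfunE mulrC.
- by move=> x; rewrite !id_lfunE.
- by move=> x; rewrite !id_lfunE.
Defined.

Section AntiModules.
Variables (k : fieldType) (A A' B B' : falgType k) (a : antiiso A A') (b : antiiso B B').

Definition amod (X : bimod A B) : bimod B' A'.
Proof.
refine (@Bimod k B' A' X (fun c x => ract x (b c)) (fun x c => lact (a c) x) _ _ _ _ _ _ _ _ _).
- by move=> x c u v; rewrite linearP ract_linr.
- by move=> c e x y; rewrite ract_linl.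
- by move=> c e x y; rewrite lact_linr.
- by move=> x c u v; rewrite linearP lact_linl.
- by move=> x; rewrite anti1 ract1.
- by move=> u v x; rewrite antiM ractM.
- by move=> x; rewrite anti1 lact1.
- by move=> x u v; rewrite antiM lactM.
- by move=> u x v; rewrite lractA.
Defined.

Implicit Types X Y Z : bimod A B.

Lemma amod_lE X c (x : X) : lact c (x : amod X) = ract x (b c). Proof. by []. Qed.
Lemma amod_rE X c (x : X) : ract (x : amod X) c = lact (a c) x. Proof. by []. Qed.

Definition amodh X Y (f : bhom X Y) : bhom (amod X) (amod Y).
Proof.
refine (let g : 'Hom(X, Y) := f in @Bhom _ _ _ (amod X) (amod Y) g _).
by split=> [c x|x c]; [exact: (@bhomr _ _ _ X Y f)|exact: (@bhoml _ _ _ X Y f)].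
Defined.

Lemma amod_hom X Y (f : bhom (amod X) (amod Y)) : exists g : bhom X Y, forall x, g x = f x.
Proof.
have [c x|x c|g gE] := @bhom_of _ _ _ X Y f; last by exists g.
  by rewrite -{1}(antiVK a c); have := bhomr f x (antiV a c); rewrite !amod_rE antiVK.
by have := bhoml f (antiV b c) x; rewrite !amod_lE antiVK.
Qed.

Lemma amodh_short X Y Z (f : bhom X Y) (g : bhom Y Z) : short_exact f g ->
  short_exact (amodh f) (amodh g).
Proof. by move=> /short_exactP[h1 h2 h3 h4]; apply/short_exactP; split. Qed.

End AntiModules.

Section AntiTransfer.
Variables (k : fieldType) (A A' B B' : falgType k) (a : antiiso A A') (b : antiiso B B').
Implicit Types (X Z : bimod A B) (Y : bimod B' A').
Let am := amod a b.
Let am' := amod (anti_inv b) (anti_inv a).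

(** [am] and [am'] are mutually inverse only through the equations [antiK] and [antiVK], not by
    computation, so maps are carried across one at a time with the same underlying linear map. *)
Lemma amod_adjl X Y (f : bhom (am X) Y) : exists g : bhom X (am' Y), forall x, g x = f x.
Proof.
have [c x|x c|g gE] := @bhom_of _ _ _ X (am' Y) f; last by exists g.
  by have := bhomr f x (antiV a c); rewrite amod_rE antiVK.
by have := bhoml f (antiV b c) x; rewrite amod_lE antiVK.
Qed.

Lemma amod_adjr X Y (f : bhom Y (am X)) : exists g : bhom (am' Y) X, forall x, g x = f x.
Proof.
have [c x|x c|g gE] := @bhom_of _ _ _ (am' Y) X f; last by exists g.
  by have := bhomr f x (antiV a c); rewrite amod_rE antiVK.
by have := bhoml f (antiV b c) x; rewrite amod_lE antiVK.
Qed.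

Lemma amod_adjl' X Y (f : bhom X (am' Y)) : exists g : bhom (am X) Y, forall x, g x = f x.
Proof.
have [c x|x c|g gE] := @bhom_of _ _ _ (am X) Y f; last by exists g.
  by have := bhomr f x (b c); rewrite amod_rE (antiK b).
by have := bhoml f (a c) x; rewrite amod_lE (antiK a).
Qed.

Lemma amod_adjr' X Y (f : bhom (am' Y) X) : exists g : bhom Y (am X), forall x, g x = f x.
Proof.
have [c x|x c|g gE] := @bhom_of _ _ _ Y (am X) f; last by exists g.
  by have := bhomr f x (b c); rewrite amod_rE (antiK b).
by have := bhoml f (a c) x; rewrite amod_lE (antiK a).
Qed.

Lemma amod_projective X : projective X -> projective (am X).
Proof.
move=> /projP h; apply/projP => Y Z g f /surjP hg.
have [f' f'E] := amod_adjl f.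
have [|u uE] := h _ _ (amodh (anti_inv b) (anti_inv a) g) f'; first exact/surjP.
have [v vE] := amod_adjl' u; exists v => x; rewrite vE -f'E; exact: uE.
Qed.

Lemma amod_ext1z X Z : ext1z X Z -> ext1z (am X) (am Z).
Proof.
move=> h S Q i q /short_exactP[i1 i2 i3 i4] f.
have [q' q'E] := amod_adjr q; have [f' f'E] := amod_adjr f.
have [|u uE] := h _ _ (amodh (anti_inv b) (anti_inv a) i) q' _ f'.
  apply/short_exactP; split=> [x e|x|y|z]; first exact: i1.
  - by rewrite q'E i2.
  - by rewrite q'E => e; exact: i3.
  - by have [y e] := i4 z; exists y; rewrite q'E.
by have [v vE] := amod_adjr' u; exists v => s; rewrite vE -f'E; exact: uE.
Qed.

Lemma ext1z_amod X Z : ext1z (am X) (am Z) -> ext1z X Z.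
Proof.
move=> h S Q i q hiq f.
have [u uE] := h _ _ _ _ (amodh_short a b hiq) (amodh a b f).
by have [v vE] := amod_hom u; exists v => s; rewrite vE; exact: uE.
Qed.

Lemma amod_pd X : pd_le1 X -> pd_le1 (am X).
Proof.
case=> P1 [P0 [f [g [h1 h0 h]]]]; exists (am P1), (am P0), (amodh a b f), (amodh a b g).
by split; [exact: amod_projective|exact: amod_projective|exact: amodh_short].
Qed.

Lemma amod_amod X : biso (am' (am X)) X.
Proof.
have [g gE] := amod_adjr (bidh (am X)); exists g; split.
  by apply/injP => x; rewrite gE bidhE.
by apply/surjP => x; exists x; rewrite gE bidhE.
Qed.

End AntiTransfer.

Lemma pd_amod (k : fieldType) (A A' B B' : falgType k) (a : antiiso A A') (b : antiiso B B') X :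
  pd_le1 (amod a b X) -> pd_le1 X.
Proof.
by move=> /(amod_pd (anti_inv b) (anti_inv a)); apply: pd_le1_iso; apply: amod_amod.
Qed.

Lemma amod_hered (k : fieldType) (A A' B B' : falgType k) (a : antiiso A A') (b : antiiso B B') :
  hered_sub A B -> hered_sub B' A'.
Proof.
move=> h X Y Z i hi hYZ; apply: (ext1z_amod (a := anti_inv b) (b := anti_inv a)).
apply: (h _ (amod (anti_inv b) (anti_inv a) Y) _ (amodh (anti_inv b) (anti_inv a) i)).
  by move/injP: hi => hi; apply/injP.
exact: amod_ext1z.
Qed.

(** * Balance of Ext^2 *)

(** A total linear relation with zero indeterminacy is a graph. It turns a correspondence between
    representatives of classes into a linear map without choosing representatives linearly. *)
Lemma functional_relation (k : fieldType) (E E' : vectType k) (S : E -> E' -> Prop) :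
  (forall c x y x' y', S x x' -> S y y' -> S (c *: x + y) (c *: x' + y')) ->
  (forall x, exists x', S x x') -> (forall x', S 0 x' -> x' = 0) ->
  exists h : 'Hom(E, E'), forall x x', S x x' -> x' = h x.
Proof.
move=> hS ht h0.
have inj x x' y' : S x x' -> S x y' -> x' = y'.
  move=> h1 h2; apply/eqP; rewrite -subr_eq0 addrC -scaleN1r; apply/eqP/h0.
  by rewrite -(addNr x) -scaleN1r; apply: hS.
have [e eE] := fin_all_exists (fun i : 'I_(\dim {:E}) => ht (vbasis {:E})`_i).
have L : linear (fun x : E => \sum_(i < \dim {:E}) (vcoord i x : k) *: e i).
  move=> c x y; rewrite scaler_sumr -big_split; apply: eq_bigr => i _ /=.
  by rewrite linearP scalerDl scalerA.
exists (mklin L) => x x' hx; rewrite mklinE; apply: (inj x) => //.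
rewrite {1}(vbasis_sum x); have S0 : S 0 0 by have [y hy] := ht 0; move: (hy); rewrite (h0 y hy).
elim/big_ind2: _ => // [u u' v v' h1 h2|i _].
  by rewrite -(scale1r u) -(scale1r u'); apply: hS.
by have := hS (vcoord i x) _ _ _ _ (eE i) S0; rewrite !addr0.
Qed.

Section Symbols.
Variables (k : fieldType) (A C : falgType k) (Y : bimod A C).
Implicit Types (y : Y) (c d : C).

(** The generators y (x) c - yc (x) 1 of the syzygy, as in the normalised bar resolution; applied
    twice they span syz (syz Y). *)
Definition sz y c : syz Y :=
  vsproj (lker (multmap Y)) (tens y (c : breg C) - tens (ract y c) (1 : breg C)).

Lemma vsval_sz y c :
  vsval (sz y c) = tens y (c : breg C) - tens (ract y c) (1 : breg C).
Proof.
rewrite vsprojK // memv_ker linearB /= !(mklinE (@multmap_linear _ _ _ Y)) !multmap_tens.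
by rewrite ract1 subrr.
Qed.

Lemma sz_linl c : linear (sz^~ c).
Proof.
move=> e x y; apply: subvs_inj; rewrite linearP /= !vsval_sz ract_linl !tens_linl.
by rewrite scalerBr opprD addrACA.
Qed.

Lemma sz_linr y : linear (sz y).
Proof.
move=> e c d; apply: subvs_inj; rewrite linearP /= !vsval_sz ract_linr tens_linl.
by rewrite (tens_linr (W := breg C)) scalerBr opprD addrACA.
Qed.

Lemma sz1 y : sz y 1 = 0.
Proof. by apply: subvs_inj; rewrite vsval_sz ract1 subrr linear0. Qed.

Lemma sz_ract y c d : ract (sz y c) d = sz y (c * d) - sz (ract y c) d.
Proof.
have vsvalB (u v : syz Y) : vsval (u - v) = vsval u - vsval v by exact: linearB.
apply: subvs_inj; rewrite vsvalB (bker_valr (f := multmap Y)) !vsval_sz.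
rewrite (@ractB _ _ _ (btensk Y (breg C))) !(@ract_tens _ _ _ _ _ Y (breg C)) -ractM /= mul1r.
by rewrite opprB addrC addrA addrNK addrC.
Qed.

Lemma sz_lact a y c : lact a (sz y c) = sz (lact a y) c.
Proof.
apply: subvs_inj; rewrite (bker_vall (f := multmap Y)) !vsval_sz.
by rewrite (@lactB _ _ _ (btensk Y (breg C))) !(@lact_tens _ _ _ _ _ Y (breg C)) lractA.
Qed.

Lemma sz_span (z : syz Y) :
  z = \sum_(i < \dim {:Y}) sz (vbasis {:Y})`_i ((vsval z : 'Hom(dualv Y, breg C)) (vcoord i)).
Proof.
apply: subvs_inj; rewrite linear_sum /=.
under eq_bigr => i _ do rewrite vsval_sz.
rewrite big_split /= sumrN -tens_sum -(linf_sum (@tens_linl _ Y (breg C) 1)).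
have := bker_val0 (f := multmap Y) z; rewrite (mklinE (@multmap_linear _ _ _ Y)) => e.
by rewrite [X in tens X _]e (linf0 (@tens_linl _ Y (breg C) 1)) subr0.
Qed.

Lemma sz_ext (W : vectType k) (f g : syz Y -> W) : linear f -> linear g ->
  (forall y c, f (sz y c) = g (sz y c)) -> f =1 g.
Proof.
move=> lf lg h z; rewrite (sz_span z) (linf_sum lf) (linf_sum lg).
by apply: eq_bigr => i _; exact: h.
Qed.

Lemma sz_lin (W : vectType k) (beta : Y -> C -> W) :
  (forall c, linear (beta^~ c)) -> (forall y, linear (beta y)) ->
  exists h : 'Hom(syz Y, W), forall y c, h (sz y c) = beta y c - beta (ract y c) 1.
Proof.
move=> bl br; have [h hE] := @hom_of_bilin k Y (breg C) W beta bl br.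
exists (h \o linfun (@vsval _ _ (lker (multmap Y))))%VF => y c.
by rewrite comp_lfunE lfunE /= vsval_sz linearB /= !hE.
Qed.

(** The identity on beta is the relation [sz_ract] among the generators. At d = 1 it yields beta(yc,
    1) = 0, so the correction term of [sz_lin] disappears. *)
Lemma sz_rhom (A' : falgType k) (Z : bimod A' C) (beta : Y -> C -> Z) :
  (forall c, linear (beta^~ c)) -> (forall y, linear (beta y)) ->
  (forall y c d, ract (beta y c) d = beta y (c * d) - beta (ract y c) d) ->
  exists b : rhom (syz Y) Z, forall y c, rapp b (sz y c) = beta y c.
Proof.
move=> bl br hb; have [h hE] := sz_lin bl br.
have b1 y c : beta (ract y c) 1 = 0.
  have := hb y c 1; rewrite ract1 mulr1 => e.
  by apply/eqP; rewrite -oppr_eq0 -(inj_eq (addrI (beta y c))) addr0 -e.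
have hE' y c : h (sz y c) = beta y c by rewrite hE b1 subr0.
have [z c|b bE] := @rhom_of _ _ _ _ (syz Y) Z h; last by exists b => y c; rewrite bE hE'.
rewrite (sz_span z) ract_sum !linear_sum ract_sum; apply: eq_bigr => i _.
by rewrite sz_ract linearB /= !hE' hb.
Qed.

Lemma sz_extends (A' : falgType k) (Z : bimod A' C) (b : rhom (syz Y) Z) :
  (exists e, b = rhom_pre (bker_incl (multmap Y)) Z e) <->
  (exists g : 'Hom(Y, Z), forall y c, rapp b (sz y c) = ract (g y) c - g (ract y c)).
Proof.
split=> [[d ->]|[g gE]].
  have L : linear (fun y : Y => rapp (d : rhom (btensk Y (breg C)) Z) (tens y (1 : breg C))).
    by move=> c x y; rewrite tens_linl rapp_linear.
  exists (mklin L) => y c; rewrite rapp_pre bker_inclE vsval_sz !(mklinE L).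
  rewrite (linf_sub (rapp_linear d)) -rapp_r; congr (rapp d _ - _).
  by rewrite (@ract_tens _ _ _ _ _ Y (breg C)) /= mul1r.
have [c e x y|y|h hE] := @hom_of_bilin k Y (breg C) Z (fun y c => ract (g y) c).
- by rewrite linearP ract_linl.
- exact: ract_linr.
have [|d dE] := @rhom_of _ _ _ _ (btensk Y (breg C)) Z h.
  move=> t c; have e : (h \o racth (btensk Y (breg C)) c = racth Z c \o h)%VF.
    apply: (tens_ext (V := Y) (W := breg C)) => y x.
    rewrite !comp_lfunE (@racthE _ _ _ (btensk Y (breg C))) racthE.
    by rewrite (@ract_tens _ _ _ _ _ Y (breg C)) !hE ractM.
  by move/lfunP/(_ t): e; rewrite !comp_lfunE !racthE.
exists d; apply: rapp_ext => z; rewrite (sz_span z) !rapp_sum; apply: eq_bigr => i _.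
rewrite rapp_pre bker_inclE vsval_sz gE dE linearB /= !hE ract1.
by [].
Qed.

End Symbols.

(* The elements of Hom_C(syz^2 DC, C) as 4-linear forms on DC x C x C x DC: the
   description is symmetric under the exchange of the left and the right. *)
Section Cocycles.
Variables (k : fieldType) (C : falgType k).
Let X : bimod C C := bdual (breg C).

Definition form4 := X -> C -> C -> X -> k^o.

(** [coc_eq] says that the alternating sum over the products of neighbours in the word (x, p, q, r,
    y) vanishes. Reversing the word only changes its overall sign. The conditions at 1 are the
    normalisation. *)
Record cocycle (f : form4) : Prop := Cocycle {
  coc1 : forall p q y, linear (fun x => f x p q y);
  coc2 : forall x q y, linear (fun p => f x p q y);
  coc3 : forall x p y, linear (fun q => f x p q y);
  coc4 : forall x p q, linear (fun y => f x p q y);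
  coc_one2 : forall x q y, f x 1 q y = 0;
  coc_one3 : forall x p y, f x p 1 y = 0;
  coc_eq : forall x p q r y,
    f x p q (lact r y) = f x p (q * r) y - f x (p * q) r y + f (ract x p) q r y }.

Definition coboundary (f : form4) : Prop := exists g : X -> C -> X -> k^o,
  [/\ forall p y, linear (fun x => g x p y), forall x y, linear (fun p => g x p y),
      forall x p, linear (g x p)
    & forall x p q y, f x p q y = g x p (lact q y) - g x (p * q) y + g (ract x p) q y].

Definition form_of (b : rhom (syz (syz X)) (breg C)) : form4 :=
  fun x p q y => (y : dualv C) (rapp b (sz (sz x p) q)).

Lemma form_of_linear c b b' x p q y :
  form_of (c *: b + b') x p q y = c *: form_of b x p q y + form_of b' x p q y.
Proof. by rewrite /form_of rapp_linearf linearP. Qed.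

Lemma form_of_cocycle b : cocycle (form_of b).
Proof.
have bl := rapp_linear b; split=> [p q y c x x'|x q y c p p'|x p y c q q'|x p q c y y'|x q y|x p y|].
- by rewrite /form_of sz_linl sz_linl bl linearP.
- by rewrite /form_of sz_linr sz_linl bl linearP.
- by rewrite /form_of sz_linr bl linearP.
- by rewrite /form_of add_lfunE scale_lfunE.
- by rewrite /form_of sz1 (linf0 (sz_linl q)) (linf0 bl) linear0.
- by rewrite /form_of sz1 (linf0 bl) linear0.
move=> x p q r y; rewrite /form_of (@bdual_lE _ _ _ (breg C)) -rapp_r sz_ract sz_ract.
rewrite (linf_sub (sz_linl r)) !(linf_sub bl) !linearB /=.
by rewrite opprK addrA.
Qed.

Lemma dual_eq (u v : C) : (forall y : dualv C, y u = y v) -> u = v.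
Proof.
move=> h; apply/eqP; rewrite -subr_eq0; apply/eqP/dual_sep => y.
by rewrite linearB /= h subrr.
Qed.

Definition drepr (f : X -> k^o) (hf : linear f) : C := ((evalv C)^-1 (mklin hf))%VF.

Lemma dreprE f (hf : linear f) (y : dualv C) : y (drepr hf) = f y.
Proof.
rewrite -evalvE limg_lfunVK; first exact: mklinE.
by rewrite (evalv_surj (mklin hf)); apply: memv_img; apply: memvf.
Qed.

(** The last variable runs over DC, so by reflexivity a form is a C-valued function of x, p, q.
    Normalisation in p and then the cocycle identity make it a C-linear map on the second syzygy. *)
Lemma form_of_surj f : cocycle f -> exists b, forall x p q y, form_of b x p q y = f x p q y.
Proof.
case=> h1 h2 h3 h4 h5 h6 h7; pose beta x p q : breg C := drepr (h4 x p q).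
have bE x p q (y : dualv C) : y (beta x p q) = f x p q y := dreprE (h4 x p q) y.
have b3 x p : linear (beta x p : C -> breg C).
  by move=> c q q'; apply: dual_eq => y; rewrite linearP /= !bE; exact: h3.
have [p c x x'|x c p p'|h hE] := @sz_lin _ _ _ X 'Hom(C, breg C) (fun x p => mklin (b3 x p)).
- apply/lfunP => q; rewrite add_lfunE scale_lfunE !mklinE.
  by apply: dual_eq => y; rewrite linearP /= !bE; exact: h1.
- apply/lfunP => q; rewrite add_lfunE scale_lfunE !mklinE.
  by apply: dual_eq => y; rewrite linearP /= !bE; exact: h2.
have hE' x p q : h (sz x p) q = beta x p q.
  rewrite hE add_lfunE opp_lfunE !mklinE [X in _ - X](_ : _ = 0) ?subr0 //.
  by apply: dual_eq => y; rewrite bE h5 linear0.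
have [q c s s'|s|s q r|b b0] := @sz_rhom _ _ _ (syz X) _ (breg C) (fun s q => h s q).
- by rewrite linearP add_lfunE scale_lfunE.
- exact: linearP.
- move: s; apply: sz_ext => [c s s'|c s s'|x p].
  + by rewrite linearP add_lfunE scale_lfunE ract_linl.
  + rewrite ract_linl !linearP !add_lfunE !scale_lfunE scalerBr.
    by rewrite opprD addrACA.
  rewrite sz_ract linearB add_lfunE opp_lfunE !hE'; apply: dual_eq => y.
  rewrite -(@bdual_lE _ _ _ (breg C)) !linearB /= !bE h7.
  by rewrite opprK addrA.
by exists b => x p q y; rewrite /form_of b0 hE' bE.
Qed.

Lemma form_of_coboundary b : coboundary (form_of b) <->
  bproj (im_stable (rhom_pre (bker_incl (multmap (syz X))) (breg C))) b = 0.
Proof.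
have bl := rapp_linear b.
split=> [[g [g1 g2 g3 gE]]|/bproj_im_ker hb].
  suff [d ->] : exists d, b = rhom_pre (bker_incl (multmap (syz X))) (breg C) d.
    rewrite -[RHS](bhom0 (bproj (im_stable (rhom_pre (bker_incl (multmap (syz X))) (breg C))))).
    by apply: bproj_im_eq; rewrite add0r.
  apply/sz_extends; pose G x p := drepr (g3 x p).
  have GE x p (y : dualv C) : y (G x p) = g x p y := dreprE (g3 x p) y.
  have [p c x x'|x c p p'|h hE] := @sz_lin _ _ _ X (breg C) G.
  - by apply: dual_eq => y; rewrite linearP /= !GE; exact: g1.
  - by apply: dual_eq => y; rewrite linearP /= !GE; exact: g2.
  have g0 x p y : g (ract x p) 1 y = 0.
    have := gE x p 1 y; rewrite lact1 mulr1 subrr add0r => <-.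
    exact: (coc_one3 (form_of_cocycle b)).
  have hE' x p (y : dualv C) : y (h (sz x p)) = g x p y.
    by rewrite hE linearB /= !GE g0 subr0.
  exists h => s q; move: s; apply: sz_ext => [c s s'|c s s'|x p].
  - by rewrite sz_linl bl.
  - rewrite (@ract_linl _ _ _ (syz X)) !(linearP h) (@ract_linl _ _ _ (breg C)) scalerBr opprD.
    exact: addrACA.
  apply: dual_eq => y; rewrite -[LHS]/(form_of b x p q y) gE.
  rewrite sz_ract !linearB /= -(@bdual_lE _ _ _ (breg C)) !hE'.
  by rewrite opprK addrA.
have /sz_extends[h hE] := hb; exists (fun x p y => (y : dualv C) (h (sz x p))).
split=> [p y c x x'|x y c p p'|x p c y y'|x p q y].
- by rewrite sz_linl !linearP.
- by rewrite sz_linr !linearP.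
- by rewrite add_lfunE scale_lfunE.
rewrite /form_of hE sz_ract !linearB /= -(@bdual_lE _ _ _ (breg C)).
by rewrite opprK addrA.
Qed.

End Cocycles.

(** * Reversal of words over an anti-isomorphism *)

Section Flip.
Variables (k : fieldType) (C C' : falgType k) (a : antiiso C C').

Definition flip (x : bdual (breg C)) : bdual (breg C') := ((x : dualv C) \o a)%VF.

Lemma flipE (x : bdual (breg C)) (c : C') : (flip x : dualv C') c = (x : dualv C) (a c).
Proof. exact: comp_lfunE. Qed.

Lemma flip_linear : linear flip.
Proof. exact: compr_lin. Qed.

Lemma flip_lact c x : flip (lact (a c) x) = ract (flip x) c.
Proof.
apply/lfunP => d; rewrite (@bdual_rE _ _ _ (breg C')) !flipE (@bdual_lE _ _ _ (breg C)).
by rewrite /= antiM.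
Qed.

Lemma flip_ract c x : flip (ract x (a c)) = lact c (flip x).
Proof.
apply/lfunP => d; rewrite (@bdual_lE _ _ _ (breg C')) !flipE (@bdual_rE _ _ _ (breg C)).
by rewrite /= antiM.
Qed.

End Flip.

Section FlipBack.
Variables (k : fieldType) (C C' : falgType k) (a : antiiso C C').
Let fl := flip (anti_inv a).

Lemma flip_back_lact c x : fl (lact c x) = ract (fl x) (a c).
Proof. by have := flip_lact (anti_inv a) (a c) x; rewrite [_ (a c)](antiK a). Qed.

Lemma flip_back_ract c x : fl (ract x c) = lact (a c) (fl x).
Proof. by have := flip_ract (anti_inv a) (a c) x; rewrite [_ (a c)](antiK a). Qed.

Lemma flip_backK x : fl (flip a x) = x.
Proof. by apply/lfunP => c; rewrite !flipE /= antiVK. Qed.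

(** The word (x, p, q, y) read backwards and moved to the other algebra. *)
Definition flip4 (f : form4 C) : form4 C' :=
  fun x p q y => f (fl y) (a q) (a p) (fl x).

Lemma flip4_cocycle f : cocycle f -> cocycle (flip4 f).
Proof.
have L := flip_linear (anti_inv a).
case=> h1 h2 h3 h4 h5 h6 h7; split=> [p q y c u v|x q y c u v|x p y c u v|x p q c u v|x q y|x p y|x p q r y]; rewrite /flip4.
- rewrite /fl L; exact: h4.
- rewrite linearP; exact: h3.
- rewrite linearP; exact: h2.
- rewrite /fl L; exact: h1.
- by rewrite anti1.
- by rewrite anti1.
have Q (u v w : k^o) : w = u - v + (v - u + w) by rewrite addrA -opprB addNr add0r.
rewrite flip_back_lact flip_back_ract h7 !antiM; exact: Q.
Qed.

Lemma flip4_coboundary f : coboundary f -> coboundary (flip4 f).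
Proof.
have L := flip_linear (anti_inv a).
case=> g [h1 h2 h3 h4]; exists (fun x p y => g (fl y) (a p) (fl x)).
split=> [p y c u v|x y c u v|x p c u v|x p q y].
- rewrite /fl L; exact: h3.
- rewrite linearP; exact: h2.
- rewrite /fl L; exact: h1.
rewrite /flip4 h4 antiM flip_back_lact flip_back_ract.
by rewrite addrC addrA addrAC.
Qed.

End FlipBack.

Lemma bcoker_surj (k : fieldType) (A B : falgType k) (X Y : bimod A B) (f : bhom X Y)
  (e : bcoker f) : exists y, bproj (im_stable f) y = e.
Proof. by exists (vrepr e); rewrite bprojE vpiK. Qed.

Section Class.
Variables (k : fieldType) (C : falgType k).
Let X : bimod C C := bdual (breg C).

Definition ext2cls : bhom (rhom (syz (syz X)) (breg C)) (rExt 2 X (breg C)) :=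
  bproj (im_stable (rhom_pre (bker_incl (multmap (syz X))) (breg C))).

Lemma ext2cls_surj e : exists b, ext2cls b = e.
Proof. exact: bcoker_surj. Qed.

Lemma ext2cls0 b : coboundary (form_of b) <-> ext2cls b = 0.
Proof. exact: form_of_coboundary. Qed.

Lemma form_of_lact c b x p q y :
  form_of (lact c b) x p q y = form_of b x p q (ract (y : bdual (breg C)) c).
Proof. by rewrite /form_of rapp_lact (@bdual_rE _ _ _ (breg C)). Qed.

Lemma form_of_ract c b (x : X) p q y : form_of (ract b c) x p q y = form_of b (lact c x) p q y.
Proof. by rewrite /form_of rapp_ract !sz_lact. Qed.

End Class.

Lemma coboundary_ext (k : fieldType) (C : falgType k) (f f' : form4 C) :
  (forall x p q y, f x p q y = f' x p q y) -> coboundary f -> coboundary f'.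
Proof. by move=> e [g [h1 h2 h3 h4]]; exists g; split=> // x p q y; rewrite -e h4. Qed.

(* Ext^2(DC, C) over right modules and over left modules, i.e. right modules over the
   opposite algebra C', agree. *)
Lemma ext2_balance (k : fieldType) (C C' : falgType k) (a : antiiso C C') :
  biso (amod (anti_k k) a (rforget (rExt 2 (bdual (breg C)) (breg C))))
       (lforget (rExt 2 (bdual (breg C')) (breg C'))).
Proof.
set E := rExt 2 (bdual (breg C)) (breg C); set E' := rExt 2 (bdual (breg C')) (breg C').
(* Two classes correspond if they have representatives whose forms are reversals of each other.
   Reversal preserves coboundaries in both directions, which gives [zS], hence well-definedness and
   injectivity at once. *)
pose S (e : E) (e' : E') := exists b b', [/\ ext2cls C b = e, ext2cls C' b' = e' &
  forall x p q y, form_of b' x p q y = flip4 a (form_of b) x p q y].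
have zS e e' : S e e' -> (e = 0 <-> e' = 0).
  move=> [b [b' [<- <- h]]]; split=> hb.
    apply/(ext2cls0 b').1; apply: (coboundary_ext _ (flip4_coboundary a ((ext2cls0 b).2 hb))).
    by move=> x p q y; rewrite h.
  apply/(ext2cls0 b).1.
  apply: (coboundary_ext _ (flip4_coboundary (anti_inv a) ((ext2cls0 b').2 hb))) => x p q y.
  by rewrite /flip4 h /flip4 /= !(antiVK a) !(flip_backK a).
have [|e|e' he'|h hE] := @functional_relation _ E E' S.
- move=> c e1 e2 e1' e2' [b1 [b1' [<- <- h1]]] [b2 [b2' [<- <- h2]]].
  exists (c *: b1 + b2), (c *: b1' + b2'); split.
  + exact: linearP.
  + exact: linearP.
  by move=> x p q y; rewrite /flip4 !form_of_linear h1 h2.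
- have [b <-] := ext2cls_surj e.
  have [b' b'E] := form_of_surj (flip4_cocycle a (form_of_cocycle b)).
  by exists (ext2cls C' b'), b, b'.
- exact/(zS _ _ he').
have tS e : S e (h e).
  have [b be] := ext2cls_surj e.
  have [b' b'E] := form_of_surj (flip4_cocycle a (form_of_cocycle b)).
  have s : S e (ext2cls C' b') by exists b, b'.
  by rewrite -(hE _ _ s).
have rS e c : h (ract e (a c)) = lact c (h e).
  have [b [b' [be b'e hb]]] := tS e; symmetry; apply: hE; exists (ract b (a c)), (lact c b').
  split; [by rewrite bhomr be|by rewrite bhoml b'e|] => x p q y.
  by rewrite form_of_lact hb /flip4 form_of_ract flip_back_ract.
have [||f fE] := @bhom_of _ _ _ (amod (anti_k k) a (rforget E)) (lforget E') h.
- by move=> c x; exact: rS.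
- move=> x c; rewrite (@kright _ _ (amod (anti_k k) a (rforget E))).
  by rewrite (@kright _ _ (lforget E')); exact: linearZ.
exists f; split.
  by apply/injP => x; rewrite fE => hx; exact/(zS _ _ (tS x)).
apply/surjP => e'; have [b' <-] := ext2cls_surj e'.
have [b bE] := form_of_surj (flip4_cocycle (anti_inv a) (form_of_cocycle b')).
exists (ext2cls C b); rewrite fE; apply: hE; exists b, b'; split=> // x p q y.
by rewrite /flip4 bE /flip4 !(flip_backK (anti_inv a)) /= !(antiK a).
Qed.

(** * Ext^2(DC, C) for a tilted algebra C *)

Record tilting_bimod (k : fieldType) (A C : falgType k) (T : bimod C A) : Prop := TiltingBimod {
  tb_hered : hered_sub k^o A;
  tb_rigid : ext1z (rforget T) (rforget T);
  tb_full : forall g : 'Hom(T, T), rlin (X := T) (Y := T) g -> exists c, forall t, g t = lact c t;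
  tb_faithful : forall c : C, (forall t : T, lact c t = 0) -> c = 0 }.

Lemma cogenerated_iso (k : fieldType) (A C A' : falgType k) (T : bimod C A) (Y Z : bimod A' C) :
  biso Y Z -> cogenerated T Z -> cogenerated T Y.
Proof.
move=> [f [/injP fi _]] hZ y hy; apply/fi/hZ => chi hchi.
have := hy (chi \o f)%VF; rewrite comp_lfunE; apply=> x c.
by rewrite !comp_lfunE bhomr hchi.
Qed.

(** A left linear map theta : T -> F dualises to DF -> DT; a functional killed by all these
    transposes vanishes on everything that T generates in F. *)
Lemma cogenerated_dual_lforget (k : fieldType) (A C B : falgType k) (T : bimod C A) (F : bimod C B) :
  (forall lam : dualv F, (forall theta : 'Hom(T, F), llin (X := T) (Y := F) theta ->
     forall t, lam (theta t) = 0) -> lam = 0) -> cogenerated T (bdual (lforget F)).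
Proof.
move=> G lam h; apply: G => theta htheta t.
have := h (mklin (@compr_lin k T F k^o theta)).
rewrite mklinE => /(_ _)/lfunP/(_ t); rewrite comp_lfunE zero_lfunE; apply=> phi c.
apply/lfunP => u; rewrite (@bdual_rE _ _ _ T) !(mklinE (compr_lin theta)).
rewrite (comp_lfunE (ract phi c : dualv F) theta) (comp_lfunE (phi : dualv F) theta).
by rewrite (@bdual_rE _ _ _ (lforget F)) -htheta.
Qed.
Lemma rExt2E (k : fieldType) (A B C : falgType k) (X : bimod A B) (Y : bimod C B) :
 rExt 2 X Y = rExt 1 (syz X) Y.
Proof. unfold rExt. simpl iter. reflexivity. Qed.

Section Ext2.
Variables (k : fieldType) (A C : falgType k) (T : bimod C A).
Hypothesis hT : tilting_bimod T.
Let X : bimod C C := bdual (breg C).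
Let E : bimod C C := rExt 2 X (breg C).

Lemma ext2_cogenerated : cogenerated T (bdual (lforget E)).
Proof.
rewrite /E rExt2E; apply: cogenerated_dual_lforget.
exact: (rExt1_generated (tb_hered hT) (tb_rigid hT) (tb_full hT) (tb_faithful hT)
  (syz_cogenerated (tb_faithful hT) (X := X))).
Qed.

Lemma ext2_dual_pd : pd_le1 (bdual (lforget E)).
Proof.
exact: (cogenerated_pd (tb_hered hT) (tb_rigid hT) (tb_full hT)
  (tb_faithful hT) ext2_cogenerated).
Qed.

Lemma ext2_rigid : ext1z (lforget E) (lforget E).
Proof.
apply: rExt2_rigid; first exact: dual_reg_injective.
apply: (syz_rdual_basis (tb_hered hT) (tb_rigid hT) (tb_full hT)
  (tb_faithful hT)).
exact: (syz_cogenerated (tb_faithful hT)).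
Qed.

End Ext2.

Section AmodIso.
Variables (k : fieldType) (A A' B B' : falgType k) (a : antiiso A A') (b : antiiso B B').
Variable X : bimod A B.

Lemma amod_dual_iso : biso (bdual (amod a b X)) (amod b a (bdual X)).
Proof.
have [c phi|phi c|g gE] := @bhom_of _ _ _ (bdual (amod a b X)) (amod b a (bdual X)) \1%VF.
- rewrite !id_lfunE; apply/lfunP => x.
  exact: etrans (@bdual_lE _ _ _ (amod a b X) c phi x) (esym (@bdual_rE _ _ _ X (a c) phi x)).
- rewrite !id_lfunE; apply/lfunP => x.
  exact: etrans (@bdual_rE _ _ _ (amod a b X) c phi x) (esym (@bdual_lE _ _ _ X (b c) phi x)).
exists g; split; first by apply/injP => x; rewrite gE id_lfunE.
by apply/surjP => x; exists x; rewrite gE id_lfunE.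
Qed.

Lemma amod_lforget_iso : biso (amod a (anti_k k) (lforget X)) (rforget (amod a b X)).
Proof.
have [|g gE] := @rbhom _ _ (amod a (anti_k k) (lforget X)) (rforget (amod a b X)) \1%VF.
  by move=> x c; rewrite !id_lfunE.
exists g; split; first by apply/injP => x; rewrite gE id_lfunE.
by apply/surjP => x; exists x; rewrite gE id_lfunE.
Qed.

End AmodIso.

(** An endomorphism of DT as a left A-module is the transpose of an endomorphism of the right module
    T, so it is again given by C; rigidity passes over by duality of Ext^1. *)
Lemma tilting_bimod_op (k : fieldType) (A C A' C' : falgType k) (T : bimod C A)
  (a : antiiso A A') (c : antiiso C C') :
  hered_sub k^o A' -> tilting_bimod T -> tilting_bimod (amod a c (bdual T)).
Proof.
move=> hA' [hA hT hE hF]; split=> //.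
- apply: (ext1z_iso_l (amod_lforget_iso a c (bdual T))).
  apply: (ext1z_iso_r (amod_lforget_iso a c (bdual T))).
  apply: amod_ext1z; apply: (ext1z_iso_l (dual_rforget_iso T)).
  apply: (ext1z_iso_r (dual_rforget_iso T)); exact: ext1z_dual.
- move=> g hg; have [e phi|g' gE] := @lbhom _ _ (bdual (rforget T)) (bdual (rforget T)) g.
    have := hg phi (antiV a e); rewrite (@amod_rE _ _ _ _ _ a c (bdual T)) antiVK.
    by rewrite (@amod_rE _ _ _ _ _ a c (bdual T)) antiVK.
  have [g1 g1E] := dual_transpose g'.
  have [|d dE] := hE (g1 : 'Hom(T, T)); first by move=> t e; exact: (bhomr g1).
  exists (antiV c d) => phi; rewrite (@amod_lE _ _ _ _ _ a c (bdual T)) antiVK.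
  rewrite -gE -g1E; apply/lfunP => t.
  by have := @dualhE _ _ _ (rforget T) (rforget T) g1 phi t; rewrite (@bdual_rE _ _ _ T) -dE.
move=> d h; apply: (can_inj (antiK c)); rewrite linear0; apply: hF => t.
apply: dual_sep => phi; have := h phi; rewrite amod_lE => /lfunP/(_ t).
by rewrite (@bdual_rE _ _ _ T) zero_lfunE.
Qed.

Lemma biso_trans (k : fieldType) (A B : falgType k) (X Y Z : bimod A B) :
  biso X Y -> biso Y Z -> biso X Z.
Proof.
move=> [f [/injP f1 /surjP f2]] [g [/injP g1 /surjP g2]]; exists (bcomp g f); split.
  by apply/injP => x; rewrite bcompE => /g1/f1.
by apply/surjP => z; have [y ->] := g2 z; have [x ->] := f2 y; exists x; rewrite bcompE.
Qed.

(** Reflexivity: the dual of [amod a c (bdual T)] is DDT = T, so maps from L to it are maps from L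
    to T. *)
Lemma lcogenerated_of_dual (k : fieldType) (A C A' C' : falgType k) (T : bimod C A)
  (a : antiiso A A') (c : antiiso C C') (L : lmod C) :
  cogenerated (amod a c (bdual T)) (amod c (anti_k k) L) -> lcogenerated T L.
Proof.
move=> h l hl; apply: (h l) => chi hchi.
have ev : forall F : dualv (dualv T), evalv T ((evalv T)^-1%VF F) = F.
  move=> F; rewrite limg_lfunVK // [F]evalv_surj; apply: memv_img; exact: memvf.
have evi : forall x y : T, evalv T x = evalv T y -> x = y.
  move=> x y e; apply/eqP; rewrite -subr_eq0; apply/eqP/dual_sep => phi.
  by rewrite linearB /= -(evalvE x phi) -(evalvE y phi) e subrr.
pose chi' : 'Hom(L, T) := ((evalv T)^-1 \o (chi : 'Hom(L, dualv (dualv T))))%VF.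
have chiE x phi : (phi : dualv T) (chi' x) = (chi x : dualv (dualv T)) phi.
  by rewrite -(evalvE (chi' x) phi) /chi' comp_lfunE ev.
have [|u uE] := @lhom_of _ _ _ _ L T chi'.
  move=> d x; apply: evi; apply/lfunP => phi; rewrite !evalvE chiE.
  have e := hchi x (antiV c d); rewrite (@amod_rE _ _ _ _ _ c (anti_k k) L) antiVK in e.
  rewrite e (@bdual_rE _ _ _ (amod a c (bdual T))) (@amod_lE _ _ _ _ _ a c (bdual T)).
  by rewrite antiVK -chiE (@bdual_rE _ _ _ T).
by apply/lfunP => phi; rewrite -chiE -uE hl linear0 zero_lfunE.
Qed.

Section Both.
Variables (k : fieldType) (A C A' C' : falgType k) (T : bimod C A).
Variables (a : antiiso A A') (c : antiiso C C').
Hypothesis hT : tilting_bimod T.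
Hypothesis hA' : hered_sub k^o A'.
Let E : bimod C C := rExt 2 (bdual (breg C)) (breg C).
Let E' : bimod C' C' := rExt 2 (bdual (breg C')) (breg C').
Let hT' := tilting_bimod_op a c hA' hT.
Let bal : biso (amod (anti_k k) c (rforget E)) (lforget E') := ext2_balance c.

Lemma ext2_dual_op : biso (amod c (anti_k k) (bdual (rforget E))) (bdual (lforget E')).
Proof.
apply: biso_trans (biso_sym (amod_dual_iso (anti_k k) c (rforget E))) _.
exact: biso_dual (biso_sym bal).
Qed.

Lemma ext2_lcogenerated : lcogenerated T (bdual (rforget E)).
Proof.
apply: (lcogenerated_of_dual (a := a) (c := c)).
apply: cogenerated_iso ext2_dual_op _; exact: ext2_cogenerated.
Qed.

Lemma ext2_ldual_pd : pd_le1 (bdual (rforget E)).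
Proof.
apply: (pd_amod (a := c) (b := anti_k k)).
apply: pd_le1_iso (biso_sym ext2_dual_op) _; exact: ext2_dual_pd hT'.
Qed.

Lemma ext2_rrigid : ext1z (rforget E) (rforget E).
Proof.
apply: (ext1z_amod (a := anti_k k) (b := c)).
apply: ext1z_iso_l (biso_sym bal) _; apply: ext1z_iso_r (biso_sym bal) _.
exact: ext2_rigid hT'.
Qed.

Lemma ext2_cross : ext1z (bdual (lforget E)) (rforget E).
Proof.
apply: (ext1z_iso_r (biso_sym (beval_iso (rforget E)))).
exact: (ext1z_cogenerated (tb_hered hT) (tb_rigid hT) (tb_full hT) (tb_faithful hT)
  (ext2_cogenerated hT) ext2_lcogenerated).
Qed.

End Both.

(** * Induced and coinduced modules *)

Section Induced.
Variables (k : fieldType) (C : falgType k) (E : bimod C C).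
Let B : falgType k := trivext E.
Let M : rmod C := bdual (lforget E).
Hypothesis hpd : pd_le1 M.
Hypothesis hMM : ext1z M M.
Hypothesis hME : ext1z M (rforget E).

Let f : 'Hom(C, B) := linfun (@te_incl k C E).
Let fE x : f x = te_incl E x. Proof. exact: lfunE. Qed.
Let f1 : f 1 = 1. Proof. by rewrite fE. Qed.
Let fM x y : f (x * y) = f x * f y. Proof. by rewrite !fE rmorphM. Qed.

Let RB : bimod C B := lrestrict (@te_incl k C E) (breg B).
Let N : rmod B := btens M RB.

Lemma te_inr_linear : linear (fun e : E => (0, e) : B).
Proof. by move=> x e e'; congr (_, _); rewrite /= scaler0 addr0. Qed.
Lemma te_fst_linear : linear (fun b : B => b.1).
Proof. by []. Qed.
Lemma te_snd_linear : linear (fun b : B => b.2).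
Proof. by []. Qed.

Let eta : 'Hom(M, N) := mklin (btens_elt_linl (X := M) (1 : RB)).

Let etaE m : eta m = btens_elt m (1 : RB). Proof. exact: mklinE. Qed.

Let eta_slin : slin f eta.
Proof.
move=> m x; rewrite !etaE btens_eltP -btens_elt_r; congr btens_elt.
by rewrite fE /= mulr1 mul1r.
Qed.

Let eta_univ (Z : rmod B) (z : 'Hom(M, Z)) : slin f z ->
  exists h : bhom N Z, forall m, h (eta m) = z m.
Proof.
move=> hz.
have [b u x y|m|m x b|x m b|m b d|h hE] := @btens_univ _ _ _ _ M RB Z (fun m b => ract (z m) b).
- by rewrite linearP ract_linl.
- exact: ract_linr.
- by rewrite hz -ractM fE.
- by rewrite !kleft linearZ /= ractZ.
- exact: ractM.
by exists h => m; rewrite etaE hE ract1.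
Qed.

Let eta_gen (y : N) : exists t : 'Hom(dualv M, B),
  y = \sum_(i < \dim {:M}) ract (eta (vbasis {:M})`_i) (t (vcoord i)).
Proof.
have [u ->] := btens_gen y; exists u; apply: eq_bigr => i _.
by rewrite etaE -btens_elt_r; congr btens_elt; rewrite /= mul1r.
Qed.

Lemma induced_pd : pd_le1 (induced E M).
Proof.
rewrite -[induced E M]/N; refine (universal_pd (f1 := f1) (fM := fM) eta_slin eta_univ eta_gen hpd _).
(* The complement of C in B is E, whose dual is M itself, so the condition on DB reduces to Ext^1(M,
   M) = 0. *)
apply: (@ext1z_res_dual _ _ _ f f1 fM M (lforget E) (mklin te_inr_linear)
  (mklin te_fst_linear) (mklin te_snd_linear)) => // [x b|x b|x|x|e|b].
- by rewrite !(mklinE te_fst_linear) fE.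
- by rewrite !(mklinE te_snd_linear) fE /= ract0 addr0.
- by rewrite (mklinE te_fst_linear) fE.
- by rewrite (mklinE te_snd_linear) fE.
- by rewrite (mklinE te_snd_linear) (mklinE te_inr_linear).
rewrite (mklinE te_fst_linear) (mklinE te_snd_linear) (mklinE te_inr_linear) fE.
by case: b => x e; congr (_, _); rewrite /= ?addr0 ?add0r.
Qed.

Lemma induced_rigid : ext1z (induced E M) (induced E M).
Proof.
rewrite -[induced E M]/N; refine (universal_ext (f1 := f1) (fM := fM) eta_slin eta_univ eta_gen _).
refine (@universal_ext_res _ _ _ f f1 fM M N eta eta_slin eta_gen (rforget E)
  (mklin te_inr_linear) _ _ hpd hMM hME).
  move=> e x; rewrite !(mklinE te_inr_linear) fE; congr (_, _) => /=; first by rewrite mul0r.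
  by rewrite lact0l add0r.
move=> b; exists b.1, b.2; rewrite fE (mklinE te_inr_linear).
by case: b => x e; congr (_, _); rewrite /= ?addr0 ?add0r.
Qed.

End Induced.

Lemma hom_vcoord (k : fieldType) (V W : vectType k) (w : 'I_(\dim {:V}) -> W) :
  exists t : 'Hom(dualv V, W), forall i, t (vcoord i) = w i.
Proof.
have L : linear (fun phi : dualv V => \sum_(i < \dim {:V}) (phi (vbasis {:V})`_i : k) *: w i).
  move=> x u v; rewrite scaler_sumr -big_split; apply: eq_bigr => i _ /=.
  by rewrite add_lfunE scale_lfunE scalerDl scalerA.
exists (mklin L) => i; rewrite mklinE (bigD1 i) //= big1 ?addr0 => [|j ji].
  by rewrite vcoordE coord_free ?(basis_free (vbasisP _)) // eqxx scale1r.
by rewrite vcoordE coord_free ?(basis_free (vbasisP _)) // (negbTE ji) scale0r.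
Qed.

Section Coinduced.
Variables (k : fieldType) (C : falgType k) (E : bimod C C).
Let B : falgType k := trivext E.
Variables (C' B' : falgType k) (cC : antiiso C C') (cB : antiiso B B').
Let L : lmod C := bdual (rforget E).
Hypothesis hpd : pd_le1 L.
Hypothesis hLL : ext1z L L.
Hypothesis hLE : ext1z L (lforget E).

(** The inclusion of C in B, seen between the opposite algebras. With the left modules L and B (x)_C
    L turned into right modules M and N over them, N is universal for M along f. *)
Let f : 'Hom(C', B') := (antiV cB \o (linfun (@te_incl k C E) \o cC))%VF.
Let VM (x y : B) : antiV cB (x * y) = antiV cB y * antiV cB x.
Proof. exact: (antiM (anti_inv cB)). Qed.
Let V1 : antiV cB 1 = 1. Proof. exact: (anti1 (anti_inv cB)). Qed.
Let fE x : f x = antiV cB (te_incl E (cC x)). Proof. by rewrite 2!comp_lfunE lfunE. Qed.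
Let f1 : f 1 = 1.
Proof. by rewrite fE anti1 V1. Qed.
Let fM x y : f (x * y) = f x * f y.
Proof. by rewrite !fE antiM rmorphM VM. Qed.

Let RB : bimod B C := rrestrict (@te_incl k C E) (breg B).
Let NB : lmod B := btens RB L.
Let M : rmod C' := amod cC (anti_k k) L.
Let N : rmod B' := amod cB (anti_k k) NB.

Let eta : 'Hom(M, N) := mklin (btens_elt_linr (Y := L) (1 : RB)).
Let etaE m : eta m = btens_elt (1 : RB) (m : L). Proof. exact: mklinE. Qed.

Let eta_slin : slin f eta.
Proof.
move=> m x; rewrite !etaE (@amod_rE _ _ _ _ _ cC (anti_k k) L) -btens_eltP.
rewrite (@amod_rE _ _ _ _ _ cB (anti_k k) NB) fE antiVK -btens_elt_l; congr btens_elt.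
by rewrite /= mulr1 mul1r.
Qed.

Let eta_univ (Z : rmod B') (z : 'Hom(M, Z)) : slin f z ->
  exists h : bhom N Z, forall m, h (eta m) = z m.
Proof.
move=> hz.
have [m b u v|x b u v|b x m|b x m|b m d|h hE] := @btens_univ _ _ _ _ RB L
  (amod (anti_inv (anti_k k)) (anti_inv cB) Z) (fun b m => ract (z m) (antiV cB b)).
- by rewrite linearP ract_linr.
- by rewrite linearP ract_linl.
- rewrite [antiV cB _]VM ractM; congr (@ract _ _ _ Z _ (antiV cB b)).
  by have := hz m (antiV cC x); rewrite (@amod_rE _ _ _ _ _ cC (anti_k k) L) antiVK fE antiVK.
- by rewrite [antiV cB _]VM ractM.
- by rewrite (@kright _ _ (amod (anti_inv (anti_k k)) (anti_inv cB) Z)) kright linearZ /= ractZ.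
have [g gE] := amod_adjl' h; exists g => m.
by rewrite gE etaE hE V1 ract1.
Qed.

Let eta_gen (y : N) : exists t : 'Hom(dualv M, B'),
  y = \sum_(i < \dim {:M}) ract (eta (vbasis {:M})`_i) (t (vcoord i)).
Proof.
have [u uE] := btens_gen_r (y : NB).
have [t tE] := @hom_vcoord _ L _ (fun i => antiV cB (u i)).
exists t; rewrite [LHS]uE; apply: eq_bigr => i _.
rewrite tE etaE (@amod_rE _ _ _ _ _ cB (anti_k k) NB) antiVK -btens_elt_l.
by congr btens_elt; rewrite /= mulr1.
Qed.

Lemma coinduced_pd : pd_le1 (bdual (coinduced E (rforget E))).
Proof.
apply: pd_le1_iso (beval_iso NB) _; apply: (pd_amod (a := cB) (b := anti_k k)).
rewrite -/N; refine (universal_pd (f1 := f1) (fM := fM) eta_slin eta_univ eta_gen _ _).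
  exact: amod_pd.
have iB : linear (fun e : E => antiV cB ((0, e) : B)).
  by move=> x u v; rewrite te_inr_linear linearP.
have pB : linear (fun b : B' => antiV cC (cB b).1).
  by move=> x u v; rewrite linearP linearP.
have qB : linear (fun b : B' => (cB b).2).
  by move=> x u v; rewrite linearP.
apply: (@ext1z_res_dual _ _ _ f f1 fM M (amod (anti_k k) cC (rforget E)) (mklin iB)
  (mklin pB) (mklin qB)) => // [x b|x b|x|x|e|b|].
- rewrite !(mklinE pB) antiM fE antiVK /= (antiM (anti_inv cC)) /=.
  by rewrite antiK.
- by rewrite !(mklinE qB) antiM fE antiVK /= lact0 add0r.
- by rewrite (mklinE pB) fE antiVK /= antiK.
- by rewrite (mklinE qB) fE antiVK.
- by rewrite (mklinE qB) (mklinE iB) antiVK.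
- rewrite (mklinE pB) (mklinE qB) (mklinE iB) fE antiVK -linearD /=.
  rewrite -[LHS](antiK cB); congr (antiV cB _); case: (cB b) => x e.
  by congr (_, _); rewrite /= ?addr0 ?add0r.
apply: ext1z_iso_r (biso_sym (amod_dual_iso (anti_k k) cC (rforget E))) _.
exact: amod_ext1z.
Qed.

Lemma coinduced_rigid :
  ext1z (bdual (coinduced E (rforget E))) (bdual (coinduced E (rforget E))).
Proof.
apply: ext1z_iso_l (beval_iso NB) _; apply: ext1z_iso_r (beval_iso NB) _.
apply: (ext1z_amod (a := cB) (b := anti_k k)).
rewrite -/N; refine (universal_ext (f1 := f1) (fM := fM) eta_slin eta_univ eta_gen _).
have iB : linear (fun e : E => antiV cB ((0, e) : B)).
  by move=> x u v; rewrite te_inr_linear linearP.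
refine (@universal_ext_res _ _ _ f f1 fM M N eta eta_slin eta_gen (amod cC (anti_k k) (lforget E))
  (mklin iB) _ _ _ _ _).
- move=> e x; rewrite !(mklinE iB) (@amod_rE _ _ _ _ _ cC (anti_k k) (lforget E)) fE -VM.
  congr (antiV cB _); congr (_, _); first by rewrite /= mulr0.
  by rewrite /= ract0r addr0.
- move=> b; exists (antiV cC (cB b).1), (cB b).2; rewrite (mklinE iB) fE antiVK -linearD /=.
  rewrite -[LHS](antiK cB); congr (antiV cB _); case: (cB b) => x e.
  by congr (_, _); rewrite /= ?addr0 ?add0r.
- exact: amod_pd.
- exact: amod_ext1z.
exact: amod_ext1z.
Qed.

End Coinduced.

(** * From a tilted algebra to the tilting bimodule, and the conclusion *)

Lemma endalg_bimod (k : fieldType) (A C : falgType k) (T0 : rmod A) :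
  hered_sub k^o A -> bzero (rExt 1 T0 T0) -> is_endalg T0 C ->
  exists T : bimod C A, tilting_bimod T.
Proof.
move=> hA /ext1z_rExt hT [phi [/injP phi0 phi_im phi1 phiM]].
have phi_r c : rlin (phi c : 'Hom(T0, T0)).
  by apply/rhomvP; rewrite -phi_im; apply: memv_img; apply: memvf.
have ll x : linear (fun c : C => phi c x : T0).
  by move=> e c d; rewrite linearP add_lfunE scale_lfunE.
have lr c : linear (phi c : T0 -> T0) by move=> e x y; rewrite linearP.
have l1 (x : T0) : phi 1 x = x by rewrite phi1 id_lfunE.
have lM c d (x : T0) : phi (c * d) x = phi c (phi d x) by rewrite phiM comp_lfunE.
pose T := @Bimod k C A T0 (fun c x => phi c x) (fun x b => ract x b) ll lr
  (@ract_linl _ _ _ T0) (@ract_linr _ _ _ T0) l1 lM (@ract1 _ _ _ T0) (@ractM _ _ _ T0) phi_r.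
exists T; split=> //.
- have [|g gE] := @rbhom _ _ T0 (rforget T) \1%VF; first by move=> x b; rewrite !id_lfunE.
  have hg : biso T0 (rforget T).
    exists g; split; first by apply/injP => x; rewrite gE id_lfunE.
    by apply/surjP => x; exists x; rewrite gE id_lfunE.
  by apply: (ext1z_iso_l hg); apply: (ext1z_iso_r hg).
- move=> g hg; have : (g : 'End(T0)) \in limg phi by rewrite phi_im; apply/rhomvP.
  by case/memv_imgP=> c _ ->; exists c.
by move=> c hc; apply: phi0; apply/lfunP => x; rewrite zero_lfunE; exact: hc.
Qed.

Lemma tilted_bimod (k : fieldType) (C : falgType k) : tilted C ->
  exists (A A' : falgType k) (a : antiiso A A') (T : bimod C A),
    tilting_bimod T /\ hered_sub k^o A'.
Proof.
move=> [Q [T0 [hQ _ [[_ hT] _] _ hC]]]; have hA := @pathalg_hereditary k Q hQ.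
have [T TT] := endalg_bimod (hered_quot_sub hA) hT hC.
exists (pathalg k Q), (opalg (pathalg k Q)), (anti_op (pathalg k Q)), T; split=> //.
exact: (amod_hered (anti_op (pathalg k Q)) (anti_k k) (hered_quot_dual hA)).
Qed.

Lemma partial_tilting_of_ext (k : fieldType) (A : falgType k) (M : rmod A) :
  pd_le1 M -> ext1z M M -> partial_tilting M /\ tau_rigid M.
Proof. by move=> h1 h2; split; [split=> //; apply/ext1z_rExt|exact: tau_rigid_of_ext]. Qed.

Lemma partial_cotilting_of_ext (k : fieldType) (A : falgType k) (M : rmod A) :
  pd_le1 (bdual M) -> ext1z (bdual M) (bdual M) -> partial_cotilting M /\ tau_corigid M.
Proof.
move=> h1 h2; split; last exact: tau_corigid_of_ext.
have i := biso_sym (beval_iso M).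
split; first exact: id_le1_iso i (pd_dual h1).
by apply/ext1z_rExt; apply: (ext1z_iso_l i); apply: (ext1z_iso_r i); exact: ext1z_dual.
Qed.

Theorem theorem1p1 (k : closedFieldType) (C : falgType k) (hC : tilted C) :
  let E : bimod C C := rExt 2 (bdual (breg C)) (breg C) in
  let DE : rmod C := bdual (lforget E) in
  let EC : rmod C := rforget E in
  (partial_tilting DE /\ tau_rigid DE /\
   partial_tilting (induced E DE) /\ tau_rigid (induced E DE)) /\
  (partial_cotilting EC /\ tau_corigid EC /\
   partial_cotilting (coinduced E EC) /\ tau_corigid (coinduced E EC)).
Proof.
move=> E DE EC; have [A [A' [a [T [hT hA']]]]] := tilted_bimod hC.
have pdDE : pd_le1 DE := ext2_dual_pd hT.
have extDE : ext1z DE DE := ext1z_dual (ext2_rigid hT).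
have cross : ext1z DE EC := ext2_cross a (anti_op C) hT hA'.
have pdDEC : pd_le1 (bdual EC) := ext2_ldual_pd a (anti_op C) hT hA'.
have extEC : ext1z (bdual EC) (bdual EC) := ext1z_dual (ext2_rrigid a (anti_op C) hT hA').
(* The coinduced side needs the left-module form of the mixed vanishing, which is the dual of
   [cross]. *)
have cross' : ext1z (bdual EC) (lforget E).
  exact: (ext1z_iso_r (biso_sym (beval_iso (lforget E))) (ext1z_dual cross)).
have [t1 t2] := partial_tilting_of_ext pdDE extDE.
have [t3 t4] := partial_tilting_of_ext (induced_pd pdDE extDE) (induced_rigid pdDE extDE cross).
have [c1 c2] := partial_cotilting_of_ext pdDEC extEC.
have [c3 c4] := partial_cotilting_of_ext
  (coinduced_pd (anti_op C) (anti_op (trivext E)) pdDEC extEC)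
  (coinduced_rigid (anti_op C) (anti_op (trivext E)) pdDEC extEC cross').
by [].
Qed.
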